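(* Let $\alpha=(\alpha_1,\alpha_2,\ldots,\alpha_\ell)$ be a pseudo-composition of $n$. Then there are isomorphisms of $\mathcal H^B_n(0)$-modules $$\mathbf M^B_\alpha\ \cong\ \left(\mathbf P^B_{\alpha_1}\otimes\mathbf P_{\alpha_2}\otimes\cdots\otimes\mathbf P_{\alpha_\ell}\right)\uparrow_{\mathcal H^B_\alpha(0)}^{\mathcal H^B_n(0)}\ \cong\ \bigoplus_{\beta\preccurlyeq\alpha}\mathbf P^B_\beta .$$
   Context: $\mathbb F$ is an arbitrary field. $\mathfrak S^B_n$ is the group of signed permutations $w$ of $\{\pm1,\ldots,\pm n\}$ ($w(-i)=-w(i)$), written as words $w(1)\cdots w(n)$, with Coxeter generators $s_0=\bar12\cdots n$ and $s_i=(i,i+1)(-i,-(i+1))$, $1\le i\le n-1$ (type $B_n$). $\mathcal H^B_n(0)$ is the $\mathbb F$-algebra generated by $\pi_0,\ldots,\pi_{n-1}$ with $\pi_i^2=\pi_i$ and the braid relations of $\mathfrak S^B_n$; $\overline\pi_i:=\pi_i-1$; $\mathcal H^B_0(0)=\mathbb F$. $\mathcal H_m(0)$ is the analogous type A algebra, generated by $\pi_1,\ldots,\pi_{m-1}$. A pseudo-composition of $n$ is a sequence $\alpha=(\alpha_1,\ldots,\alpha_\ell)$, $\ell\ge1$, with $\alpha_1\ge0$, $\alpha_2,\ldots,\alpha_\ell>0$ and sum $n$. $D(\alpha)=\{\alpha_1,\alpha_1+\alpha_2,\ldots,\alpha_1+\cdots+\alpha_{\ell-1}\}\subseteq\{0,\ldots,n-1\}$.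 For pseudo-compositions of the same size, $\beta\preccurlyeq\alpha$ means $D(\beta)\subseteq D(\alpha)$. A composition (sequence of positive integers) is identified with its ribbon diagram: rows of lengths its parts, from bottom to top, the last box of each row directly below the first box of the next row up. A pseudo-composition is identified with its pseudo-ribbon diagram: if $\alpha_1>0$, take the ribbon of $\alpha$ and add an extra box containing $0$ (the 0-box) to the left of the bottom row; if $\alpha_1=0$, take the ribbon of $(\alpha_2,\ldots,\alpha_\ell)$ and add the 0-box directly below the leftmost (lowest) box; $(0)$ is the 0-box alone. A generalized pseudo-ribbon $\alpha^1\oplus\cdots\oplus\alpha^k$ is a skew diagram with connected components $\alpha^1$ (a pseudo-ribbon) and $\alpha^2,\ldots,\alpha^k$ (ribbons), with $\alpha^{i+1}$ strictly northeast of $\alpha^i$; its size is the number of boxes other than the 0-box. A (type B) standard tableau of generalized pseudo-ribbon shape $\gamma$ of size $n$ is a filling $\tau$ of the boxes other than the 0-box with elements of $\{\pm1,\ldots,\pm n\}$ such that rows increase left to right and columns increase top to bottom, the entry $0$ of the 0-box included, and such that the reading word $w(\tau)$ (rows read from bottom to top, each left to right, omitting the 0-box) is a signed permutation in $\mathfrak S^B_n$. Let $s_0(\tau)$ be $\tau$ with the entry $\pm1$ negated; for $i\ge1$ let $s_i(\tau)$ be $\tau$ with the absolute values of $\pm i$ and $\pm(i+1)$ swapped, signs in their positions unchanged. Say $0$ is a descent of $\tau$ if $-1$ appears in $\tau$; say $i\ge1$ is a descent of $\tau$ if: $i$ and $i+1$ both appear with $i$ in a higher row than $i+1$; or $-i$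 and $-(i+1)$ both appear with $-i$ in a lower row than $-(i+1)$; or $i$ and $-(i+1)$ both appear. $\mathbf P^B_\gamma$ is the $\mathcal H^B_n(0)$-module with $\mathbb F$-basis the standard tableaux of shape $\gamma$ and $\overline\pi_i(\tau)=-\tau$ if $i$ is a descent of $\tau$; $\overline\pi_i(\tau)=0$ if $i$ is not a descent and $s_i(\tau)$ is not standard; $\overline\pi_i(\tau)=s_i(\tau)$ otherwise. For a pseudo-composition $\alpha=(\alpha_1,\ldots,\alpha_\ell)$, $\mathbf M^B_\alpha:=\mathbf P^B_{\alpha_1\oplus\cdots\oplus\alpha_\ell}$, where $\alpha_1$ is viewed as the one-part pseudo-ribbon $(\alpha_1)$ and each other $\alpha_i$ as a one-row ribbon. For $i\ge2$, $\mathbf P_{\alpha_i}$ is the one-dimensional $\mathcal H_{\alpha_i}(0)$-module on which all $\overline\pi_j$ act by $0$. $\mathcal H^B_\alpha(0)\cong\mathcal H^B_{\alpha_1}(0)\otimes\mathcal H_{\alpha_2}(0)\otimes\cdots\otimes\mathcal H_{\alpha_\ell}(0)$ is the subalgebra of $\mathcal H^B_n(0)$ generated by the $\pi_i$ with $i\in\{0,\ldots,n-1\}\setminus D(\alpha)$. $N\uparrow_B^A:=A\otimes_BN$. *)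

(* Defs.v *)
From HB Require Import structures.
From mathcomp Require Import all_boot all_order all_algebra.
From mathcomp Require Import perm boolp finmap monalg zify.

Set Implicit Arguments.
Unset Strict Implicit.
Unset Printing Implicit Defensive.

Import Order.TTheory GRing.Theory Num.Theory.
Local Open Scope ring_scope.
Local Open Scope quotient_scope.

(* [altcomp k f g] is the k-fold alternating composite f \o g \o f \o ... *)
Fixpoint altcomp (T : Type) (k : nat) (f g : T -> T) (v : T) : T :=
  if k is k'.+1 then f (altcomp k' g f v) else v.

Fixpoint altprod (R : pzRingType) (k : nat) (x y : R) : R :=
  if k is k'.+1 then x * altprod k' y x else 1.

Section ZeroHecke.
Variables (F : fieldType) (I : choiceType) (cox : I -> I -> nat).

Local Notation free := {malg F[{fmonom I}]}.

Definition fgen (i : I) : free := << fmu i >>.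

(* The two-sided ideal generated by the relations of the 0-Hecke algebra. *)
Inductive hecke_rel : free -> Prop :=
| hecke_rel_idem i : hecke_rel (fgen i * fgen i - fgen i)
| hecke_rel_braid i j : i != j ->
    hecke_rel (altprod (cox i j) (fgen i) (fgen j)
               - altprod (cox i j) (fgen j) (fgen i))
| hecke_rel_0 : hecke_rel 0
| hecke_rel_B x y : hecke_rel x -> hecke_rel y -> hecke_rel (x - y)
| hecke_rel_M a x b : hecke_rel x -> hecke_rel (a * x * b).

Definition hecke_ideal : {pred free} := fun x => `[< hecke_rel x >].

Lemma hecke_idealP x : reflect (hecke_rel x) (x \in hecke_ideal).
Proof. exact: asboolP. Qed.

Lemma hecke_ideal_zmod : zmod_closed hecke_ideal.
Proof.
split=> [|x y /hecke_idealP hx /hecke_idealP hy]; apply/hecke_idealP.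
  exact: hecke_rel_0.
exact: hecke_rel_B.
Qed.

HB.instance Definition _ := GRing.isZmodClosed.Build free hecke_ideal
  hecke_ideal_zmod.

Definition hecke : Type := Quotient.quot hecke_ideal.

HB.instance Definition _ := GRing.Zmodule.on hecke.

Definition hproj (x : free) : hecke := \pi_(Quotient.quot hecke_ideal) x.

Lemma hprojP (x y : free) : hproj x = hproj y <-> hecke_rel (x - y).
Proof.
split.
  move=> e; apply/hecke_idealP; rewrite Quotient.idealrBE.
  by apply/eqP.
by move=> /hecke_idealP; rewrite Quotient.idealrBE => /eqP.
Qed.

Lemma hproj_surj (h : hecke) : exists x, h = hproj x.
Proof. by exists (repr h); rewrite /hproj reprK. Qed.


Lemma hprojB x y : hproj (x - y) = hproj x - hproj y.
Proof. by rewrite /hproj pi_addr pi_oppr. Qed.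

HB.instance Definition _ := GRing.isZmodMorphism.Build free hecke hproj hprojB.

Lemma hecke_rel_proj0 x : hproj x = 0 <-> hecke_rel x.
Proof. by rewrite -(raddf0 hproj) hprojP subr0. Qed.

Lemma hprojD x y : hproj (x + y) = hproj x + hproj y.
Proof. exact: raddfD. Qed.

Definition hone : hecke := hproj 1.
Definition hmul (h k : hecke) : hecke := hproj (repr h * repr k).
Definition hscale (c : F) (h : hecke) : hecke := hproj (c *: repr h).

Lemma hproj_repr (h : hecke) : hproj (repr h) = h.
Proof. by rewrite /hproj reprK. Qed.

Lemma hprojM x y : hproj (x * y) = hmul (hproj x) (hproj y).
Proof.
rewrite /hmul; set x' := repr _; set y' := repr _.
have hx : hecke_rel (x - x') by apply/hprojP; rewrite hproj_repr.
have hy : hecke_rel (y - y') by apply/hprojP; rewrite hproj_repr.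
apply/hprojP.
have -> : x * y - x' * y' = 1 * (x - x') * y - (0 - x' * (y - y') * 1).
  rewrite mul1r mulr1 sub0r opprK mulrBl mulrBr addrA.
  by rewrite -(addrA (x * y)) addNr addr0.
apply: hecke_rel_B; first exact: hecke_rel_M.
by apply: hecke_rel_B; [exact: hecke_rel_0|exact: hecke_rel_M].
Qed.

Lemma hprojZ c x : hproj (c *: x) = hscale c (hproj x).
Proof.
rewrite /hscale; set x' := repr _; apply/hprojP.
have hx : hecke_rel (x - x') by apply/hprojP; rewrite hproj_repr.
have -> : c *: x - c *: x' = (c *: 1) * (x - x') * 1.
  by rewrite -scalerBr mulr1 -scalerAl mul1r.
exact: hecke_rel_M.
Qed.

Lemma hmulA : associative hmul.
Proof.
move=> a b c; have [[x ->] [y ->] [z ->]] :=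
  And3 (hproj_surj a) (hproj_surj b) (hproj_surj c).
by rewrite -!hprojM mulrA.
Qed.
Lemma hmul1 : left_id hone hmul.
Proof. by move=> a; have [x ->] := hproj_surj a; rewrite -hprojM mul1r. Qed.
Lemma h1mul : right_id hone hmul.
Proof. by move=> a; have [x ->] := hproj_surj a; rewrite -hprojM mulr1. Qed.
Lemma hmulDl : left_distributive hmul +%R.
Proof.
move=> a b c; have [[x ->] [y ->] [z ->]] :=
  And3 (hproj_surj a) (hproj_surj b) (hproj_surj c).
by rewrite -!hprojM -!hprojD -hprojM mulrDl.
Qed.
Lemma hmulDr : right_distributive hmul +%R.
Proof.
move=> a b c; have [[x ->] [y ->] [z ->]] :=
  And3 (hproj_surj a) (hproj_surj b) (hproj_surj c).
by rewrite -!hprojM -!hprojD -hprojM mulrDr.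
Qed.

(* Words act on a space with operators [op]; [fact] extends this linearly to
   the free algebra. *)
Section FreeAction.
Variables (V : lmodType F) (op : I -> {linear V -> V}).

Definition wact (w : seq I) (v : V) : V := foldr (fun i => op i) v w.

Lemma wact_linear w c u v : wact w (c *: u + v) = c *: wact w u + wact w v.
Proof. by elim: w => //= i w ->; rewrite linearP. Qed.

Definition fact (x : free) (v : V) : V :=
  \sum_(w <- msupp x) x@_w *: wact w v.

Lemma factEw (d : {fset {fmonom I}}) x v : (msupp x `<=` d)%fset ->
  fact x v = \sum_(w <- d) x@_w *: wact w v.
Proof.
move=> le_d; rewrite /fact (big_fset_incl _ le_d) //= => w _.
by move=> /mcoeff_outdom ->; rewrite scale0r.
Qed.

Lemma factD x y v : fact (x + y) v = fact x v + fact y v.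
Proof.
rewrite (factEw v (fsubsetUl (msupp x) (msupp y))).
rewrite (factEw v (fsubsetUr (msupp x) (msupp y))).
rewrite (factEw v (msuppD_le x y)) -big_split /=.
by apply: eq_bigr => w _; rewrite mcoeffD scalerDl.
Qed.

Lemma factZ c x v : fact (c *: x) v = c *: fact x v.
Proof.
rewrite (factEw v (msuppZ_le c x)) /fact scaler_sumr.
by apply: eq_bigr => w _; rewrite mcoeffZ scalerA.
Qed.

Lemma fact0 v : fact 0 v = 0.
Proof. by have := factZ 0 0 v; rewrite !scale0r. Qed.

Lemma factN x v : fact (- x) v = - fact x v.
Proof. by apply: (addrI (fact x v)); rewrite -factD !subrr fact0. Qed.

Lemma factB x y v : fact (x - y) v = fact x v - fact y v.
Proof. by rewrite factD factN. Qed.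

Lemma fact_sum (J : Type) (r : seq J) (E : J -> free) v :
  fact (\sum_(j <- r) E j) v = \sum_(j <- r) fact (E j) v.
Proof.
elim: r => [|j r IH]; first by rewrite !big_nil fact0.
by rewrite !big_cons factD IH.
Qed.

Lemma fact_linear x c u v : fact x (c *: u + v) = c *: fact x u + fact x v.
Proof.
rewrite /fact scaler_sumr -big_split /=; apply: eq_bigr => w _.
by rewrite wact_linear scalerDr !scalerA mulrC.
Qed.

Lemma factv0 x : fact x 0 = 0.
Proof.
have /= := fact_linear x (-1) 0 0.
by rewrite scaleN1r addNr scaleN1r addNr.
Qed.

Lemma factU c w v : fact << c *g w >> v = c *: wact w v.
Proof.
rewrite (factEw v msuppU_le) big_seq_fset1 mcoeffUU //.
Qed.

Lemma wact_sum w (J : Type) (r : seq J) (c : J -> F) (E : J -> V) :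
  wact w (\sum_(j <- r) c j *: E j) = \sum_(j <- r) c j *: wact w (E j).
Proof.
elim: r => [|j r IH]; last by rewrite !big_cons wact_linear IH.
rewrite !big_nil; have := wact_linear w (-1) 0 0.
by rewrite scaleN1r addNr scaleN1r addNr.
Qed.

Lemma factM x y v : fact (x * y) v = fact x (fact y v).
Proof.
rewrite malgME fact_sum; apply: eq_bigr => w _.
rewrite fact_sum wact_sum scaler_sumr; apply: eq_bigr => k _.
by rewrite factU scalerA fmM /wact foldr_cat.
Qed.

Lemma fact1 v : fact 1 v = v.
Proof. by rewrite factU scale1r fm1. Qed.

Lemma fact_gen i v : fact (fgen i) v = op i v.
Proof. by rewrite factU scale1r fmU. Qed.

Lemma fact_altprod k i j v :
  fact (altprod k (fgen i) (fgen j)) v = altcomp k (op i) (op j) v.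
Proof.
by elim: k i j => [|k IH] i j /=; rewrite ?fact1 // factM fact_gen IH.
Qed.

Hypothesis op_idem : forall i v, op i (op i v) = op i v.
Hypothesis op_braid : forall i j v, i != j ->
  altcomp (cox i j) (op i) (op j) v = altcomp (cox i j) (op j) (op i) v.

Lemma fact_rel x v : hecke_rel x -> fact x v = 0.
Proof.
move=> hx; elim: hx v => {x} [i|i j ne||x y _ IHx _ IHy|a x b _ IH] v.
- by rewrite factB factM !fact_gen op_idem subrr.
- by rewrite factB !fact_altprod op_braid ?subrr.
- exact: fact0.
- by rewrite factB IHx IHy subrr.
- by rewrite !factM IH factv0.
Qed.

End FreeAction.

Lemma hone_neq0 : hone != 0.
Proof.
apply/eqP => /hecke_rel_proj0 h1.
pose op (i : I) : {linear F^o -> F^o} := idfun.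
have op_id i v : op i (op i v) = op i v by [].
have op_br i j v : i != j ->
    altcomp (cox i j) (op i) (op j) v = altcomp (cox i j) (op j) (op i) v.
  by move=> _; elim: (cox i j) => //= k ->.
have := fact_rel op_id op_br 1 h1; rewrite fact1.
by apply/eqP; exact: oner_neq0.
Qed.

HB.instance Definition _ := GRing.Zmodule_isNzRing.Build hecke
  hmulA hmul1 h1mul hmulDl hmulDr hone_neq0.

Lemma hprojM' x y : hproj (x * y) = hproj x * hproj y.
Proof. exact: hprojM. Qed.

Lemma hscaleA a b v : hscale a (hscale b v) = hscale (a * b) v.
Proof. by have [x ->] := hproj_surj v; rewrite -!hprojZ scalerA. Qed.
Lemma hscale1 : left_id 1 hscale.
Proof. by move=> v; have [x ->] := hproj_surj v; rewrite -hprojZ scale1r. Qed.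
Lemma hscaleDr : right_distributive hscale +%R.
Proof.
move=> a u v; have [[x ->] [y ->]] := conj (hproj_surj u) (hproj_surj v).
by rewrite -!hprojZ -!hprojD -hprojZ scalerDr.
Qed.
Lemma hscaleDl v : {morph hscale^~ v : a b / a + b}.
Proof.
by move=> a b; have [x ->] := hproj_surj v; rewrite -!hprojZ -hprojD scalerDl.
Qed.

HB.instance Definition _ := GRing.Zmodule_isLmodule.Build F hecke
  hscaleA hscale1 hscaleDr hscaleDl.

Lemma hscaleAl (c : F) (u v : hecke) : c *: (u * v) = (c *: u) * v.
Proof.
have [[x ->] [y ->]] := conj (hproj_surj u) (hproj_surj v).
by rewrite -[LHS]/(hscale _ _) -[c *: _]/(hscale _ _) -hprojM' -!hprojZ
  -hprojM' scalerAl.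
Qed.

HB.instance Definition _ := GRing.Lmodule_isLalgebra.Build F hecke hscaleAl.

Lemma hscaleAr (c : F) (u v : hecke) : c *: (u * v) = u * (c *: v).
Proof.
have [[x ->] [y ->]] := conj (hproj_surj u) (hproj_surj v).
rewrite -[LHS]/(hscale _ _) -[c *: _]/(hscale _ _) -hprojM' -!hprojZ -hprojM'.
congr hproj; rewrite scalerAl (malgMEw (msuppZ_le c x) (fsubset_refl _)).
rewrite (malgMEw (fsubset_refl _) (msuppZ_le c y)).
apply: eq_bigr => k _; apply: eq_bigr => l _.
by rewrite !mcoeffZ mulrCA mulrA.
Qed.

HB.instance Definition _ := GRing.Lalgebra_isAlgebra.Build F hecke hscaleAr.

Definition hgen (i : I) : hecke := hproj (fgen i).

Lemma hgen_idem i : hgen i * hgen i = hgen i.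
Proof. by rewrite -hprojM'; apply/hprojP; exact: hecke_rel_idem. Qed.

Lemma hproj_altprod k x y :
  hproj (altprod k x y) = altprod k (hproj x) (hproj y).
Proof.
elim: k x y => [|k IH] x y; first by [].
by rewrite -[LHS]/(hproj (x * altprod k y x)) hprojM' IH.
Qed.

Lemma hgen_braid i j : i != j ->
  altprod (cox i j) (hgen i) (hgen j) = altprod (cox i j) (hgen j) (hgen i).
Proof.
by move=> ne; rewrite -!hproj_altprod; apply/hprojP; exact: hecke_rel_braid.
Qed.

(* Operators satisfying the defining relations make a vector space a module
   over the presented algebra, in which [hgen i] acts by [hr_op i]. *)
Record hrep := HRep {
  hr_space : lmodType F;
  hr_op : I -> {linear hr_space -> hr_space};
  hr_idem : forall i v, hr_op i (hr_op i v) = hr_op i v;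
  hr_braid : forall i j v, i != j ->
    altcomp (cox i j) (hr_op i) (hr_op j) v
    = altcomp (cox i j) (hr_op j) (hr_op i) v
}.

Definition hmod (r : hrep) : Type := hr_space r.

Section HMod.
Variable r : hrep.

HB.instance Definition _ := GRing.Zmodule.on (hmod r).

Definition hact (h : hecke) (v : hmod r) : hmod r :=
  fact (@hr_op r) (repr h) v.

Lemma hactE x v : hact (hproj x) v = fact (@hr_op r) x v.
Proof.
rewrite /hact; set x' := repr _.
have hx : hecke_rel (x' - x) by apply/hprojP; rewrite hproj_repr.
apply/eqP; rewrite -subr_eq0 -[_ - _]factB; apply/eqP; apply: fact_rel => //.
  exact: hr_idem.
exact: hr_braid.
Qed.

Lemma hactA a b v : hact a (hact b v) = hact (a * b) v.
Proof.
have [[x ->] [y ->]] := conj (hproj_surj a) (hproj_surj b).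
by rewrite -hprojM' !hactE factM.
Qed.
Lemma hact1 : left_id 1 hact.
Proof. by move=> v; rewrite hactE fact1. Qed.
Lemma hactDr : right_distributive hact +%R.
Proof.
move=> a u v; have [x ->] := hproj_surj a; rewrite !hactE.
by have := fact_linear (@hr_op r) x 1 u v; rewrite !scale1r.
Qed.
Lemma hactDl v : {morph hact^~ v : a b / a + b}.
Proof.
move=> a b; have [[x ->] [y ->]] := conj (hproj_surj a) (hproj_surj b).
by rewrite -hprojD !hactE factD.
Qed.

HB.instance Definition _ := GRing.Zmodule_isLmodule.Build hecke (hmod r)
  hactA hact1 hactDr hactDl.

Lemma hmod_genE i (v : hmod r) : hgen i *: v = @hr_op r i v.
Proof. by rewrite -[LHS]/(hact _ _) hactE fact_gen. Qed.

Lemma hmod_scalarE (c : F) (v : hmod r) :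
  (c%:A : hecke) *: v = (c *: (v : hr_space r) : hr_space r).
Proof.
have -> : c%:A = hproj (c *: 1) by rewrite hprojZ.
by rewrite -[LHS]/(hact _ _) hactE factZ fact1.
Qed.

End HMod.

End ZeroHecke.

Arguments hgen {F I cox} i.

Section Tensor.
Variables (R : Type) (M N : zmodType).
Variables (ra : M -> R -> M) (la : R -> N -> N).

Local Notation free := {malg int[(M * N)%type]}.

(* The subgroup of the free abelian group on [M * N] presenting the balanced
   tensor product of a right module M (action [ra]) and a left module N (action
   [la]) over R. *)
Inductive tens_rel : free -> Prop :=
| tens_rel_Dl x x' y : tens_rel (<< (x + x', y) >> - << (x, y) >> - << (x', y) >>)
| tens_rel_Dr x y y' : tens_rel (<< (x, y + y') >> - << (x, y) >> - << (x, y') >>)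
| tens_rel_bal x r y : tens_rel (<< (ra x r, y) >> - << (x, la r y) >>)
| tens_rel_0 : tens_rel 0
| tens_rel_B u v : tens_rel u -> tens_rel v -> tens_rel (u - v).

Definition tens_pred : {pred free} := fun x => `[< tens_rel x >].

Lemma tens_predP x : reflect (tens_rel x) (x \in tens_pred).
Proof. exact: asboolP. Qed.

Lemma tens_pred_zmod : zmod_closed tens_pred.
Proof.
split=> [|x y /tens_predP hx /tens_predP hy]; apply/tens_predP.
  exact: tens_rel_0.
exact: tens_rel_B.
Qed.

HB.instance Definition _ := GRing.isZmodClosed.Build free tens_pred
  tens_pred_zmod.

Definition tensor : Type := Quotient.quot tens_pred.

HB.instance Definition _ := GRing.Zmodule.on tensor.

Definition tproj (x : free) : tensor := \pi_(Quotient.quot tens_pred) x.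

Definition pure (x : M) (y : N) : tensor := tproj << (x, y) >>.

Lemma tprojB u v : tproj (u - v) = tproj u - tproj v.
Proof. by rewrite /tproj pi_addr pi_oppr. Qed.

HB.instance Definition _ := GRing.isZmodMorphism.Build free tensor tproj tprojB.

Lemma tproj_eq0 u : tproj u = 0 <-> tens_rel u.
Proof.
rewrite -(raddf0 tproj); split.
  move=> e; apply/tens_predP; rewrite -[u]subr0 Quotient.idealrBE.
  by apply/eqP.
by move=> /tens_predP; rewrite -{1}[u]subr0 Quotient.idealrBE => /eqP.
Qed.

Lemma pureDl x x' y : pure (x + x') y = pure x y + pure x' y.
Proof.
apply/eqP; rewrite -subr_eq0 opprD addrA -!tprojB; apply/eqP/tproj_eq0.
exact: tens_rel_Dl.
Qed.

Lemma pureDr x y y' : pure x (y + y') = pure x y + pure x y'.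
Proof.
apply/eqP; rewrite -subr_eq0 opprD addrA -!tprojB; apply/eqP/tproj_eq0.
exact: tens_rel_Dr.
Qed.

Lemma pure_bal x r y : pure (ra x r) y = pure x (la r y).
Proof.
by apply/eqP; rewrite -subr_eq0 -tprojB; apply/eqP/tproj_eq0/tens_rel_bal.
Qed.

Lemma pure0l y : pure 0 y = 0.
Proof. by apply: (addrI (pure 0 y)); rewrite -pureDl !addr0. Qed.

Lemma pure0r x : pure x 0 = 0.
Proof. by apply: (addrI (pure x 0)); rewrite -pureDr !addr0. Qed.

Lemma tensor_ind (P : tensor -> Prop) :
  (forall x y, P (pure x y)) -> (forall s t, P s -> P t -> P (s - t)) ->
  forall t, P t.
Proof.
move=> Pp PB t; rewrite -[t]reprK -[\pi_ _ _]/(tproj _).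
set u := repr t.
have P0 : P 0 by rewrite -(subrr (pure 0 0)); apply: PB.
have PN s : P s -> P (- s) by move=> ?; rewrite -sub0r; apply: PB.
have PD s s' : P s -> P s' -> P (s + s').
  by move=> ? ?; rewrite -[s']opprK; apply: PB => //; apply: PN.
have PM s (n : nat) : P s -> P (s *+ n).
  by move=> Ps; elim: n => [|n IH]; rewrite ?mulr0n // mulrS; apply: PD.
have PZ s (z : int) : P s -> P (s *~ z).
  by case: z => n Ps; [exact: PM|apply: PN; exact: PM].
rewrite [u]monalgE raddf_sum; elim: (enum_fset _) => [|[x y] r IH].
  by rewrite big_nil.
rewrite big_cons; apply: PD => //.
have -> : << u@_(x, y) *g (x, y) >> = << (x, y) >> *~ u@_(x, y) :> free.
  by rewrite -(raddfMz (mkmalgU (x, y))) intz.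
by rewrite raddfMz; apply: PZ; exact: Pp.
Qed.

Lemma tensor_ext (Z : zmodType) (f g : {additive tensor -> Z}) :
  (forall x y, f (pure x y) = g (pure x y)) -> f =1 g.
Proof.
move=> e; elim/tensor_ind => // s t es et.
by rewrite !raddfB es et.
Qed.

Section Lift.
Variables (Z : zmodType) (f : M -> N -> Z).

Definition tlift0 (u : free) : Z := \sum_(p <- msupp u) f p.1 p.2 *~ u@_p.

Lemma tlift0Ew (d : {fset (M * N)%type}) u : (msupp u `<=` d)%fset ->
  tlift0 u = \sum_(p <- d) f p.1 p.2 *~ u@_p.
Proof.
move=> le_d; rewrite /tlift0 (big_fset_incl _ le_d) //= => w _.
by move=> /mcoeff_outdom ->; rewrite mulr0z.
Qed.

Lemma tlift0B u v : tlift0 (u - v) = tlift0 u - tlift0 v.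
Proof.
rewrite (tlift0Ew (fsubsetUl (msupp u) (msupp v))).
rewrite (tlift0Ew (fsubsetUr (msupp u) (msupp v))).
rewrite (tlift0Ew (msuppB_le u v)) -sumrB /=.
by apply: eq_bigr => w _; rewrite mcoeffB mulrzBr.
Qed.

Lemma tlift0U x y : tlift0 << (x, y) >> = f x y.
Proof. by rewrite (tlift0Ew msuppU_le) big_seq_fset1 mcoeffUU. Qed.

Lemma tlift00 : tlift0 0 = 0.
Proof. by have := tlift0B 0 0; rewrite !subrr. Qed.

Definition tlift (t : tensor) : Z := tlift0 (repr t).

Hypothesis fDl : forall x x' y, f (x + x') y = f x y + f x' y.
Hypothesis fDr : forall x y y', f x (y + y') = f x y + f x y'.
Hypothesis f_bal : forall x r y, f (ra x r) y = f x (la r y).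

Lemma tlift0_rel u : tens_rel u -> tlift0 u = 0.
Proof.
elim=> {u} [x x' y|x y y'|x r y||u v _ IHu _ IHv].
- by rewrite !tlift0B !tlift0U fDl addrAC addrK subrr.
- by rewrite !tlift0B !tlift0U fDr addrAC addrK subrr.
- by rewrite !tlift0B !tlift0U f_bal subrr.
- exact: tlift00.
- by rewrite tlift0B IHu IHv subrr.
Qed.

Lemma tlift_proj u : tlift (tproj u) = tlift0 u.
Proof.
rewrite /tlift; set u' := repr _; apply/eqP; rewrite -subr_eq0 -tlift0B.
apply/eqP/tlift0_rel/tproj_eq0; rewrite raddfB /=.
by rewrite [tproj u']reprK subrr.
Qed.

Lemma tlift_pure x y : tlift (pure x y) = f x y.
Proof. by rewrite tlift_proj tlift0U. Qed.

Lemma tliftB s t : tlift (s - t) = tlift s - tlift t.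
Proof.
rewrite -[s]reprK -[t]reprK -![\pi_ _ _]/(tproj _).
by rewrite -raddfB !tlift_proj tlift0B.
Qed.

End Lift.

End Tensor.

(* Extension of scalars along a ring morphism [phi : B -> A]: the left
   A-module [A (x)_B N], where B acts on A by right multiplication. *)
Section Induction.
Variables (B A : pzRingType) (phi : {rmorphism B -> A}) (N : lmodType B).

Definition induced : Type :=
  tensor (fun (a : A) (b : B) => a * phi b) (fun (b : B) (v : N) => b *: v).

HB.instance Definition _ := GRing.Zmodule.on induced.

Definition ipure (a : A) (v : N) : induced := pure _ _ a v.

Definition iscale (a : A) (t : induced) : induced :=
  tlift (fun x y => ipure (a * x) y) t.

Fact iscale_Dl a x x' y : ipure (a * (x + x')) y = ipure (a * x) y + ipure (a * x') y.
Proof. by rewrite mulrDr [LHS]pureDl. Qed.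
Fact iscale_Dr a x y y' : ipure (a * x) (y + y') = ipure (a * x) y + ipure (a * x) y'.
Proof. exact: pureDr. Qed.
Fact iscale_bal a x b y : ipure (a * (x * phi b)) y = ipure (a * x) (b *: y).
Proof. by rewrite mulrA [LHS]pure_bal. Qed.

Lemma iscale_pure a x y : iscale a (ipure x y) = ipure (a * x) y.
Proof. exact: (tlift_pure (iscale_Dl a) (iscale_Dr a) (iscale_bal a)). Qed.

Lemma iscaleB a s t : iscale a (s - t) = iscale a s - iscale a t.
Proof. exact: (tliftB (iscale_Dl a) (iscale_Dr a) (iscale_bal a)). Qed.

HB.instance Definition _ a := GRing.isZmodMorphism.Build induced induced
  (iscale a) (iscaleB a).

Lemma iscaleA a b t : iscale a (iscale b t) = iscale (a * b) t.
Proof.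
elim/tensor_ind: t => [x y|s t es et].
  by rewrite -[pure _ _ _ _]/(ipure x y) !iscale_pure mulrA.
by rewrite [iscale b _]iscaleB !iscaleB -es -et.
Qed.
Lemma iscale1 : left_id 1 iscale.
Proof.
elim/tensor_ind => [x y|s t es et].
  by rewrite -[pure _ _ _ _]/(ipure x y) iscale_pure mul1r.
by rewrite iscaleB es et.
Qed.
Lemma iscaleDr : right_distributive iscale +%R.
Proof. by move=> a s t; exact: raddfD. Qed.
Lemma iscaleDl t : {morph iscale^~ t : a b / a + b}.
Proof.
move=> a b; elim/tensor_ind: t => [x y|s t es et].
  by rewrite -[pure _ _ _ _]/(ipure x y) !iscale_pure mulrDl [LHS]pureDl.
by rewrite !iscaleB es et opprD addrACA.
Qed.

HB.instance Definition _ := GRing.Zmodule_isLmodule.Build A induced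
  iscaleA iscale1 iscaleDr iscaleDl.

End Induction.

Definition restricted (B A : pzRingType) (phi : {rmorphism B -> A})
  (V : lmodType A) : Type := V.

Section Restriction.
Variables (B A : pzRingType) (phi : {rmorphism B -> A}) (V : lmodType A).
Local Notation restricted := (restricted phi V).

HB.instance Definition _ := GRing.Zmodule.on restricted.

Definition rscale (b : B) (v : restricted) : restricted := phi b *: (v : V).

Lemma rscaleA a b v : rscale a (rscale b v) = rscale (a * b) v.
Proof. by rewrite /rscale scalerA rmorphM. Qed.
Lemma rscale1 : left_id 1 rscale.
Proof. by move=> v; rewrite /rscale rmorph1 scale1r. Qed.
Lemma rscaleDr : right_distributive rscale +%R.
Proof. by move=> a u v; rewrite /rscale -scalerDr. Qed.
Lemma rscaleDl v : {morph rscale^~ v : a b / a + b}.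
Proof. by move=> a b; rewrite /rscale rmorphD scalerDl. Qed.

HB.instance Definition _ := GRing.Zmodule_isLmodule.Build B restricted
  rscaleA rscale1 rscaleDr rscaleDl.

End Restriction.

Section GeneratedSubalgebra.
Variables (F : fieldType) (A : algType F) (S : A -> Prop).

Inductive in_gensub : A -> Prop :=
| in_gensub_gen x : S x -> in_gensub x
| in_gensub_1 : in_gensub 1
| in_gensub_P c x y : in_gensub x -> in_gensub y -> in_gensub (c *: x + y)
| in_gensub_M x y : in_gensub x -> in_gensub y -> in_gensub (x * y).

Definition gensub_pred : {pred A} := fun x => `[< in_gensub x >].

Lemma gensub_predP x : reflect (in_gensub x) (x \in gensub_pred).
Proof. exact: asboolP. Qed.

Lemma gensub_subalg : GRing.subsemialg_closed gensub_pred.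
Proof.
have P0 : in_gensub 0.
  rewrite -(addNr (1 : A)) -scaleN1r; apply: in_gensub_P; exact: in_gensub_1.
split.
- by apply/gensub_predP; exact: in_gensub_1.
- split=> [|x y /gensub_predP hx /gensub_predP hy]; apply/gensub_predP => //.
  by rewrite -[x]scale1r; exact: in_gensub_P.
- move=> c x /gensub_predP hx; apply/gensub_predP.
  by rewrite -[_ *: _]addr0; exact: in_gensub_P.
- move=> x y /gensub_predP hx /gensub_predP hy; apply/gensub_predP.
  exact: in_gensub_M.
Qed.

(* The F-subalgebra of A generated by S. *)
Record gensub := GenSub { gensub_val :> A; _ : gensub_val \in gensub_pred }.

HB.instance Definition _ := [isSub for gensub_val].
HB.instance Definition _ := [Choice of gensub by <:].
HB.instance Definition _ := GRing.SubChoice_isSubAlgebra.Build F A gensub_pred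
  gensub gensub_subalg.

Definition gensub_incl : {rmorphism gensub -> A} := val.

End GeneratedSubalgebra.

Section DirectSum.
Variables (R : pzRingType) (J : finType) (V : J -> lmodType R).

Definition dsum : Type := {dffun forall j, V j}.

HB.instance Definition _ := Choice.on dsum.

Definition dsum0 : dsum := [ffun j => (0 : V j)].
Definition dsumN (f : dsum) : dsum := [ffun j => - f j].
Definition dsumD (f g : dsum) : dsum := [ffun j => f j + g j].
Definition dsumZ (a : R) (f : dsum) : dsum := [ffun j => a *: f j].

Fact dsumA : associative dsumD.
Proof. by move=> f g h; apply/ffunP => j; rewrite !ffunE addrA. Qed.
Fact dsumC : commutative dsumD.
Proof. by move=> f g; apply/ffunP => j; rewrite !ffunE addrC. Qed.
Fact dsum0D : left_id dsum0 dsumD.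
Proof. by move=> f; apply/ffunP => j; rewrite !ffunE add0r. Qed.
Fact dsumND : left_inverse dsum0 dsumN dsumD.
Proof. by move=> f; apply/ffunP => j; rewrite !ffunE addNr. Qed.

HB.instance Definition _ := GRing.isZmodule.Build dsum dsumA dsumC dsum0D dsumND.

Fact dsumZA a b f : dsumZ a (dsumZ b f) = dsumZ (a * b) f.
Proof. by apply/ffunP => j; rewrite !ffunE scalerA. Qed.
Fact dsumZ1 : left_id 1 dsumZ.
Proof. by move=> f; apply/ffunP => j; rewrite !ffunE scale1r. Qed.
Fact dsumZDr : right_distributive dsumZ +%R.
Proof. by move=> a f g; apply/ffunP => j; rewrite !ffunE scalerDr. Qed.
Fact dsumZDl f : {morph dsumZ^~ f : a b / a + b}.
Proof. by move=> a b; apply/ffunP => j; rewrite !ffunE scalerDl. Qed.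

HB.instance Definition _ := GRing.Zmodule_isLmodule.Build R dsum
  dsumZA dsumZ1 dsumZDr dsumZDl.

End DirectSum.

Definition mod_iso (R : pzRingType) (U V : lmodType R) : Prop :=
  exists f : {linear U -> V}, bijective f.

(* 0-Hecke relations for operators of the form
   [E x |-> - E x] if x has the descent, [E x |-> E (s x)] otherwise. *)
Section BraidOps.
Variables (V : zmodType) (X : Type) (E : X -> V) (ok : X -> Prop).
Variables (P1 P2 : {additive V -> V}) (s1 s2 : X -> X).

Section Len2.
Variables a b c d : X -> int.
Hypothesis st1T : forall x, ok x -> b x < a x -> P1 (E x) = - E x.
Hypothesis st1F : forall x, ok x -> a x <= b x ->
  P1 (E x) = E (s1 x) /\ ok (s1 x).
Hypothesis st2T : forall x, ok x -> d x < c x -> P2 (E x) = - E x.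
Hypothesis st2F : forall x, ok x -> c x <= d x ->
  P2 (E x) = E (s2 x) /\ ok (s2 x).
Hypothesis s1c : forall x, (c (s1 x) = c x) * (d (s1 x) = d x).
Hypothesis s2a : forall x, (a (s2 x) = a x) * (b (s2 x) = b x).
Hypothesis s12 : forall x, s1 (s2 x) = s2 (s1 x).

Lemma braid2 x : ok x -> P1 (P2 (E x)) = P2 (P1 (E x)).
Proof.
move=> okx.
have [h1|h1] := ltrP (b x) (a x); have [h2|h2] := ltrP (d x) (c x).
- by rewrite (st1T okx h1) (st2T okx h2) !raddfN (st1T okx h1) (st2T okx h2).
- have [-> ok2] := st2F okx h2; rewrite (st1T okx h1) raddfN st1T ?s2a //.
  by have [-> _] := st2F okx h2.
- have [-> ok1] := st1F okx h1; rewrite (st2T okx h2) raddfN (st2T ok1) ?s1c //.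
  by have [-> _] := st1F okx h1.
- have [-> ok1] := st1F okx h1; have [-> ok2] := st2F okx h2.
  have [|-> _] := st1F ok2; first by rewrite !s2a.
  have [|-> _] := st2F ok1; first by rewrite !s1c.
  by rewrite s12.
Qed.
End Len2.

Section Len3.
Variables a b c : X -> int.
Hypothesis st1T : forall x, ok x -> b x < a x -> P1 (E x) = - E x.
Hypothesis st1F : forall x, ok x -> a x <= b x ->
  P1 (E x) = E (s1 x) /\ ok (s1 x).
Hypothesis st2T : forall x, ok x -> c x < b x -> P2 (E x) = - E x.
Hypothesis st2F : forall x, ok x -> b x <= c x ->
  P2 (E x) = E (s2 x) /\ ok (s2 x).
Hypothesis neq : forall x, ok x -> (a x != b x) /\ (b x != c x) /\ (a x != c x).
Hypothesis s1E : forall x,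
  (a (s1 x) = b x) * (b (s1 x) = a x) * (c (s1 x) = c x).
Hypothesis s2E : forall x,
  (a (s2 x) = a x) * (b (s2 x) = c x) * (c (s2 x) = b x).
Hypothesis s121 : forall x, s1 (s2 (s1 x)) = s2 (s1 (s2 x)).

Let sE := (s1E, s2E).

Ltac step := match goal with
  | H : ok ?y |- context [GRing.Additive.sort P1 (E ?y)] => first
    [ rewrite (st1T H); [|by rewrite ?sE; lia]
    | let e := fresh "e" in let o := fresh "o" in
      have [|e o] := st1F H; [by rewrite ?sE; lia | rewrite e ] ]
  | H : ok ?y |- context [GRing.Additive.sort P2 (E ?y)] => first
    [ rewrite (st2T H); [|by rewrite ?sE; lia]
    | let e := fresh "e" in let o := fresh "o" in
      have [|e o] := st2F H; [by rewrite ?sE; lia | rewrite e ] ]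
  | _ => first [rewrite (raddfN P1) | rewrite (raddfN P2)]
  end.

Lemma braid3 x : ok x -> P1 (P2 (P1 (E x))) = P2 (P1 (P2 (E x))).
Proof.
move=> okx; have [n1 [n2 n3]] := neq okx.
have [h1|h1] := ltrP (b x) (a x); have [h2|h2] := ltrP (c x) (b x);
  have [h3|h3] := ltrP (c x) (a x); try (exfalso; lia).
all: repeat step.
all: by rewrite ?opprK ?s121.
Qed.
End Len3.

Section Len4.
Variables a b : X -> int.
Hypothesis st1T : forall x, ok x -> a x < 0 -> P1 (E x) = - E x.
Hypothesis st1F : forall x, ok x -> 0 <= a x ->
  P1 (E x) = E (s1 x) /\ ok (s1 x).
Hypothesis st2T : forall x, ok x -> b x < a x -> P2 (E x) = - E x.
Hypothesis st2F : forall x, ok x -> a x <= b x ->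
  P2 (E x) = E (s2 x) /\ ok (s2 x).
Hypothesis neq : forall x, ok x ->
  (a x != 0) /\ (b x != 0) /\ (a x != b x) /\ (a x != - b x).
Hypothesis s1E : forall x, (a (s1 x) = - a x) * (b (s1 x) = b x).
Hypothesis s2E : forall x, (a (s2 x) = b x) * (b (s2 x) = a x).
Hypothesis s1212 : forall x, s1 (s2 (s1 (s2 x))) = s2 (s1 (s2 (s1 x))).

Let sE := (s1E, s2E).

Ltac step := match goal with
  | H : ok ?y |- context [GRing.Additive.sort P1 (E ?y)] => first
    [ rewrite (st1T H); [|by rewrite ?sE; lia]
    | let e := fresh "e" in let o := fresh "o" in
      have [|e o] := st1F H; [by rewrite ?sE; lia | rewrite e ] ]
  | H : ok ?y |- context [GRing.Additive.sort P2 (E ?y)] => first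
    [ rewrite (st2T H); [|by rewrite ?sE; lia]
    | let e := fresh "e" in let o := fresh "o" in
      have [|e o] := st2F H; [by rewrite ?sE; lia | rewrite e ] ]
  | _ => first [rewrite (raddfN P1) | rewrite (raddfN P2)]
  end.

Lemma braid4 x : ok x -> P1 (P2 (P1 (P2 (E x)))) = P2 (P1 (P2 (P1 (E x)))).
Proof.
move=> okx; have [n1 [n2 [n3 n4]]] := neq okx.
have [h1|h1] := ltrP (a x) 0; have [h2|h2] := ltrP (b x) 0;
  have [h3|h3] := ltrP (b x) (a x);
  have [h4|h4] := ltrP (a x + b x) 0; try (exfalso; lia).
all: repeat step.
all: by rewrite ?opprK ?s1212.
Qed.
End Len4.
End BraidOps.

(* Passing from the operators [a], [b] of [pi_i - 1] to those of [pi_i]. *)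
Section Shift.
Variables (F : fieldType) (V : lmodType F).
Definition shiftop (a : {linear V -> V}) (v : V) : V := a v + v.

Lemma shiftop_linear a : linear (shiftop a).
Proof.
by move=> c u v; rewrite /shiftop linearP scalerDr addrACA.
Qed.
HB.instance Definition _ a := GRing.isLinear.Build F V V *:%R (shiftop a)
  (shiftop_linear a).

Section Two.
Variables a b : {linear V -> V}.
Hypothesis a2 : forall v, a (a v) = - a v.
Hypothesis b2 : forall v, b (b v) = - b v.
Let p : {linear V -> V} := shiftop a.
Let q : {linear V -> V} := shiftop b.

Let ap v : a (p v) = 0. Proof. by rewrite /p /= /shiftop linearD a2 addNr. Qed.
Let bq v : b (q v) = 0. Proof. by rewrite /q /= /shiftop linearD b2 addNr. Qed.
Let pE v : p v = a v + v. Proof. by []. Qed.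
Let qE v : q v = b v + v. Proof. by []. Qed.

Lemma shift_idem v : shiftop a (shiftop a v) = shiftop a v.
Proof. by rewrite -[LHS]/(p (p v)) pE ap add0r. Qed.

Lemma shift2 v :
  shiftop a (shiftop b v) = a (b v) + (a v + b v) + v.
Proof. by rewrite -[LHS]/(p (q v)) pE qE linearD !addrA. Qed.

Lemma shift3 v : shiftop a (shiftop b (shiftop a v)) =
  a (b (a v)) + (a (b v) + b (a v)) + (b v + a v) + v.
Proof.
rewrite -[LHS]/(p (q (p v))) pE qE linearD ap addr0 pE !linearD.
by rewrite -!addrA.
Qed.

Lemma shift4 v : shiftop a (shiftop b (shiftop a (shiftop b v))) =
  a (b (a (b v))) + (a (b (a v)) + b (a (b v))) +
   (b (a v) + a (b v)) + (a v + b v) + v.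
Proof.
rewrite -[LHS]/(p (q (p (q v)))) [LHS]pE (qE (p _)) linearD ap addr0.
rewrite (pE (q v)) (linearD b) bq addr0 qE !linearD.
by rewrite -!addrA.
Qed.
End Two.

Lemma shift_braid (a b : {linear V -> V}) (k : nat) (v : V) :
  (forall v, a (a v) = - a v) -> (forall v, b (b v) = - b v) ->
  (1 < k < 5)%N -> altcomp k a b v = altcomp k b a v ->
  altcomp k (shiftop a) (shiftop b) v = altcomp k (shiftop b) (shiftop a) v.
Proof.
move=> a2 b2; case: k => [|[|[|[|[|k]]]]] //= _ e.
- by rewrite !shift2 // e (addrC (a v)).
- by rewrite !shift3 // e (addrC (a (b v))) (addrC (b v)).
- by rewrite !shift4 // e (addrC (a (b (a v)))) (addrC (b (a v))) (addrC (a v)).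
Qed.

End Shift.

Definition is_comp (s : seq nat) : bool := (s != [::]) && all (leq 1) s.
Definition is_pcomp (s : seq nat) : bool :=
  if s is _ :: t then all (leq 1) t else false.

Record pscomp (n : nat) := PComp {
  pc_parts :> seq nat;
  pcompP : is_pcomp pc_parts && (sumn pc_parts == n)
}.

HB.instance Definition _ n := [isSub for @pc_parts n].
HB.instance Definition _ n := [Countable of pscomp n by <:].

Section PCompFinite.
Variable n : nat.

Definition pcomp_code (a : pscomp n) : n.+1.-bseq 'I_n.+1 :=
  insub_bseq n.+1 [seq inord m | m <- pc_parts a].

Definition pcomp_decode (b : n.+1.-bseq 'I_n.+1) : option (pscomp n) :=
  insub [seq val m | m <- b].

Lemma pcomp_codeK : pcancel pcomp_code pcomp_decode.
Proof.
case=> s hs; rewrite /pcomp_decode /pcomp_code /=.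
have [hp /eqP hn] := andP hs.
have size_s : (size s <= n.+1)%N.
  rewrite -hn; case: s hp {hs hn} => //= a t ht; rewrite ltnS.
  apply: leq_trans (leq_addl a _); elim: t ht => //= m t IH /andP[h /IH].
  by rewrite -add1n; exact: leq_add.
have le_s m : m \in s -> (m < n.+1)%N.
  move=> ms; rewrite ltnS -hn; elim: s ms {hs hp hn size_s} => //= x t IH.
  rewrite inE => /orP[/eqP ->|/IH h]; first exact: leq_addr.
  exact: leq_trans h (leq_addl _ _).
have -> : [seq val m | m <- insub_bseq n.+1 [seq (inord m : 'I_n.+1) | m <- s]]
    = s.
  have -> : insub_bseq n.+1 [seq (inord m : 'I_n.+1) | m <- s]
      = [seq inord m | m <- s] :> seq 'I_n.+1.
    by rewrite -[LHS]/(val (insubd _ _)) val_insubd size_map size_s.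
  rewrite -map_comp -[RHS]map_id; by apply/eq_in_map => m /le_s h; rewrite /= inordK.
by rewrite (insubT (fun s => is_pcomp s && (sumn s == n)) hs); congr Some;
  exact: val_inj.
Qed.

HB.instance Definition _ : isFinite (pscomp n) := PCanIsFinite pcomp_codeK.

End PCompFinite.

(* The partial sums alpha_1 + ... + alpha_j, 1 <= j < l. *)
Definition descset (s : seq nat) : seq nat :=
  [seq sumn (take j s) | j <- iota 1 (size s).-1].

(* [D(b)] is contained in [D(a)]. *)
Definition pc_le n (b a : pscomp n) : bool :=
  all (fun d => d \in descset a) (descset b).

(* The generalized pseudo-ribbon [gp_first (+) c1 (+) c2 (+) ...] of size n,
   for [gp_rest = [:: c1; c2; ...]]. *)
Record gpribbon (n : nat) := GPRibbon {
  gp_first : seq nat;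
  gp_rest : seq (seq nat);
  gpribbonP : [&& is_pcomp gp_first, all is_comp gp_rest
    & sumn gp_first + sumn (map sumn gp_rest) == n]%N
}.

(* Boxes are (row, column), rows counted upwards, columns rightwards; they are
   listed in reading order (rows from bottom to top, each left to right), the
   lowest box of the first row being (r, c). *)
Fixpoint ribbon_boxes (r c : nat) (s : seq nat) : seq (nat * nat) :=
  if s is m :: s' then
    [seq (r, c + j)%N | j <- iota 0 m] ++ ribbon_boxes r.+1 (c + m.-1) s'
  else [::].

(* The 0-box is (0, 0). *)
Definition pribbon_boxes (s : seq nat) : seq (nat * nat) :=
  (0, 0)%N ::
  if s is a :: t then
    if a is 0%N then ribbon_boxes 1 0 t else ribbon_boxes 0 1 s
  else [::].

(* A ribbon ends at its northeasternmost box; the next component starts at the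
   box diagonally above it. *)
Fixpoint add_ribbons (acc : seq (nat * nat)) (cs : seq (seq nat)) :=
  if cs is s :: cs' then
    let b := last (0, 0)%N acc in
    add_ribbons (acc ++ ribbon_boxes b.1.+1 b.2.+1 s) cs'
  else acc.

Definition boxes n (g : gpribbon n) : seq (nat * nat) :=
  add_ribbons (pribbon_boxes (gp_first g)) (gp_rest g).

Definition row_ n (g : gpribbon n) (k : nat) : nat := (nth (0, 0)%N (boxes g) k).1.
Definition col_ n (g : gpribbon n) (k : nat) : nat := (nth (0, 0)%N (boxes g) k).2.

Section Boxes.

Definition ne (b b' : nat * nat) : bool :=
  [&& b.1 <= b'.1, b.2 <= b'.2 & b != b']%N.

Lemma ne_trans : transitive ne.
Proof.
move=> [r c] [r' c'] [r'' c'']; rewrite /ne /= !xpair_eqE.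
by move=> *; lia.
Qed.

Lemma size_ribbon r c s : size (ribbon_boxes r c s) = sumn s.
Proof.
by elim: s r c => //= m s IH r c; rewrite size_cat size_map size_iota IH.
Qed.

Lemma path_row b (r c k m : nat) : ne b (r, c + k)%N ->
  path ne b [seq (r, c + j)%N | j <- iota k m].
Proof.
elim: m k b => //= m IH k b h; rewrite h /=; apply: IH.
rewrite /ne /= xpair_eqE; lia.
Qed.

Lemma last_row b (r c k m : nat) :
  last b [seq (r, c + j)%N | j <- iota k m.+1] = (r, c + k + m)%N.
Proof.
by rewrite -[m.+1]addn1 iotaD map_cat last_cat /= addnA.
Qed.

Lemma path_ribbon b r c s : all (leq 1) s -> ne b (r, c) ->
  path ne b (ribbon_boxes r c s).
Proof.
elim: s b r c => [//|[//|m] s IH] b r c /andP[_ hs] h.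
have -> : ribbon_boxes r c (m.+1 :: s) =
  [seq (r, c + j)%N | j <- iota 0 m.+1] ++ ribbon_boxes r.+1 (c + m) s by [].
rewrite cat_path path_row ?addn0 // last_row addn0; apply: IH => //.
by rewrite /ne /= xpair_eqE; lia.
Qed.

Lemma sorted_pribbon s : is_pcomp s -> sorted ne (pribbon_boxes s).
Proof.
case: s => // -[|a] t /= h; first exact: path_ribbon.
exact: (@path_ribbon (0, 0)%N 0 1 (a.+1 :: t)).
Qed.

Lemma size_pribbon s : size (pribbon_boxes s) = (sumn s).+1.
Proof.
case: s => [|[|a] t] //=; first by rewrite size_ribbon.
by rewrite size_cat size_map size_iota size_ribbon.
Qed.

Lemma size_add_ribbons acc cs :
  size (add_ribbons acc cs) = (size acc + sumn (map sumn cs))%N.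
Proof.
elim: cs acc => [|s cs IH] acc /=; first by rewrite addn0.
by rewrite IH size_cat size_ribbon addnA.
Qed.

Lemma sorted_add_ribbons acc cs : (0 < size acc)%N -> sorted ne acc ->
  all is_comp cs -> sorted ne (add_ribbons acc cs).
Proof.
elim: cs acc => //= s cs IH [//|b acc] _ /= h /andP[/andP[_ hs] hcs].
apply: IH => //=; rewrite cat_path h; apply: path_ribbon => //.
by case: (last b acc) => r c; rewrite /ne /= xpair_eqE; lia.
Qed.

Variables (n : nat) (g : gpribbon n).

Lemma size_boxes : size (boxes g) = n.+1.
Proof.
case: g => s cs h; have /and3P[_ _ /eqP e] := h.
by rewrite /boxes size_add_ribbons size_pribbon /= addSn e.
Qed.

Lemma sorted_boxes : sorted ne (boxes g).
Proof.
case: g => s cs h; have /and3P[hs hcs _] := h; apply: sorted_add_ribbons => //.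
exact: sorted_pribbon.
Qed.

Lemma boxes_lt j k : (j < k < n.+1)%N ->
  [/\ row_ g j <= row_ g k, col_ g j <= col_ g k &
      (row_ g j < row_ g k) || (col_ g j < col_ g k)]%N.
Proof.
move=> /andP[jk kn].
have := sorted_ltn_nth ne_trans (0, 0)%N sorted_boxes.
move=> /(_ j k); rewrite !inE size_boxes => /(_ (ltn_trans jk kn) kn jk).
rewrite /row_ /col_; case: (nth _ _ j) => r c; case: (nth _ _ k) => r' c'.
by rewrite /ne /= xpair_eqE => *; split; lia.
Qed.

Lemma row_ltn (j k : 'I_n.+1) : row_ g j = row_ g k ->
  (col_ g j < col_ g k)%N -> (j < k)%N.
Proof.
move=> er h; case: (ltngtP j k) h => //.
- by move=> kj; have [] := @boxes_lt k j _; rewrite ?kj ?ltn_ord //; lia.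
- by move/val_inj ->; rewrite ltnn.
Qed.

Lemma col_ltn (j k : 'I_n.+1) : col_ g j = col_ g k ->
  (row_ g j < row_ g k)%N -> (j < k)%N.
Proof.
move=> er h; case: (ltngtP j k) h => //.
- by move=> kj; have [] := @boxes_lt k j _; rewrite ?kj ?ltn_ord //; lia.
- by move/val_inj ->; rewrite ltnn.
Qed.

End Boxes.

(* A letter of {+-1, ..., +-n}: its sign (true for negative) and its absolute
   value minus one. *)
Definition letter (n : nat) : Type := (bool * 'I_n)%type.

Definition lval n (x : letter n) : int := if x.1 then - x.2.+1%:Z else x.2.+1%:Z.

Definition pred_ord n (i : 'I_n) : 'I_n :=
  Ordinal (leq_ltn_trans (leq_pred i) (ltn_ord i)).

(* The generator s_i acting on letters. For i >= 1 the absolute values i and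
   i + 1 are encoded as [pred_ord i] and [i]. *)
Definition sletter n (i : 'I_n) (x : letter n) : letter n :=
  if i == 0%N :> nat then (if x.2 == i then ~~ x.1 else x.1, x.2)
  else (x.1, tperm (pred_ord i) i x.2).

(* A filling, given by its reading word. *)
Definition filling (n : nat) : Type := {ffun 'I_n -> letter n}.
HB.instance Definition _ n := Finite.on (filling n).

Definition sfill n (i : 'I_n) (w : filling n) : filling n :=
  [ffun k => sletter i (w k)].

(* The entry of the k-th box in reading order, the 0-box being box 0. *)
Definition entry n (w : filling n) (k : 'I_n.+1) : int :=
  if unlift ord0 k is Some j then lval (w j) else 0.

Definition signed_perm n (w : filling n) : bool :=
  injectiveb (fun k => (w k).2).

Definition rows_incr n (g : gpribbon n) (w : filling n) : bool :=
  [forall j : 'I_n.+1, forall k : 'I_n.+1,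
    (row_ g j == row_ g k) && (col_ g j < col_ g k)%N ==> (entry w j < entry w k)].

Definition cols_incr n (g : gpribbon n) (w : filling n) : bool :=
  [forall j : 'I_n.+1, forall k : 'I_n.+1,
    (col_ g j == col_ g k) && (row_ g j < row_ g k)%N ==> (entry w k < entry w j)].

Definition standard n (g : gpribbon n) (w : filling n) : bool :=
  [&& signed_perm w, rows_incr g w & cols_incr g w].

Record tab n (g : gpribbon n) := Tab { tab_fill :> filling n; tabP : standard g tab_fill }.
HB.instance Definition _ n (g : gpribbon n) := [isSub for @tab_fill n g].
HB.instance Definition _ n (g : gpribbon n) := [Finite of tab g by <:].

(* The row of the box containing the k-th letter of the reading word. *)
Definition lrow n (g : gpribbon n) (k : 'I_n) : nat := row_ g k.+1.

Definition descent n (g : gpribbon n) (w : filling n) (i : 'I_n) : bool :=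
  if i == 0%N :> nat then [exists k, lval (w k) == -1]
  else [exists k, exists l,
    [|| [&& lval (w k) == i%:Z, lval (w l) == i.+1%:Z & (lrow g l < lrow g k)%N],
        [&& lval (w k) == - i%:Z, lval (w l) == - i.+1%:Z & (lrow g k < lrow g l)%N]
      | (lval (w k) == i%:Z) && (lval (w l) == - i.+1%:Z)]].

Section TableauModule.
Variables (F : fieldType) (n : nat) (g : gpribbon n).

Definition tabspace : lmodType F := {ffun tab g -> F^o}.

Definition tabvec (t : tab g) : tabspace := [ffun u => (u == t)%:R].

(* The action of [pi_i - 1] on a standard tableau. *)
Definition tabact (i : 'I_n) (t : tab g) : tabspace :=
  if descent g t i then - tabvec t
  else if insub (sfill i t) is Some t' then tabvec t' else 0.

Definition pibar (i : 'I_n) (v : tabspace) : tabspace :=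
  \sum_(t : tab g) v t *: tabact i t.

Lemma pibar_linear i : linear (pibar i).
Proof.
move=> c u v; rewrite /pibar scaler_sumr -big_split /=; apply: eq_bigr => t _.
by rewrite !ffunE scalerDl scalerA.
Qed.
HB.instance Definition _ i := GRing.isLinear.Build F tabspace tabspace *:%R
  (pibar i) (pibar_linear i).

Lemma pibar_tab i t : pibar i (tabvec t) = tabact i t.
Proof.
rewrite /pibar (bigD1 t) //= big1 => [|u ne]; rewrite ffunE.
  by rewrite eqxx scale1r addr0.
by rewrite (negbTE ne) scale0r.
Qed.

Lemma tabspaceE (v : tabspace) : v = \sum_(t : tab g) v t *: tabvec t.
Proof.
apply/ffunP => u; rewrite sum_ffunE (bigD1 u) //= big1 => [|t ne].
  by rewrite !ffunE eqxx addr0 /GRing.scale /= mulr1.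
by rewrite !ffunE eq_sym (negbTE ne) scaler0.
Qed.

Implicit Types (w : filling n) (i : 'I_n).

(* The position (with sign) of the letter of absolute value a + 1. *)
Definition lpos (a : 'I_n) w : int :=
  \sum_(k | (w k).2 == a) (if (w k).1 then - k.+1%:Z else k.+1%:Z).

Lemma lposE w k : signed_perm w ->
  lpos (w k).2 w = if (w k).1 then - k.+1%:Z else k.+1%:Z.
Proof.
move=> /injectiveP inj; rewrite /lpos (bigD1 k) //= big1 ?addr0 // => j.
by move=> /andP[/eqP /inj ->]; rewrite eqxx.
Qed.

Lemma signed_perm_surj w a : signed_perm w -> exists k, (w k).2 = a.
Proof.
move=> /injectiveP inj; exists (invF inj a); exact: (f_invF inj).
Qed.

Lemma lpos_neq0 w a : signed_perm w -> lpos a w != 0.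
Proof.
move=> sp; have [k <-] := signed_perm_surj a sp; rewrite lposE //.
by case: (w k).1; lia.
Qed.

Lemma lpos_neq w a b : signed_perm w -> a != b ->
  lpos a w != lpos b w /\ lpos a w != - lpos b w.
Proof.
move=> sp; have [k <-] := signed_perm_surj a sp.
have [l <-] := signed_perm_surj b sp => ne.
have nkl : k != l by apply: contraNneq ne => ->.
rewrite !lposE //; move: nkl; rewrite -val_eqE /= => nkl.
by case: (w k).1; case: (w l).1; split; lia.
Qed.

Lemma lpos_sfill0 i a w : i = 0%N :> nat ->
  lpos a (sfill i w) = if a == i then - lpos a w else lpos a w.
Proof.
move=> i0; rewrite /lpos; under eq_bigl do rewrite ffunE /sletter i0 /=.
case: eqP => [->|ne].
  rewrite -sumrN; apply: eq_bigr => k /eqP e; rewrite ffunE /sletter i0 /= e.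
  by rewrite eqxx; case: (w k).1; rewrite /= ?opprK.
apply: eq_bigr => k /eqP e; rewrite ffunE /sletter i0 /= e.
by case: eqP ne.
Qed.

Lemma lpos_sfill i a w : i != 0%N :> nat ->
  lpos a (sfill i w) = lpos (tperm (pred_ord i) i a) w.
Proof.
move=> i0; rewrite /lpos; apply: eq_big => k.
  by rewrite ffunE /sletter (negbTE i0) /= -(inj_eq (@perm_inj _ (tperm (pred_ord i) i))) tpermK.
by rewrite ffunE /sletter (negbTE i0).
Qed.

Lemma signed_perm_sfill i w : signed_perm w -> signed_perm (sfill i w).
Proof.
move=> /injectiveP inj; apply/injectiveP => k l; rewrite !ffunE /sletter.
by case: ifP => _ /=; [move/inj|move/perm_inj/inj].
Qed.

(* Descents in terms of positions. *)
Definition wdes (i : 'I_n) w : bool :=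
  if i == 0%N :> nat then lpos i w < 0 else lpos i w < lpos (pred_ord i) w.

Lemma pred_ord_val (i : 'I_n) : i != 0%N :> nat -> (pred_ord i).+1 = i.
Proof. by case: i => -[]. Qed.

Lemma entry_lift w k : entry w (lift ord0 k) = lval (w k).
Proof. by rewrite /entry liftK. Qed.

Lemma lrow_lift k : lrow g k = row_ g (lift ord0 k).
Proof. by []. Qed.

Lemma descentE w i : standard g w -> descent g w i = wdes i w.
Proof.
move=> /and3P[sp /forallP rinc _]; rewrite /descent /wdes.
have rowP (k l : 'I_n) : (k < l)%N -> lval (w l) <= lval (w k) -> (lrow g k < lrow g l)%N.
  move=> kl le; have := @boxes_lt n g k.+1 l.+1; rewrite !ltnS kl ltn_ord.
  move=> /(_ isT) [lr lc ne]; rewrite ltn_neqAle lr andbT; apply/eqP => er.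
  have /forallP/(_ (lift ord0 l))/implyP := rinc (lift ord0 k).
  rewrite !entry_lift ltNge le => h; apply/notF/h.
  by move: er ne; rewrite /lrow /= => ->; rewrite eqxx ltnn.
have rowW (k l : 'I_n) : (lrow g k < lrow g l)%N -> (k < l)%N.
  move=> h; rewrite ltnNge; apply/negP; rewrite leq_eqVlt => /orP[/eqP/val_inj e|lk].
    by rewrite e ltnn in h.
  have := @boxes_lt n g l.+1 k.+1; rewrite !ltnS lk ltn_ord => /(_ isT) [].
  by rewrite -/(lrow g l) -/(lrow g k); lia.
case: ifP => [/eqP i0|/negbT i0].
  have [k ek] := signed_perm_surj i sp; rewrite -ek lposE //.
  apply/existsP/idP => [[l /eqP]|].
    move=> h; have el : (w l).2 = i.
      apply: val_inj => /=; move: h; rewrite /lval; case: (w l).1; lia.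
    have -> : k = l by apply: (injectiveP _ sp); rewrite ek el.
    by move: h; rewrite /lval; case: (w l).1; lia.
  move=> h; exists k; rewrite /lval; case: (w k).1 h; last by lia.
  by rewrite ek i0.
have [k ek] := signed_perm_surj (pred_ord i) sp.
have [l el] := signed_perm_surj i sp.
have pk := @lposE w k sp; have pl := @lposE w l sp; rewrite ek in pk; rewrite el in pl.
rewrite pk pl.
have nkl : k != l :> nat.
  apply/eqP => /val_inj e; move: ek; rewrite e el => /(congr1 val) /=.
  by have := pred_ord_val i0; rewrite /=; lia.
have vk : lval (w k) = if (w k).1 then - i%:Z else i%:Z.
  by rewrite /lval ek pred_ord_val.
have vl : lval (w l) = if (w l).1 then - i.+1%:Z else i.+1%:Z.
  by rewrite /lval el.
have uk j : `|lval (w j)|%N = i -> j = k.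
  move=> h; apply: (injectiveP _ sp); rewrite ek; apply: val_inj => /=.
  by move: h; rewrite /lval; case: (w j).1; lia.
have ul j : `|lval (w j)|%N = i.+1 -> j = l.
  move=> h; apply: (injectiveP _ sp); rewrite el; apply: val_inj => /=.
  by move: h; rewrite /lval; case: (w j).1; lia.
have rkl := rowP k l; have rlk := rowP l k; have wkl := rowW k l; have wlk := rowW l k.
apply/existsP/idP => [[k' /existsP[l' h]]|h].
  have e1 : k' = k by apply: uk; move: h; lia.
  have e2 : l' = l by apply: ul; move: h; lia.
  move: h; rewrite e1 e2 vk vl; move: i0.
  by case: (w k).1; case: (w l).1; lia.
exists k; apply/existsP; exists l; rewrite vk vl; move: h i0 rkl rlk; rewrite vk vl.
by case: (w k).1; case: (w l).1; lia.
Qed.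

Lemma entry_sfill i w k : entry (sfill i w) k =
  if unlift ord0 k is Some j then lval (sletter i (w j)) else 0.
Proof. by rewrite /entry; case: unliftP => // j _; rewrite ffunE. Qed.

Lemma lval_sletter0 i (x : letter n) : i = 0%N :> nat ->
  lval (sletter i x) = if `|lval x|%N == 1%N then - lval x else lval x.
Proof.
move=> i0; case: x => b a; rewrite /sletter i0 /lval /= -val_eqE /= i0.
by case: b; case: eqP => /=; case: eqP => /=; lia.
Qed.

Lemma lval_sletter i (x : letter n) : i != 0%N :> nat ->
  lval (sletter i x) = if `|lval x|%N == i then (if x.1 then - i.+1%:Z else i.+1%:Z)
    else if `|lval x|%N == i.+1 then (if x.1 then - i%:Z else i%:Z) else lval x.
Proof.
move=> i0; case: x => b a; rewrite /sletter (negbTE i0) /lval /=.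
have := pred_ord_val i0.
case: tpermP => [->|->|/eqP + /eqP +] /=; rewrite -?val_eqE /=;
  case: b; do 2?case: ifP => //=; lia.
Qed.

Lemma entry_cases w k : entry w k = 0 /\ k = 0%N :> nat \/
  exists j : 'I_n, [/\ entry w k = lval (w j), k = j.+1 :> nat
    & forall i, entry (sfill i w) k = lval (sletter i (w j))].
Proof.
rewrite /entry; case: unliftP => [j ->|->]; [right|by left].
by exists j; split => // i; rewrite ffunE.
Qed.

(* Inversions persist when multiplying by a non-descent. *)
Lemma inv_persist i w (j k : 'I_n.+1) : signed_perm w -> ~~ wdes i w ->
  (j < k)%N -> entry w k < entry w j ->
  entry (sfill i w) k < entry (sfill i w) j.
Proof.
move=> sp nd jk.
have [[ek k0]|[l [ek kl sk]]] := entry_cases w k; first by move: jk; rewrite k0.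
rewrite ek sk.
have pl := @lposE w l sp.
have [[ej j0]|[m [ej jm sj]]] := entry_cases w j.
  have -> : entry (sfill i w) j = 0.
    by rewrite entry_sfill; case: unliftP j0 => // m ->.
  rewrite ej; move: nd; rewrite /wdes; case: ifP => [/eqP i0|/negbT i0] nd.
    rewrite lval_sletter0 // /lval; case: (w l).1 (pl) => //= pl' _.
    case: eqP => //= h; exfalso; move: nd.
    have <- : (w l).2 = i by apply: val_inj => /=; lia.
    by rewrite pl'; lia.
  rewrite lval_sletter // /lval; case: (w l).1 => //= _.
  by do 2?case: ifP => //=; lia.
have pm := @lposE w m sp.
have nml : m != l by rewrite -val_eqE /=; lia.
have nml2 : (w m).2 != (w l).2 by apply: contraNneq nml => /(injectiveP _ sp) ->.
rewrite ej sj; move: nd; rewrite /wdes; case: ifP => [/eqP i0|/negbT i0] nd.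
  rewrite !lval_sletter0 //; move: nml2; rewrite -val_eqE /= /lval.
  by case: (w l).1; case: (w m).1 => /=; do 2?case: ifP => //=; lia.
rewrite !lval_sletter //.
have pi := pred_ord_val i0.
have lv (x : letter n) : `|lval x|%N = x.2.+1 by rewrite /lval; case: x.1; lia.
rewrite !lv.
case E1 : ((w l).2.+1 == i) => /=; case E2: ((w m).2.+1 == i.+1) => /=.
- have e1 : (w l).2 = pred_ord i by apply: val_inj; move: E1 => /=; lia.
  have e2 : (w m).2 = i by apply: val_inj; move: E2 => /=; lia.
  move: nd; rewrite -e1 -e2 pl pm; move: E1 E2; rewrite /lval.
  by case: (w l).1; case: (w m).1; do 3?case: ifP => /=; lia.
- move: nml2 E1 E2; rewrite -val_eqE /= /lval.
  by case: (w l).1; case: (w m).1; do 3?case: ifP => /=; lia.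
- case E3 : ((w l).2.+1 == i.+1); first by move: nml2 E2 E3; rewrite -val_eqE /=; lia.
  move: nml2 E1 E2; rewrite -val_eqE /= /lval.
  by case: (w l).1; case: (w m).1; do 3?case: ifP => /=; lia.
- case E3 : ((w l).2.+1 == i.+1); case E4 : ((w m).2.+1 == i) => //=.
  + have e1 : (w l).2 = i by apply: val_inj; move: E3 => /=; lia.
    have e2 : (w m).2 = pred_ord i by apply: val_inj; move: E4 => /=; lia.
    move: nd; rewrite -e2 -e1 pl pm; move: E3 E4; rewrite /lval.
    by case: (w l).1; case: (w m).1; lia.
  + move: nml2 E1 E2 E3 E4; rewrite -val_eqE /= /lval.
    by case: (w l).1; case: (w m).1; lia.
  + move: nml2 E1 E2 E3 E4; rewrite -val_eqE /= /lval.
    by case: (w l).1; case: (w m).1; lia.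
Qed.

Lemma entry_neq w (j k : 'I_n.+1) : signed_perm w -> j != k -> entry w j != entry w k.
Proof.
move=> sp; rewrite -val_eqE /=.
have [[-> j0]|[l [-> jl _]]] := entry_cases w j;
have [[-> k0]|[m [-> km _]]] := entry_cases w k; rewrite ?j0 ?k0 ?jl ?km //.
- by rewrite /lval; case: (w m).1; lia.
- by rewrite /lval; case: (w l).1; lia.
move=> ne; have nlm : l != m by rewrite -val_eqE /=; lia.
have : (w l).2 != (w m).2 by apply: contraNneq nlm => /(injectiveP _ sp) ->.
by rewrite -val_eqE /= /lval; case: (w l).1; case: (w m).1; lia.
Qed.

Definition okfill w : Prop := signed_perm w /\ cols_incr g w.

Definition Efill w : tabspace := if insub w is Some t then tabvec t else 0.

Lemma Efill_tab (t : tab g) : Efill t = tabvec t.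
Proof. by rewrite /Efill valK. Qed.

Lemma okfill_tab (t : tab g) : okfill t.
Proof. by have /and3P[] := tabP t. Qed.

Lemma cols_up i w : signed_perm w -> ~~ wdes i w -> cols_incr g w ->
  cols_incr g (sfill i w).
Proof.
move=> sp nd /forallP h; apply/forallP => j; apply/forallP => k; apply/implyP.
move=> hc; have /forallP/(_ k)/implyP/(_ hc) := h j.
by apply: inv_persist => //; have /andP[/eqP e1 e2] := hc; exact: (@col_ltn n g).
Qed.

Lemma rows_up i w : signed_perm w -> ~~ wdes i w ->
  rows_incr g (sfill i w) -> rows_incr g w.
Proof.
move=> sp nd /forallP h; apply/forallP => j; apply/forallP => k; apply/implyP.
move=> hc; have /forallP/(_ k)/implyP/(_ hc) := h j.
have jk : (j < k)%N by have /andP[/eqP e1 e2] := hc; exact: (@row_ltn n g).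
apply: contraTT; rewrite -!leNgt le_eqVlt => /orP[/eqP e|].
  have kj : k != j by rewrite -val_eqE /=; lia.
  by have := entry_neq sp kj; rewrite e eqxx.
by move=> /(inv_persist sp nd jk) /ltW.
Qed.

Lemma pibarT i w : okfill w -> wdes i w -> pibar i (Efill w) = - Efill w.
Proof.
move=> [sp hc] hd; rewrite /Efill; case: insubP => [t st e|_].
  by rewrite pibar_tab /tabact descentE ?tabP // -[tab_fill t]/(val t) e hd.
by rewrite raddf0 oppr0.
Qed.

Lemma pibarF i w : okfill w -> ~~ wdes i w ->
  pibar i (Efill w) = Efill (sfill i w) /\ okfill (sfill i w).
Proof.
move=> [sp hc] nd; split; last first.
  by split; [exact: signed_perm_sfill|exact: cols_up].
rewrite {1}/Efill; case: insubP => [t st e|nst].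
  by rewrite pibar_tab /tabact descentE ?tabP // -[tab_fill t]/(val t) e (negbTE nd).
rewrite raddf0 /Efill insubN //; apply: contra nst => /and3P[_ hr _].
by rewrite /standard sp hc (rows_up sp nd hr).
Qed.

End TableauModule.

Definition adjacent (i j : nat) : bool := (i.+1 == j) || (j.+1 == i).

(* The generators pi_0, ..., pi_(n-1) of type B are indexed by ['I_n]. *)
Definition coxB n (i j : 'I_n) : nat :=
  if adjacent i j then if (i == 0%N :> nat) || (j == 0%N :> nat) then 4 else 3
  else 2.

(* The generators pi_1, ..., pi_(m-1) of type A are indexed by ['I_m.-1],
   shifted by one. *)
Definition coxA m (i j : 'I_m.-1) : nat := if adjacent i j then 3 else 2.

Definition HeckeB (F : fieldType) (n : nat) := hecke F (@coxB n).
Definition HeckeA (F : fieldType) (m : nat) := hecke F (@coxA m).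
HB.instance Definition _ F n := GRing.Algebra.on (HeckeB F n).
HB.instance Definition _ F n := GRing.Algebra.on (HeckeA F n).

Definition pi_B (F : fieldType) n (i : 'I_n) : HeckeB F n := hgen i.
Definition pi_A (F : fieldType) m (i : 'I_m.-1) : HeckeA F m := hgen i.

Section TableauRelations.
Variables (F : fieldType) (n : nat) (g : gpribbon n).
Implicit Types (w : filling n) (i j : 'I_n).

Local Notation V := (tabspace F g).
Local Notation P := (@pibar F n g).
Local Notation E := (@Efill F n g).

Lemma tabspace_ext (f h : {linear V -> V}) :
  (forall w, okfill g w -> f (E w) = h (E w)) -> forall v, f v = h v.
Proof.
move=> e v; rewrite (tabspaceE v) !linear_sum; apply: eq_bigr => t _.
by rewrite !linearZ /= -Efill_tab e //; exact: okfill_tab.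
Qed.

Definition lpred i w : int := if i == 0%N :> nat then 0 else lpos (pred_ord i) w.

Lemma wdesE i w : wdes i w = (lpos i w < lpred i w).
Proof. by rewrite /wdes /lpred; case: ifP. Qed.

Lemma pibar_des i w : okfill g w -> lpos i w < lpred i w -> P i (E w) = - E w.
Proof. by move=> ok h; apply: pibarT; rewrite ?wdesE. Qed.

Lemma pibar_asc i w : okfill g w -> lpred i w <= lpos i w ->
  P i (E w) = E (sfill i w) /\ okfill g (sfill i w).
Proof. by move=> ok h; apply: pibarF; rewrite ?wdesE -?leNgt. Qed.

Lemma pred_ord_neq i : i != 0%N :> nat -> pred_ord i != i.
Proof. by rewrite -val_eqE /=; lia. Qed.

Lemma lpred_neq i w : signed_perm w -> lpos i w != lpred i w.
Proof.
move=> sp; rewrite /lpred; case: ifP => [_|/negbT i0]; first exact: lpos_neq0.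
by rewrite eq_sym; have [] := lpos_neq sp (pred_ord_neq i0).
Qed.

Lemma lpos_self i w : lpos i (sfill i w) = if i == 0%N :> nat then - lpos i w
  else lpos (pred_ord i) w.
Proof.
case: ifP => [/eqP i0|/negbT i0]; first by rewrite lpos_sfill0 // eqxx.
by rewrite lpos_sfill // tpermR.
Qed.

Lemma lpred_self i w : lpred i (sfill i w) = if i == 0%N :> nat then 0
  else lpos i w.
Proof.
rewrite /lpred; case: ifP => // /negbT i0; by rewrite lpos_sfill // tpermL.
Qed.

Lemma lpos_other i a w : a != i -> (i != 0%N :> nat -> a != pred_ord i) ->
  lpos a (sfill i w) = lpos a w.
Proof.
move=> ne nep; case: (eqVneq (i : nat) 0%N) => [i0|i0].
  by rewrite lpos_sfill0 // (negbTE ne).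
by rewrite lpos_sfill // tpermD // eq_sym // nep.
Qed.

Lemma pibar_sq i (v : V) : P i (P i v) = - P i v.
Proof.
pose f : {linear V -> V} := (P i \o P i)%FUN.
pose h : {linear V -> V} := (-%R \o P i)%FUN.
rewrite -[LHS]/(f v) -[RHS]/(h v); apply: tabspace_ext => w ok.
rewrite /f /h /=; have [d|a] := ltrP (lpos i w) (lpred i w).
  by rewrite pibar_des // raddfN /= pibar_des.
have [-> ok'] := pibar_asc ok a; rewrite pibar_des //.
have := @lpred_neq i w ok.1; move: a; rewrite lpos_self lpred_self /lpred.
by case: ifP => _; lia.
Qed.

Lemma sfill_ext (f h : letter n -> letter n) w :
  f =1 h -> [ffun k => f (w k)] = [ffun k => h (w k)].
Proof. by move=> e; apply/ffunP => k; rewrite !ffunE e. Qed.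

Lemma sfillC i j w : i != j -> ~~ adjacent i j ->
  sfill i (sfill j w) = sfill j (sfill i w).
Proof.
move=> ne nadj; apply/ffunP => k; rewrite !ffunE; case: (w k) => b a.
have nij : i != j :> nat by [].
have tpD (l m y : 'I_n) : l != m -> pred_ord l != m ->
    (tperm (pred_ord l) l y == m) = (y == m).
  move=> n1 n2; apply/eqP/eqP => [|->]; last by rewrite tpermD.
  by move/(canRL (tpermK _ _)) ->; rewrite tpermD.
rewrite /sletter; case: (eqVneq (i : nat) 0%N) => i0;
  case: (eqVneq (j : nat) 0%N) => j0 /=; try by lia.
- by rewrite tpD // -val_eqE /=; move: nadj; rewrite /adjacent; lia.
- by rewrite tpD // -val_eqE /=; move: nadj; rewrite /adjacent; lia.
congr pair; set pi := pred_ord i; set pj := pred_ord j.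
have /and4P[n1 n2 n3 n4] : [&& pi != pj, pi != j, i != pj & i != j].
  by rewrite -!val_eqE /=; move: nadj; rewrite /adjacent; lia.
have [->|->|/eqP h1 /eqP h2] := tpermP pj j a.
- by rewrite (tpermD n2 n4) (tpermD n1 n3) tpermL.
- by rewrite (tpermD n1 n3) (tpermD n2 n4) tpermR.
have [_|_|/eqP h3 /eqP h4] := tpermP pi i a.
- by rewrite tpermD // eq_sym.
- by rewrite tpermD // eq_sym.
- by rewrite tpermD // eq_sym.
Qed.

Lemma tperm_braid (T : finType) (a b c y : T) : a != b -> b != c -> a != c ->
  tperm a b (tperm b c (tperm a b y)) = tperm b c (tperm a b (tperm b c y)).
Proof.
move=> ab bc ac.
have [ba cb ca] : [/\ b != a, c != b & c != a] by split; rewrite eq_sym.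
have [->|ya] := eqVneq y a.
  by rewrite tpermL tpermL (tpermD ac bc) (tpermD ba ca) tpermL tpermL.
have [->|yb] := eqVneq y b.
  by rewrite tpermR (tpermD ba ca) !tpermL (tpermD ac bc) tpermR.
have [->|yc] := eqVneq y c.
  by rewrite (tpermD ac bc) !tpermR (tpermD ba ca).
by rewrite !(tpermD (z := y)) // eq_sym.
Qed.

Lemma sfill_braid3 i j w : i != 0%N :> nat -> i.+1 = j ->
  sfill i (sfill j (sfill i w)) = sfill j (sfill i (sfill j w)).
Proof.
move=> i0 ij; apply/ffunP => k; rewrite !ffunE; case: (w k) => b a.
have j0 : j != 0%N :> nat by rewrite -ij.
rewrite /sletter (negbTE i0) (negbTE j0) /=; congr pair.
have -> : pred_ord j = i by apply: val_inj; rewrite /= -ij.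
by apply: tperm_braid; rewrite -val_eqE /=; lia.
Qed.

Lemma sfill_braid4 i j w : i = 0%N :> nat -> i.+1 = j ->
  sfill i (sfill j (sfill i (sfill j w))) = sfill j (sfill i (sfill j (sfill i w))).
Proof.
move=> i0 ij; apply/ffunP => k; rewrite !ffunE; case: (w k) => b a.
have j0 : j != 0%N :> nat by rewrite -ij.
rewrite /sletter i0 /= (negbTE j0) /=.
have -> : pred_ord j = i by apply: val_inj; rewrite /= -ij.
have ne : i != j by rewrite -val_eqE /=; lia.
have ne' : j != i by rewrite eq_sym.
have E := (tpermL, tpermR, eqxx, negbTE ne, negbTE ne').
have [->|h1] := eqVneq a i; first by do 8?rewrite ?E /=.
have [->|h2] := eqVneq a j; first by do 8?rewrite ?E /=.
have [n1 n2] : i != a /\ j != a by split; rewrite eq_sym.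
by do 5?rewrite ?(tpermD n1 n2) ?(negbTE h1) /=.
Qed.

Lemma pibar_braid_lt i j (v : V) : (i < j)%N ->
  altcomp (coxB i j) (P i) (P j) v = altcomp (coxB i j) (P j) (P i) v.
Proof.
move=> ij; have ne : i != j by rewrite -val_eqE /=; lia.
rewrite /coxB /adjacent; have -> /= : (j.+1 == i) = false by lia.
rewrite orbF.
have j0 : (j == 0%N :> nat) = false by lia.
case: eqP => [eij|neij]; last first.
  pose f : {linear V -> V} := (P i \o P j)%FUN.
  pose h : {linear V -> V} := (P j \o P i)%FUN.
  rewrite -[LHS]/(f v) -[RHS]/(h v); apply: tabspace_ext => w.
  apply: (@braid2 V (filling n) E (okfill g) (P i) (P j) (sfill i) (sfill j)
     (lpred i) (lpos i) (lpred j) (lpos j)).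
  - exact: pibar_des.
  - exact: pibar_asc.
  - exact: pibar_des.
  - exact: pibar_asc.
  - move=> x; rewrite /lpred j0; split; apply: lpos_other;
      rewrite -?val_eqE /=; lia.
  - move=> x; rewrite /lpred; split; last first.
      by apply: lpos_other; rewrite -?val_eqE /=; lia.
    by case: ifP => // i0; apply: lpos_other; rewrite -?val_eqE /=; lia.
  - by move=> x; apply: sfillC => //; rewrite /adjacent; lia.
have pj : pred_ord j = i by apply: val_inj; rewrite /= -eij.
have lpj w : lpred j w = lpos i w by rewrite /lpred j0 pj.
rewrite j0 orbF; case: eqP => [i0|/eqP i0].
  pose f : {linear V -> V} := (P i \o (P j \o (P i \o P j)))%FUN.
  pose h : {linear V -> V} := (P j \o (P i \o (P j \o P i)))%FUN.
  rewrite -[LHS]/(f v) -[RHS]/(h v); apply: tabspace_ext => w.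
  have lpi x : lpred i x = 0 by rewrite /lpred i0.
  apply: (@braid4 V (filling n) E (okfill g) (P i) (P j) (sfill i) (sfill j)
     (lpos i) (lpos j)).
  - by move=> x ok; rewrite -(lpi x); exact: pibar_des.
  - by move=> x ok; rewrite -(lpi x); exact: pibar_asc.
  - by move=> x ok; rewrite -(lpj x); exact: pibar_des.
  - by move=> x ok; rewrite -(lpj x); exact: pibar_asc.
  - move=> x [sp _]; have [] := lpos_neq sp ne.
    by rewrite !lpos_neq0.
  - move=> x; split; first by rewrite lpos_self i0.
    by apply: lpos_other; rewrite -?val_eqE /=; lia.
  - by move=> x; split; [rewrite -lpj lpred_self j0|rewrite lpos_self j0 pj].
  - by move=> x; exact: sfill_braid4.
pose f : {linear V -> V} := (P i \o (P j \o P i))%FUN.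
pose h : {linear V -> V} := (P j \o (P i \o P j))%FUN.
rewrite -[LHS]/(f v) -[RHS]/(h v); apply: tabspace_ext => w.
have lpi x : lpred i x = lpos (pred_ord i) x by rewrite /lpred (negbTE i0).
have npi := pred_ord_neq i0.
have npj : pred_ord i != j by rewrite -val_eqE /=; lia.
apply: (@braid3 V (filling n) E (okfill g) (P i) (P j) (sfill i) (sfill j)
   (lpos (pred_ord i)) (lpos i) (lpos j)).
- by move=> x ok; rewrite -(lpi x); exact: pibar_des.
- by move=> x ok; rewrite -(lpi x); exact: pibar_asc.
- by move=> x ok; rewrite -(lpj x); exact: pibar_des.
- by move=> x ok; rewrite -(lpj x); exact: pibar_asc.
- by move=> x [sp _]; have [-> _] := lpos_neq sp npi;
    have [-> _] := lpos_neq sp ne; have [-> _] := lpos_neq sp npj.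
- move=> x; split; last by apply: lpos_other; rewrite -?val_eqE /=; lia.
  by rewrite lpos_self (negbTE i0) -lpi lpred_self (negbTE i0).
- move=> x; split; last by rewrite lpos_self j0 pj.
  split; last by rewrite -lpj lpred_self j0.
  by apply: lpos_other; rewrite ?pj -?val_eqE /=; lia.
- by move=> x; exact: sfill_braid3.
Qed.

Lemma coxBC i j : coxB i j = coxB j i.
Proof.
by rewrite /coxB /adjacent orbC; do 2!congr (if _ then _ else _); rewrite orbC.
Qed.

Lemma pibar_braid i j (v : V) : i != j ->
  altcomp (coxB i j) (P i) (P j) v = altcomp (coxB i j) (P j) (P i) v.
Proof.
rewrite -val_eqE neq_ltn => /orP[]; first exact: pibar_braid_lt.
by move=> h; rewrite coxBC (pibar_braid_lt _ h).
Qed.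

Definition tabop i : {linear V -> V} := shiftop (P i).

Lemma tabop_idem i v : tabop i (tabop i v) = tabop i v.
Proof. exact: (@shift_idem F V (P i) (pibar_sq i)). Qed.

Lemma tabop_braid i j v : i != j ->
  altcomp (coxB i j) (tabop i) (tabop j) v
  = altcomp (coxB i j) (tabop j) (tabop i) v.
Proof.
move=> ne; apply: shift_braid; [exact: pibar_sq|exact: pibar_sq| |].
  by rewrite /coxB; do 2?case: ifP.
exact: pibar_braid.
Qed.

(* P^B_g: the tableau space, with [pi_i - 1] acting by [pibar i]. *)
Definition PB_rep : hrep F (@coxB n) := HRep tabop_idem tabop_braid.

Definition PB : lmodType (HeckeB F n) := hmod PB_rep.

Lemma PB_pibar i (v : PB) : (pi_B F i - 1) *: v = pibar i v.
Proof.
rewrite scalerBl scale1r [X in X - _](hmod_genE (r := PB_rep)) /=.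
by rewrite /shiftop addrK.
Qed.

End TableauRelations.

(* The tensor product over F of modules over two F-algebras. *)
Section OuterTensor.
Variables (F : fieldType) (A1 A2 : algType F).
Variables (V : lmodType A1) (W : lmodType A2).

Definition otensor : Type :=
  tensor (fun (x : V) (c : F) => (c%:A : A1) *: x)
         (fun (c : F) (y : W) => (c%:A : A2) *: y).

HB.instance Definition _ := GRing.Zmodule.on otensor.

Definition opure (x : V) (y : W) : otensor := pure _ _ x y.

Definition actl (a : A1) (t : otensor) : otensor :=
  tlift (fun x y => opure (a *: x) y) t.
Definition actr (b : A2) (t : otensor) : otensor :=
  tlift (fun x y => opure x (b *: y)) t.

Fact opureZ c x y : opure ((c%:A : A1) *: x) y = opure x ((c%:A : A2) *: y).
Proof. exact: pure_bal. Qed.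

Fact actl_Dl a x x' y :
  opure (a *: (x + x')) y = opure (a *: x) y + opure (a *: x') y.
Proof. by rewrite scalerDr [LHS]pureDl. Qed.
Fact actl_Dr a x y y' :
  opure (a *: x) (y + y') = opure (a *: x) y + opure (a *: x) y'.
Proof. exact: pureDr. Qed.
Fact actl_bal a x (c : F) y :
  opure (a *: ((c%:A : A1) *: x)) y = opure (a *: x) ((c%:A : A2) *: y).
Proof. by rewrite -opureZ !scalerA -scalerAl mul1r -scalerAr mulr1. Qed.
Fact actr_Dl b x x' y :
  opure (x + x') (b *: y) = opure x (b *: y) + opure x' (b *: y).
Proof. exact: pureDl. Qed.
Fact actr_Dr b x y y' :
  opure x (b *: (y + y')) = opure x (b *: y) + opure x (b *: y').
Proof. by rewrite scalerDr [LHS]pureDr. Qed.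
Fact actr_bal b x (c : F) y :
  opure ((c%:A : A1) *: x) (b *: y) = opure x (b *: ((c%:A : A2) *: y)).
Proof. by rewrite opureZ !scalerA -scalerAl mul1r -scalerAr mulr1. Qed.

Lemma actl_pure a x y : actl a (opure x y) = opure (a *: x) y.
Proof. exact: (tlift_pure (actl_Dl a) (actl_Dr a) (actl_bal a)). Qed.
Lemma actr_pure b x y : actr b (opure x y) = opure x (b *: y).
Proof. exact: (tlift_pure (actr_Dl b) (actr_Dr b) (actr_bal b)). Qed.
Lemma actlB a s t : actl a (s - t) = actl a s - actl a t.
Proof. exact: (tliftB (actl_Dl a) (actl_Dr a) (actl_bal a)). Qed.
Lemma actrB b s t : actr b (s - t) = actr b s - actr b t.
Proof. exact: (tliftB (actr_Dl b) (actr_Dr b) (actr_bal b)). Qed.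

HB.instance Definition _ a := GRing.isZmodMorphism.Build otensor otensor
  (actl a) (actlB a).
HB.instance Definition _ b := GRing.isZmodMorphism.Build otensor otensor
  (actr b) (actrB b).

Lemma otensor_ext (f h : {additive otensor -> otensor}) :
  (forall x y, f (opure x y) = h (opure x y)) -> f =1 h.
Proof. exact: tensor_ext. Qed.

Lemma actlA a b t : actl a (actl b t) = actl (a * b) t.
Proof.
elim/tensor_ind: t => [x y|s t es et].
  by rewrite -[pure _ _ _ _]/(opure x y) !actl_pure scalerA.
by rewrite [actl b _]actlB !actlB es et.
Qed.
Lemma actl1 : left_id 1 actl.
Proof.
elim/tensor_ind => [x y|s t es et].
  by rewrite -[pure _ _ _ _]/(opure x y) actl_pure scale1r.
by rewrite actlB es et.
Qed.
Lemma actlD a b t : actl (a + b) t = actl a t + actl b t.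
Proof.
elim/tensor_ind: t => [x y|s t es et].
  by rewrite -[pure _ _ _ _]/(opure x y) !actl_pure scalerDl [LHS]pureDl.
by rewrite !actlB es et opprD addrACA.
Qed.
Lemma actrA a b t : actr a (actr b t) = actr (a * b) t.
Proof.
elim/tensor_ind: t => [x y|s t es et].
  by rewrite -[pure _ _ _ _]/(opure x y) !actr_pure scalerA.
by rewrite [actr b _]actrB !actrB es et.
Qed.
Lemma actr1 : left_id 1 actr.
Proof.
elim/tensor_ind => [x y|s t es et].
  by rewrite -[pure _ _ _ _]/(opure x y) actr_pure scale1r.
by rewrite actrB es et.
Qed.
Lemma actlr a b t : actl a (actr b t) = actr b (actl a t).
Proof.
elim/tensor_ind: t => [x y|s t es et].
  by rewrite -[pure _ _ _ _]/(opure x y) actr_pure !actl_pure actr_pure.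
by rewrite actrB !actlB actrB es et.
Qed.

Definition oscale (c : F) (t : otensor) : otensor := actl c%:A t.

Fact oscaleA a b t : oscale a (oscale b t) = oscale (a * b) t.
Proof. by rewrite /oscale actlA -scalerAl mul1r scalerA. Qed.
Fact oscale1 : left_id 1 oscale.
Proof. by move=> t; rewrite /oscale scale1r actl1. Qed.
Fact oscaleDr : right_distributive oscale +%R.
Proof. by move=> a s t; exact: raddfD. Qed.
Fact oscaleDl t : {morph oscale^~ t : a b / a + b}.
Proof. by move=> a b; rewrite /oscale scalerDl actlD. Qed.

HB.instance Definition _ := GRing.Zmodule_isLmodule.Build F otensor
  oscaleA oscale1 oscaleDr oscaleDl.

Lemma actl_scale a : scalable (actl a).
Proof.
move=> c t; rewrite -[c *: t]/(oscale c t) -[RHS]/(oscale c _) /oscale !actlA.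
by rewrite -scalerAl mul1r -scalerAr mulr1.
Qed.
Lemma actr_scale b : scalable (actr b).
Proof.
by move=> c t; rewrite -[c *: t]/(oscale c t) -[RHS]/(oscale c _) /oscale actlr.
Qed.
HB.instance Definition _ a := GRing.isScalable.Build F otensor otensor *:%R
  (actl a) (actl_scale a).
HB.instance Definition _ b := GRing.isScalable.Build F otensor otensor *:%R
  (actr b) (actr_scale b).

Lemma altcomp_actl k a b t :
  altcomp k (actl a) (actl b) t = actl (altprod k a b) t.
Proof. by elim: k a b => [|k IH] a b /=; rewrite ?actl1 // IH actlA. Qed.
Lemma altcomp_actr k a b t :
  altcomp k (actr a) (actr b) t = actr (altprod k a b) t.
Proof. by elim: k a b => [|k IH] a b /=; rewrite ?actr1 // IH actrA. Qed.

End OuterTensor.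

(* A module V over H^B_k(0) and a module W over H_m(0) yield a module over
   H^B_(k + m)(0): pi_i acts on V for i < k, pi_(k + j) acts as pi_j on W for
   0 < j < m, and pi_k acts by 0. Only the restriction to the subalgebra
   generated by the pi_i with i != k, which is H^B_k(0) (x) H_m(0), is used
   below; there it is the outer tensor product of V and W, and the value of
   pi_k is a choice that is compatible with the relations. *)
Section OuterProduct.
Variables (F : fieldType) (k m : nat).
Variables (V : lmodType (HeckeB F k)) (W : lmodType (HeckeA F m)).

Local Notation T := (otensor V W).

Definition typeA_index (j : 'I_m) : option 'I_m.-1 :=
  if (j : nat) is j'.+1 then insub j' else None.

Definition outer_op (i : 'I_(k + m)) : {linear T -> T} :=
  match split i with
  | inl i' => actl (pi_B F i')
  | inr j => if typeA_index j is Some j' then actr (pi_A F j') else \0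
  end.

Lemma typeA_indexP (j : 'I_m) : if typeA_index j is Some j'
  then j = j'.+1 :> nat else j = 0%N :> nat.
Proof.
rewrite /typeA_index; case ej: (j : nat) => [|j'] //.
by case: insubP => [u _ <-|] //; have := ltn_ord j; lia.
Qed.

Lemma altcomp_null (l : nat) (f : {linear T -> T}) t : (1 < l)%N ->
  altcomp l (\0 : {linear T -> T}) f t = 0 /\
  altcomp l f (\0 : {linear T -> T}) t = 0.
Proof. by case: l => [|[|l]] //= _; split=> //; rewrite raddf0. Qed.

Lemma outer_idem i t : outer_op i (outer_op i t) = outer_op i t.
Proof.
rewrite /outer_op; case: (split i) => [i'|j] /=.
  by rewrite actlA hgen_idem.
by case: typeA_index => [j'|] //=; rewrite actrA hgen_idem.
Qed.

Lemma outer_braid i j t : i != j ->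
  altcomp (coxB i j) (outer_op i) (outer_op j) t
  = altcomp (coxB i j) (outer_op j) (outer_op i) t.
Proof.
move=> ne; have c2 : (1 < coxB i j)%N by rewrite /coxB; do 2?case: ifP.
rewrite /outer_op; case: splitP => [i' ei|i' ei]; case: splitP => [j' ej|j' ej].
- have -> : coxB i j = coxB i' j' by rewrite /coxB ei ej.
  have ne' : i' != j' by move: ne; rewrite -!val_eqE /= ei ej.
  have e := @hgen_braid F _ (@coxB k) i' j' ne'.
  rewrite [LHS]altcomp_actl [RHS]altcomp_actl.
  exact: (congr1 (fun a => actl a t) e).
- have := typeA_indexP j'; case: typeA_index => [j''|] e; last first.
    by have [-> ->] := altcomp_null (actl (pi_B F i')) t c2.
  have -> : coxB i j = 2.
    by rewrite /coxB /adjacent; have := ltn_ord i'; case: ifP => //; lia.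
  exact: actlr.
- have := typeA_indexP i'; case: typeA_index => [i''|] e; last first.
    by have [-> ->] := altcomp_null (actl (pi_B F j')) t c2.
  have -> : coxB i j = 2.
    by rewrite /coxB /adjacent; have := ltn_ord j'; case: ifP => //; lia.
  by rewrite /= actlr.
have := typeA_indexP i'; case: typeA_index => [i''|] e; last first.
  by case: typeA_index => [j''|];
    [have [-> ->] := altcomp_null (actr (pi_A F j'')) t c2|].
have := typeA_indexP j'; case: typeA_index => [j''|] e'; last first.
  by have [-> ->] := altcomp_null (actr (pi_A F i'')) t c2.
have -> : coxB i j = coxA i'' j''.
  by rewrite /coxB /coxA /adjacent; do 3?case: ifP => //; lia.
have ne' : i'' != j'' by move: ne; rewrite -!val_eqE /=; lia.
have eq := @hgen_braid F _ (@coxA m) i'' j'' ne'.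
rewrite [LHS]altcomp_actr [RHS]altcomp_actr.
exact: (congr1 (fun a => actr a t) eq).
Qed.

Definition outer_rep : hrep F (@coxB (k + m)) := HRep outer_idem outer_braid.

Definition outer : lmodType (HeckeB F (k + m)) := hmod outer_rep.

Lemma outer_l (i : 'I_k) (x : V) (y : W) :
  pi_B F (lshift m i) *: (opure x y : outer) = opure (pi_B F i *: x) y.
Proof.
rewrite [LHS](hmod_genE (r := outer_rep)) /= /outer_op.
by rewrite (unsplitK (inl i)) [LHS]actl_pure.
Qed.

Lemma outer_r (j : 'I_m) (j' : 'I_m.-1) (x : V) (y : W) : j = j'.+1 :> nat ->
  pi_B F (rshift k j) *: (opure x y : outer) = opure x (pi_A F j' *: y).
Proof.
move=> e; rewrite [LHS](hmod_genE (r := outer_rep)) /= /outer_op.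
rewrite (unsplitK (inr j)); have := typeA_indexP j.
case: typeA_index => [j''|]; rewrite e // => -[/val_inj ->].
by rewrite [LHS]actr_pure.
Qed.

End OuterProduct.

(* P_(m): the one-dimensional module on which every pi_j - 1 acts by 0. *)
Section TypeAOneRow.
Variables (F : fieldType) (m : nat).

Definition PA_op (j : 'I_m.-1) : {linear F^o -> F^o} := idfun.

Lemma PA_idem j v : PA_op j (PA_op j v) = PA_op j v.
Proof. by []. Qed.

Lemma PA_braid i j v : i != j ->
  altcomp (coxA i j) (PA_op i) (PA_op j) v
  = altcomp (coxA i j) (PA_op j) (PA_op i) v.
Proof. by rewrite /coxA; case: ifP. Qed.

Definition PA_rep : hrep F (@coxA m) := HRep PA_idem PA_braid.

Definition PA : lmodType (HeckeA F m) := hmod PA_rep.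
End TypeAOneRow.

Fixpoint outer_prod (F : fieldType) (k : nat) (V : lmodType (HeckeB F k))
    (s : seq nat) : lmodType (HeckeB F (foldl addn k s)) :=
  if s is m :: s' then outer_prod (outer V (PA F m)) s' else V.

Lemma pcomp1P n : is_pcomp [:: n] && (sumn [:: n] == n).
Proof. by rewrite /= addn0 eqxx. Qed.

Definition pcomp1 (n : nat) : pscomp n := PComp (pcomp1P n).

Section PseudoCompositions.
Variables (n : nat) (a : pscomp n).

Definition pc_head : nat := head 0%N a.
Definition pc_tail : seq nat := behead a.

Lemma pcomp_sum : foldl addn pc_head pc_tail = n.
Proof.
rewrite /pc_head /pc_tail; have /andP[+ /eqP] := pcompP a.
case: (pc_parts a) => //= b t _ <-.
by elim: t b => [|m t IH] b /=; rewrite ?addn0 // IH addnA.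
Qed.

Lemma gpr_ribbonP : [&& is_pcomp a, all is_comp [::]
  & sumn a + sumn (map sumn [::]) == n]%N.
Proof. by rewrite /= addn0; exact: pcompP. Qed.

(* The pseudo-ribbon alpha. *)
Definition gpr_ribbon : gpribbon n := GPRibbon gpr_ribbonP.

Lemma gpr_rowsP : let cs := [seq [:: m] | m <- pc_tail] in
  [&& is_pcomp [:: pc_head], all is_comp cs
    & sumn [:: pc_head] + sumn (map sumn cs) == n]%N.
Proof.
rewrite /pc_head /pc_tail; have /andP[+ /eqP e] := pcompP a.
move: e; case: (pc_parts a) => //= b t <- h.
rewrite addn0 -map_comp; apply/andP; split.
  by rewrite all_map; apply/allP => m /(allP h) hm; rewrite /= /is_comp /= andbT.
by apply/eqP; congr (_ + sumn _)%N; rewrite -[RHS]map_id; apply: eq_map => m /=;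
  rewrite addn0.
Qed.

(* The generalized pseudo-ribbon alpha_1 (+) ... (+) alpha_l. *)
Definition gpr_rows : gpribbon n := GPRibbon gpr_rowsP.

End PseudoCompositions.

Section Modules.
Variables (F : fieldType) (n : nat) (a : pscomp n).

Definition PB_comp : lmodType (HeckeB F n) := PB F (gpr_ribbon a).

Definition MB : lmodType (HeckeB F n) := PB F (gpr_rows a).

(* H^B_alpha(0), as the subalgebra of H^B_n(0). *)
Definition parabolic : algType F :=
  gensub (fun x : HeckeB F n =>
    exists2 i : 'I_n, val i \notin descset a & x = pi_B F i).

Definition parabolic_incl : {rmorphism parabolic -> HeckeB F n} :=
  @gensub_incl F (HeckeB F n) _.

(* P^B_(alpha_1) (x) P_(alpha_2) (x) ... (x) P_(alpha_l), extended to H^B_n(0) by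
   letting pi_i act by 0 for i in D(alpha); only its restriction [tensor_comp] to
   H^B_alpha(0) matters. *)
Definition outer_full : lmodType (HeckeB F n) :=
  ecast k (lmodType (HeckeB F k)) (pcomp_sum a)
    (outer_prod (PB F (gpr_ribbon (pcomp1 (pc_head a)))) (pc_tail a)).

Definition tensor_comp : lmodType parabolic :=
  restricted parabolic_incl outer_full.

Definition ind_comp : lmodType (HeckeB F n) :=
  induced parabolic_incl tensor_comp.

End Modules.

(* Main.v *)
(* Write J(b) for the set of s_k with k not in D(b). A tableau of shape
   alpha_1 (+) ... (+) alpha_l is a signed permutation whose right descents lie in
   D(alpha), and a tableau of pseudo-ribbon shape beta is one whose set of right
   descents is exactly D(beta); in both cases i is a descent of the tableau iff
   it is a left descent of the permutation.

   For the sum of the P^B_beta, send a tableau w of shape beta to the sum of all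
   tableaux x of M^B_alpha in the coset w W_J(beta). This is a module map because,
   when s_i w stays outside that coset, s_i moves the whole coset to that of s_i w
   in the same direction, while otherwise it permutes the coset and both sides
   vanish. It is unitriangular, hence bijective, since w is the largest element of
   its coset for the lexicographic order read from the right.

   For the induced module, the inner tensor product is a line F v0 fixed by the pi_i
   with i not in D(alpha), so w |-> pibar_w (x) v0 is a map from M^B_alpha, where
   pibar_w is well defined by Matsumoto's argument; it respects the relation
   pibar_i w = 0 because then s_i w = w s_k with s_k in J(alpha), whence
   pibar_i pibar_w = pibar_w pibar_k. Its inverse is a (x) v0 |-> a . id. *)

From HB Require Import structures.
Require Import Defs.
From mathcomp Require Import all_boot all_order all_algebra.
From mathcomp Require Import perm boolp finmap monalg zify.

Set Implicit Arguments.
Unset Strict Implicit.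
Unset Printing Implicit Defensive.

Import Order.TTheory GRing.Theory Num.Theory.
Local Open Scope ring_scope.

(** * Signed permutations as odd bijections of the integers *)

Definition oddext (f : nat -> int) (z : int) : int :=
  match z with Posz k => f k | Negz k => - f k.+1 end.

Lemma oddextN f z : f 0%N = 0 -> oddext f (- z) = - oddext f z.
Proof.
move=> f0; case: z => [[|k]|k]; first by rewrite oppr0 /= f0 oppr0.
  by rewrite -NegzE.
by rewrite NegzE opprK /= opprK.
Qed.

(* The generator s_i, extended to all integers. *)
Definition sig (i : nat) (v : int) : int :=
  if i == 0%N then if `|v|%N == 1%N then - v else v
  else if v == i%:Z then i.+1%:Z else if v == i.+1%:Z then i%:Z
  else if v == - i%:Z then - i.+1%:Z else if v == - i.+1%:Z then - i%:Z else v.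

(** The graph of [sig i] as a disjunction of linear conditions, which [lia] can use directly. *)
Lemma sigP i v :
  i = 0%N /\ `|v|%N = 1%N /\ sig i v = - v \/
  i = 0%N /\ `|v|%N <> 1%N /\ sig i v = v \/
  (0 < i)%N /\ v = i /\ sig i v = i.+1 \/
  (0 < i)%N /\ v = i.+1 /\ sig i v = i \/
  (0 < i)%N /\ v = - i%:Z /\ sig i v = - i.+1%:Z \/
  (0 < i)%N /\ v = - i.+1%:Z /\ sig i v = - i%:Z \/
  (0 < i)%N /\ `|v|%N <> i /\ `|v|%N <> i.+1 /\ sig i v = v.
Proof.
rewrite /sig; case: eqP => i0; first by case: eqP; lia.
case: eqP => [->|n1]; first by lia.
case: eqP => [->|n2]; first by lia.
case: eqP => [->|n3]; first by lia.
case: eqP => [->|n4]; first by lia.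
by lia.
Qed.

Lemma sigN i v : sig i (- v) = - sig i v.
Proof. have := sigP i v; have := sigP i (- v); lia. Qed.

Lemma sigK i : involutive (sig i).
Proof. by move=> v; have := sigP i v; have := sigP i (sig i v); lia. Qed.

(** For [i > 0] only exchanged neighbours change order; for [i = 0] the three exclusions are the
    pairs within -1, 0, 1. *)
Lemma sig_lt (i : nat) (u v : int) : u < v -> ~ (u = i /\ v = i.+1) ->
  ~ (u = - i.+1%:Z /\ v = - i%:Z) -> ~ (u = -1 /\ v = 1) -> sig i u < sig i v.
Proof. have := sigP i u; have := sigP i v; lia. Qed.

Section SignedPermutation.
Variable n : nat.
Implicit Types (w : filling n) (i j : 'I_n).

(* The permutation w and its inverse, extended by the identity outside -n, ..., n
   so that no range conditions are needed. *)
Definition ev w : int -> int := oddext (fun k =>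
  if k is k'.+1 then if insub k' is Some j then lval (w j) else k%:Z else 0).

Definition pv w : int -> int := oddext (fun k =>
  if k is k'.+1 then if insub k' is Some a then lpos a w else k%:Z else 0).

Arguments ev : simpl never.
Arguments pv : simpl never.

Lemma evN w z : ev w (- z) = - ev w z. Proof. exact: oddextN. Qed.
Lemma pvN w z : pv w (- z) = - pv w z. Proof. exact: oddextN. Qed.
Lemma ev0 w : ev w 0 = 0. Proof. by []. Qed.
Lemma pv0 w : pv w 0 = 0. Proof. by []. Qed.

Lemma ev_ord w j : ev w j.+1 = lval (w j).
Proof. by rewrite /ev /= insubT //= => h; congr (lval (w _)); exact: val_inj. Qed.

Lemma pv_ord w (a : 'I_n) : pv w a.+1 = lpos a w.
Proof. by rewrite /pv /= insubT //= => h; congr (lpos _ w); exact: val_inj. Qed.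

Lemma ev_out w (k : nat) : (n < k)%N -> ev w k = k.
Proof. by case: k => //= k h; rewrite /ev /= insubF //; lia. Qed.

Lemma pv_out w (k : nat) : (n < k)%N -> pv w k = k.
Proof. by case: k => //= k h; rewrite /pv /= insubF //; lia. Qed.

(** Case principle for odd maps: oddness disposes of the negative integers, and beyond [n] both
    [ev w] and [pv w] are the identity. *)
Lemma int_cases (P : int -> Prop) : (forall z, P z -> P (- z)) -> P 0 ->
  (forall j, P j.+1) -> (forall k : nat, (n < k)%N -> P k) -> forall z, P z.
Proof.
move=> PN P0 Pj Pk.
have Pn (k : nat) : P k.
  case: k => // k; case: (ltnP k n) => h; last by apply: Pk; lia.
  exact: (Pj (Ordinal h)).
by case=> k //; rewrite NegzE; apply: PN.
Qed.

Lemma evK w : signed_perm w -> cancel (ev w) (pv w).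
Proof.
move=> sp; elim/int_cases => [z e||j|k h]; rewrite ?ev0 ?pv0 //.
- by rewrite evN pvN e.
- rewrite ev_ord /lval; have := lposE j sp.
  by case: (w j).1 => e; rewrite ?pvN pv_ord e ?opprK.
- by rewrite ev_out ?pv_out.
Qed.

Lemma pvK w : signed_perm w -> cancel (pv w) (ev w).
Proof.
move=> sp; elim/int_cases => [z e||a|k h]; rewrite ?ev0 ?pv0 //.
- by rewrite pvN evN e.
- have [k <-] := signed_perm_surj a sp; rewrite pv_ord lposE //.
  by case e: (w k).1; rewrite ?evN ev_ord /lval e ?opprK.
- by rewrite pv_out ?ev_out.
Qed.

Lemma ev_inj w w' : ev w =1 ev w' -> w = w'.
Proof.
move=> e; apply/ffunP => j; have := e j.+1; rewrite !ev_ord /lval.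
case: (w j) (w' j) => [b a] [b' a'] /= h; congr pair; last apply: val_inj;
  by move: h; case: b; case: b' => /=; lia.
Qed.

Lemma pv_inj w w' : signed_perm w -> signed_perm w' -> pv w =1 pv w' -> w = w'.
Proof.
move=> sp sp' e; apply: ev_inj => z.
by rewrite -[RHS](pvK sp) e evK.
Qed.

Lemma ev_bound w (k : nat) : (k <= n)%N -> - n%:Z <= ev w k <= n.
Proof.
case: k => [|k] h; first by rewrite ev0; lia.
rewrite (ev_ord w (Ordinal h)) /lval; have := ltn_ord (w (Ordinal h)).2.
by case: ifP; lia.
Qed.

(** Since [pv w 0 = 0], the sign condition for [s_0] and the order condition for the other
    generators become one inequality for the inverse of [w]. *)
Lemma wdes_pv i w : wdes i w = (pv w i.+1 < pv w i).
Proof.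
rewrite /wdes pv_ord; case: eqP => [->|/eqP i0]; first by rewrite pv0.
by rewrite -(pv_ord w (pred_ord i)) pred_ord_val.
Qed.

Lemma ev_sfill i w z : ev (sfill i w) z = sig i (ev w z).
Proof.
have s0 : sig i 0 = 0 by have := sigP i 0; lia.
elim/int_cases: z => [z e||j|k h]; rewrite ?ev0 //.
- by rewrite !evN e sigN.
- rewrite !ev_ord ffunE; have := sigP i (lval (w j)).
  case: (eqVneq (i : nat) 0%N) => i0; last rewrite lval_sletter //;
    rewrite ?lval_sletter0 //; move: i0; rewrite /lval;
    by case: (w j).1 => /=; do 3?case: ifP => /=; lia.
- rewrite !ev_out //; have := sigP i k; have := ltn_ord i; lia.
Qed.

Lemma pv_sfill i w v : signed_perm w -> pv (sfill i w) v = pv w (sig i v).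
Proof.
move=> sp; have sp' := signed_perm_sfill i sp.
by apply: (can_inj (evK sp')); rewrite pvK // ev_sfill pvK // sigK.
Qed.

Lemma sfillK i w : sfill i (sfill i w) = w.
Proof. by apply: ev_inj => z; rewrite !ev_sfill sigK. Qed.

Lemma wdes_sfill i w : signed_perm w -> wdes i (sfill i w) = ~~ wdes i w.
Proof.
move=> sp; rewrite !wdes_pv !pv_sfill //.
have s1 : sig i i.+1 = if i == 0%N :> nat then -1 else i%:Z.
  by have := sigP i i.+1; case: eqP => ?; lia.
have s2 : sig i i = if i == 0%N :> nat then 0 else i.+1%:Z.
  by have := sigP i i; case: eqP => ?; lia.
rewrite s1 s2; case: eqP => i0.
  rewrite -[-1]/(- 1%N%:Z) pvN i0 pv0.
  by have := (can_inj (pvK sp)) 1%N%:Z 0; rewrite pv0; lia.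
by have := (can_inj (pvK sp)) i.+1 i; lia.
Qed.

Definition idfill : filling n := [ffun k => (false, k)].

Lemma signed_perm_id : signed_perm idfill.
Proof. by apply/injectiveP => k l; rewrite !ffunE. Qed.

Lemma ev_id z : ev idfill z = z.
Proof.
elim/int_cases: z => [z e||j|k h]; rewrite ?ev0 //; first by rewrite evN e.
  by rewrite ev_ord ffunE.
exact: ev_out.
Qed.

Lemma pv_id z : pv idfill z = z.
Proof. by rewrite -[in LHS](ev_id z) (evK signed_perm_id). Qed.

(** Without left descents the inverse of [w] is strictly increasing on the naturals. Starting from 0
    this bounds it below by the identity; counting back from a fixed point beyond [n] bounds it
    above. *)
Lemma wdes_none w : signed_perm w -> (forall i, ~~ wdes i w) -> w = idfill.
Proof.
move=> sp h; apply: pv_inj => // [|z]; first exact: signed_perm_id.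
have st (k : nat) : pv w k < pv w k.+1.
  case: (ltnP k n) => kn.
    have := h (Ordinal kn); rewrite wdes_pv /= -leNgt.
    by have := (can_inj (pvK sp)) k k.+1; lia.
  (* A value above [m] would lie beyond [n], hence be fixed, against injectivity. *)
  have kk (m : nat) : (n <= m)%N -> ~ (m%:Z < pv w m).
    move=> nm; case e: (pv w m) => [l|] // lm.
    by have : pv w l = pv w m; [rewrite pv_out ?e|move/(can_inj (pvK sp))]; lia.
  have := kk k kn; have := can_inj (pvK sp) (x1 := k) (x2 := k.+1).
  by rewrite (pv_out w (k := k.+1)) //; lia.
have lb (k : nat) : (k%:Z <= pv w k).
  by elim: k => [|k IH]; [rewrite pv0|have := st k; lia].
rewrite pv_id; case: z => k; last rewrite NegzE pvN; last congr (- _).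
  have ub (m : nat) : pv w k + m%:Z <= pv w (k + m)%N.
    elim: m => [|m IH]; first by rewrite addn0; lia.
    by have := st (k + m)%N; rewrite addnS; lia.
  (* The step [n.+1] makes [k + n.+1] exceed [n] even for [k = 0]. *)
  by have := lb k; have := ub n.+1; rewrite (@pv_out w (k + n.+1)); lia.
have ub (m : nat) : pv w k.+1 + m%:Z <= pv w (k.+1 + m)%N.
  elim: m => [|m IH]; first by rewrite addn0; lia.
  by have := st (k.+1 + m)%N; rewrite addnS; lia.
by have := lb k.+1; have := ub n; rewrite (@pv_out w (k.+1 + n)); lia.
Qed.

End SignedPermutation.

(** * Standardness in terms of descents *)

(* The signed index of the block containing z when -n, ..., n is cut after each
   d and before each -d, for d in D. *)
Definition blk (D : seq nat) : int -> int :=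
  oddext (fun k => (count (fun d => d < k)%N D)%:Z).

Arguments blk : simpl never.

Lemma blk_nat D (k : nat) : blk D k = count (fun d => d < k)%N D. Proof. by []. Qed.

Lemma blkN D z : blk D (- z) = - blk D z.
Proof. by apply: oddextN; rewrite count_pred0. Qed.

Lemma blk0 D : blk D 0 = 0. Proof. by rewrite blk_nat count_pred0. Qed.

Lemma blkS D (k : nat) : blk D k.+1 = blk D k + (count_mem k D)%:Z.
Proof.
rewrite !blk_nat -PoszD; congr Posz; elim: D => //= d D ->.
by rewrite addnACA ltnS leq_eqVlt; case: ltngtP.
Qed.

Lemma blk_ltS D (k : nat) : (blk D k < blk D k.+1) = (k \in D).
Proof. by rewrite blkS -has_pred1 has_count ltrDl. Qed.

Lemma blk_le1 D z : blk D z <= blk D (z + 1).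
Proof.
case: z => k; first by rewrite -PoszD addn1 blkS; lia.
rewrite NegzE (_ : _ + 1 = - k%:Z); last by lia.
by rewrite !blkN blkS; lia.
Qed.

Lemma int_up_ind (P : int -> int -> Prop) :
  (forall a, P a (a + 1)) -> (forall a b c, P a b -> P b c -> P a c) ->
  forall a b : int, a < b -> P a b.
Proof.
move=> P1 Pt a b ab; have [k ->] : exists k : nat, b = a + k.+1%:Z.
  by exists (absz (b - a - 1)%R); lia.
elim: k {ab} => [|k IH]; first exact: P1.
by rewrite -addn1 PoszD addrA; apply: Pt IH (P1 _).
Qed.

Lemma blk_le D (a b : int) : a <= b -> blk D a <= blk D b.
Proof.
rewrite le_eqVlt => /orP[/eqP -> //|]; elim/int_up_ind: a b / => [a|a b c].
  exact: blk_le1.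
exact: le_trans.
Qed.

Section Ascents.
Variables (n : nat) (D : seq nat) (w : filling n).

(** [asc] says that the right descents of [w] lie in [D], [dsc] that all elements of [D] are right
    descents. Since [ev w 0 = 0], the index 0 tests the sign of the first letter. *)
Definition asc : Prop := forall k : nat, k \notin D -> ev w k < ev w k.+1.
Definition dsc : Prop := forall k : nat, k \in D -> ev w k.+1 < ev w k.

(** Ascents chain along a block. The induction carries the weak monotonicity of [blk] along, so that
    equal blocks at the ends force the same block at every intermediate point; negative steps follow
    by oddness. *)
Lemma asc_blk (a b : int) : asc -> a < b -> blk D a = blk D b ->
  ev w a < ev w b.
Proof.
move=> hw ab; suff: blk D a <= blk D b /\ (blk D a = blk D b -> ev w a < ev w b).
  by case.
elim/int_up_ind: a b / ab => [a|a b c [ab1 ab2] [bc1 bc2]]; last first.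
  by split=> [|e]; [lia|apply: (lt_trans (y := ev w b)); [apply: ab2|apply: bc2]; lia].
split; first exact: blk_le1.
have st (k : nat) : blk D k = blk D k.+1 -> ev w k < ev w k.+1.
  by move=> e; apply: hw; rewrite -blk_ltS e ltxx.
case: a => k; first by rewrite -PoszD addn1; exact: st.
rewrite NegzE (_ : _ + 1 = - k%:Z); last by lia.
by rewrite !blkN !evN => /oppr_inj e; rewrite ltrN2; apply: st.
Qed.

End Ascents.

(** * Descent sets and coordinates of boxes *)

Lemma descset_cons a b t :
  descset (a :: b :: t) = a :: map (addn a) (descset (b :: t)).
Proof.
rewrite /descset /= addn0; congr cons.
by rewrite -map_comp (iotaDl 1 1) -map_comp; apply: eq_map.
Qed.

Arguments descset : simpl never.

Lemma descset_add k a t : descset (k + a :: t)%N = map (addn k) (descset (a :: t)).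
Proof.
case: t => [//|b t]; rewrite !descset_cons /= -map_comp; congr cons.
by apply: eq_map => d /=; rewrite addnA.
Qed.

Lemma descset_succ a t : descset (a.+1 :: t) = map succn (descset (a :: t)).
Proof. exact: (descset_add 1). Qed.

Lemma descset_ge a t d : d \in descset (a :: t) -> (a <= d)%N.
Proof.
case: t => // b t; rewrite descset_cons inE => /orP[/eqP -> //|/mapP[d' _ ->]].
exact: leq_addr.
Qed.

Lemma descset_sorted s : is_pcomp s -> sorted ltn (descset s).
Proof.
case: s => // a t; elim: t a => // b t IH a; rewrite descset_cons => /andP[b0 ht].
rewrite /= path_min_sorted.
  rewrite sorted_map; apply: sub_sorted (IH b ht) => x y /=.
  by rewrite /relpre /=; lia.
by apply/allP => _ /mapP[d /descset_ge h ->] /=; lia.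
Qed.

Lemma descset_lt s d : is_pcomp s -> d \in descset s -> (d < sumn s)%N.
Proof.
case: s => // a t; elim: t a d => // b t IH a d /= /andP[b0 ht].
rewrite descset_cons inE => /orP[/eqP -> |/mapP[d' /IH h ->]]; first by lia.
by have := h ht => /=; lia.
Qed.

(* Rows of lengths s from the bottom up, each starting in the column of the last
   box of the previous row (e = 1) or in the next column (e = 0). *)
Fixpoint step_boxes (e r c : nat) (s : seq nat) : seq (nat * nat) :=
  if s is m :: s' then
    [seq (r, c + j)%N | j <- iota 0 m] ++ step_boxes e r.+1 (c + (m - e)) s'
  else [::].

Lemma ribbon_step r c s : ribbon_boxes r c s = step_boxes 1 r c s.
Proof. by elim: s r c => //= m s IH r c; rewrite IH subn1. Qed.

(** Every new row, begun at a partial sum of [s], leaves the column [e] further behind the reading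
    index. The column is given additively to avoid truncated subtraction. *)
Lemma nth_step e r c s k : (e <= 1)%N -> all (leq 1) s -> (k < sumn s)%N ->
  let q := count (fun d => d <= k)%N (descset s) in
  let b := nth (0, 0)%N (step_boxes e r c s) k in
  b.1 = (r + q)%N /\ (b.2 + e * q = c + k)%N.
Proof.
move=> e1; elim: s r c k => //= m s IH r c k /andP[m0 hs] hk.
rewrite nth_cat size_map size_iota; case: ltnP => km.
  rewrite (nth_map 0%N) ?size_iota // nth_iota //=.
  rewrite (_ : count _ _ = 0%N) ?muln0 ?addn0 //.
  apply/eqP; rewrite -leqn0 leqNgt -has_count; apply/hasPn => d /descset_ge.
  by lia.
case: s hs IH hk => [|b t] hs IH hk; first by move: hk => /=; lia.
have [|-> e2] := IH r.+1 (c + (m - e))%N (k - m)%N hs; first by lia.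
rewrite descset_cons [count _ (_ :: _)]/= km.
have -> : count (fun d => d <= k)%N (map (addn m) (descset (b :: t)))
    = count (fun d => d <= k - m)%N (descset (b :: t)).
  by rewrite count_map; apply: eq_count => d /=; lia.
by rewrite add1n mulnS; split; [rewrite addnS addSn|lia].
Qed.

Lemma add_rows acc t : (0 < size acc)%N -> all (leq 1) t ->
  let b := last (0, 0)%N acc in
  add_ribbons acc [seq [:: m] | m <- t] = acc ++ step_boxes 0 b.1.+1 b.2.+1 t.
Proof.
elim: t acc => [|m t IH] acc a0 /=; first by rewrite cats0.
case: m => // m ht; rewrite IH ?size_cat //; last by rewrite ltn_addr.
rewrite cats0 last_cat last_row addn0 -catA.
by rewrite subn0 addnS.
Qed.

(** The 0-box lengthens the first row by one; for [h = 0] it is a row by itself, below the first box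
    of the next row. Pseudo-ribbons thus become ordinary ribbons. *)
Lemma pribbon_step h t : pribbon_boxes (h :: t) = step_boxes 1 0 0 (h.+1 :: t).
Proof.
rewrite -ribbon_step /pribbon_boxes; case: h => [//|h].
rewrite [RHS]/= addn0; congr (_ :: _ :: _ ++ _).
by rewrite -[in RHS](addn1 1) (iotaDl 1 1) -map_comp.
Qed.

Section Shapes.
Variables (n : nat) (a : pscomp n).

Let D := descset a.
Let s := (pc_head a).+1 :: pc_tail a.

Lemma pscomp_cons : a = pc_head a :: pc_tail a :> seq nat.
Proof. by have /andP[+ _] := pcompP a; rewrite /pc_head /pc_tail; case: (pc_parts a). Qed.

Lemma pc_tail_pos : all (leq 1) (pc_tail a).
Proof. by have /andP[+ _] := pcompP a; rewrite pscomp_cons. Qed.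

Lemma pc_sum : (pc_head a + sumn (pc_tail a))%N = n.
Proof. by have /andP[_ /eqP] := pcompP a; rewrite {1}pscomp_cons. Qed.

Lemma boxes_rows : boxes (gpr_rows a) = step_boxes 0 0 0 s.
Proof.
rewrite /boxes [gp_first _]/= pribbon_step [gp_rest _]/=.
rewrite [step_boxes 1 _ _ _]/= cats0 -[_ :: _]/[seq (0, 0 + j)%N | j <- iota 0 (pc_head a).+1].
by rewrite add_rows ?pc_tail_pos // last_row.
Qed.

Lemma boxes_ribbon : boxes (gpr_ribbon a) = step_boxes 1 0 0 s.
Proof. by rewrite /boxes [LHS]/= -/(pribbon_boxes a) {1}pscomp_cons pribbon_step. Qed.

Lemma count_descset k : count (fun d => d <= k)%N (descset s)
  = count (fun d => d < k)%N D.
Proof. by rewrite /s descset_succ count_map -pscomp_cons. Qed.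

Lemma descset_uniq : uniq D.
Proof.
have /andP[h _] := pcompP a.
exact: sorted_uniq ltn_trans ltnn _ (descset_sorted h).
Qed.

Lemma descset_ltn d : d \in D -> (d < n)%N.
Proof. by have /andP[h /eqP <-] := pcompP a; exact: descset_lt. Qed.

Lemma rows_box k : (k <= n)%N ->
  (row_ (gpr_rows a) k : int) = blk D k /\ col_ (gpr_rows a) k = k.
Proof.
move=> kn; rewrite /row_ /col_ boxes_rows.
have [||-> +] := @nth_step 0 0 0 s k isT; rewrite /s /= ?pc_tail_pos ?addSn ?pc_sum //.
by rewrite mul0n addn0 -/s count_descset.
Qed.

Lemma ribbon_box k : (k <= n)%N ->
  (row_ (gpr_ribbon a) k : int) = blk D k /\ (col_ (gpr_ribbon a) k : int) = k%:Z - blk D k.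
Proof.
move=> kn; rewrite /row_ /col_ boxes_ribbon.
have [||-> +] := @nth_step 1 0 0 s k isT; rewrite /s /= ?pc_tail_pos ?addSn ?pc_sum //.
by rewrite mul1n -/s count_descset blk_nat; lia.
Qed.

End Shapes.

Section Standardness.
Variables (n : nat) (a : pscomp n).
Implicit Types w : filling n.

Let D := descset a.

Lemma entry_ev w (k : 'I_n.+1) : entry w k = ev w k.
Proof.
by rewrite /entry; case: unliftP => [j ->|->] //; rewrite -ev_ord.
Qed.

Lemma asc_ord w : (forall k : 'I_n, val k \notin D -> ev w k < ev w k.+1) ->
  asc D w.
Proof.
move=> h k kD; case: (ltnP k n) => kn; first exact: (h (Ordinal kn)).
rewrite (@ev_out _ w k.+1) //; move: kn; rewrite leq_eqVlt => /orP[/eqP <-|kn].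
  by have := ev_bound w (leqnn n); lia.
by rewrite ev_out //; lia.
Qed.

Lemma rows_asc (g : gpribbon n) w :
  (forall k, (k <= n)%N -> (row_ g k : int) = blk D k) ->
  (forall k, k \notin D -> (k < n)%N -> col_ g k < col_ g k.+1)%N ->
  reflect (asc D w) (rows_incr g w).
Proof.
move=> hr hc; apply: (iffP forallP) => [h|h j].
  apply: asc_ord => k kD; have := forallP (h (widen_ord (leqnSn n) k)) (lift ord0 k).
  rewrite !entry_ev /= => /implyP; apply; rewrite hc // andbT -eqz_nat !hr ?blkS;
    rewrite ?(ltnW (ltn_ord k)) //.
  by rewrite (count_memPn kD) addr0.
apply/forallP => k; apply/implyP => /andP[/eqP e jk]; rewrite !entry_ev.
have jk' := row_ltn e jk; apply: asc_blk h _ _; first by rewrite ltz_nat.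
by rewrite -!hr ?e // -ltnS.
Qed.

(** All boxes of this shape lie in distinct columns, so only the row condition has content, and the
    rows are the blocks cut by [D]. *)
Lemma standard_rows w :
  reflect (signed_perm w /\ asc D w) (standard (gpr_rows a) w).
Proof.
have hr (k : nat) (kn : (k <= n)%N) := rows_box a kn.
have rP := @rows_asc (gpr_rows a) w (fun k kn => (hr k kn).1).
apply: (iffP and3P) => [[sp /rP h _]|[sp h]].
  by split=> //; apply: h => k kD kn; rewrite !(hr _ _).2 //; lia.
split=> //; first by apply/rP => // k kD kn; rewrite !(hr _ _).2 //; lia.
apply/forallP => j; apply/forallP => k; apply/implyP.
rewrite (hr j (ltn_ord j)).2 (hr k (ltn_ord k)).2 => /andP[/eqP/val_inj ->].
by rewrite ltnn.
Qed.

(** As [blk] grows by at most one per step, the equality forces every index from [j] to [k - 1] into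
    [D], and the descents there chain. *)
Lemma dsc_blk_le w (j k : nat) : dsc D w -> (j < k)%N ->
  blk D k - blk D j = k%:Z - j%:Z -> ev w k < ev w j.
Proof.
move=> h; have step (m : nat) : blk D m.+1 <= blk D m + 1.
  by rewrite blkS (count_uniq_mem _ (descset_uniq a)); case: (_ \in _); lia.
have le (m : nat) : (j <= m)%N -> blk D m - blk D j <= m%:Z - j%:Z.
  elim: m => [|m IH]; first by rewrite leqn0 => /eqP ->; lia.
  rewrite leq_eqVlt => /orP[/eqP ->|]; first by lia.
  by rewrite ltnS => /IH; have := step m; lia.
elim: k => // k IH; rewrite ltnS => jk e.
have lt : blk D k < blk D k.+1 by have := le k jk; lia.
have := h k; rewrite -blk_ltS => /(_ lt) hk.
move: jk; rewrite leq_eqVlt => /orP[/eqP -> //|jk].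
by apply: lt_trans hk (IH jk _); have := step k; have := le k (ltnW jk); lia.
Qed.

(** The column index is [k - blk D k], so two boxes share a column when every step between them is a
    cut; the column condition is therefore [dsc]. *)
Lemma standard_ribbon w :
  reflect [/\ signed_perm w, asc D w & dsc D w] (standard (gpr_ribbon a) w).
Proof.
have hr (k : nat) (kn : (k <= n)%N) := ribbon_box a kn.
have rP : reflect (asc D w) (rows_incr (gpr_ribbon a) w).
  apply: rows_asc => k; first by case/hr.
  move=> kD kn; rewrite -ltz_nat !(hr _ _).2 ?blkS ?(count_memPn kD); lia.
apply: (iffP and3P) => -[sp /rP h hd]; split=> //.
  move=> k kD; have kn := descset_ltn kD.
  have := forallP (forallP hd (widen_ord (leqnSn n) (Ordinal kn))) (lift ord0 (Ordinal kn)).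
  rewrite !entry_ev /= => /implyP; apply; rewrite -eqz_nat -ltz_nat.
  have c1 : count_mem k D = 1%N by rewrite count_uniq_mem ?kD ?descset_uniq.
  rewrite (hr _ (ltnW kn)).2 (hr _ kn).2 (hr _ (ltnW kn)).1 (hr _ kn).1.
  by rewrite blkS c1; lia.
apply/forallP => j; apply/forallP => k; apply/implyP => /andP[/eqP e jk].
rewrite !entry_ev; apply: dsc_blk_le => //; first exact: col_ltn e jk.
have [[_ cj] [_ ck]] := (hr j (ltn_ord j), hr k (ltn_ord k)).
by move: (congr1 Posz e); rewrite cj ck -/D; lia.
Qed.

End Standardness.

(** Both lists are sorted, so they agree as lists; they determine all parts but the last, which the
    common size determines. *)
Lemma descset_inj n (a b : pscomp n) : descset a =i descset b -> a = b.
Proof.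
move=> e; have {e} : descset a = descset b.
  have [/andP[ha _] /andP[hb _]] := (pcompP a, pcompP b).
  exact: (irr_sorted_eq ltn_trans ltnn (descset_sorted ha) (descset_sorted hb)).
have es : (pc_head a + sumn (pc_tail a) = pc_head b + sumn (pc_tail b))%N.
  by rewrite !pc_sum.
move=> ed; apply: val_inj => /=; move: es ed.
rewrite (pscomp_cons a) (pscomp_cons b).
elim: (pc_tail a) (pc_head a) (pc_tail b) (pc_head b) => [|x s IH] h [|y t] k.
- by rewrite /= !addn0 => ->.
- by rewrite descset_cons.
- by rewrite descset_cons.
rewrite !descset_cons /= => /= e [ehk]; rewrite ehk in e *.
by move/(inj_map (@addnI k)) => /(IH x) -> //=; lia.
Qed.

(** Induction on [n] with the predicate shifted by one: the first part grows by one and, when 0 is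
    to be a cut, a zero part is put in front. *)
Lemma descset_surj n (P : pred nat) :
  exists b : pscomp n, forall k, (k \in descset b) = (k < n)%N && P k.
Proof.
suff [s [hs es ds]] : exists s, [/\ is_pcomp s, sumn s = n
    & forall k, (k \in descset s) = (k < n)%N && P k].
  have h : is_pcomp s && (sumn s == n) by rewrite hs es eqxx.
  by exists (PComp h).
elim: n P => [|n IH] P; first by exists [:: 0%N]; split=> // k; rewrite andbC.
have [[|h t] [// hs es ds]] := IH (P \o succn).
case P0 : (P 0%N).
  exists (0%N :: h.+1 :: t); split=> // [|k]; first by move: es => /=; lia.
  rewrite descset_cons inE map_id_in; last by move=> ? _; rewrite add0n.
  rewrite descset_succ; case: k => [|k] /=; first by rewrite P0.
  by rewrite (mem_map succn_inj) ds.
exists (h.+1 :: t); split=> // [|k]; first by move: es => /=; lia.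
rewrite descset_succ; case: k => [|k] /=; last by rewrite (mem_map succn_inj) ds.
by rewrite P0; apply/mapP => -[].
Qed.

(** * Cosets of parabolic subgroups *)

Section Cosets.
Variables (n : nat) (D : seq nat).
Implicit Types (w x : filling n) (i : 'I_n).

(* x lies in w W_J, where W_J is the parabolic subgroup generated by the s_k
   with k not in D. *)
Definition same_coset x w : bool :=
  [forall j : 'I_n, blk D (pv x j.+1) == blk D (pv w j.+1)].

Lemma same_cosetP x w :
  reflect (forall v, blk D (pv x v) = blk D (pv w v)) (same_coset x w).
Proof.
apply: (iffP forallP) => [h|h j]; last by rewrite h.
elim/(@int_cases n) => [z e||j|k kn]; rewrite ?pv0 //.
- by rewrite !pvN !blkN e.
- exact/eqP/h.
- by rewrite !pv_out.
Qed.

Lemma same_coset_refl x : same_coset x x.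
Proof. by apply/same_cosetP. Qed.

Lemma same_coset_sfill i x w : signed_perm x -> signed_perm w ->
  same_coset x w -> same_coset (sfill i x) (sfill i w).
Proof.
by move=> sx sw /same_cosetP h; apply/same_cosetP => v; rewrite !pv_sfill.
Qed.

(* Equivalently, s_i w lies in w W_J. *)
Definition tied i w : bool := blk D (pv w i) == blk D (pv w i.+1).

Lemma tied_coset i x w : same_coset x w -> tied i x = tied i w.
Proof. by move=> /same_cosetP h; rewrite /tied !h. Qed.

(** A tied [s_i] exchanges values whose positions share a block (for [i = 0], the block of 0), so
    [x] moves within its coset. *)
Lemma same_coset_tied i x w : signed_perm x -> tied i x ->
  same_coset (sfill i x) w = same_coset x w.
Proof.
move=> sx /eqP t; suff e v : blk D (pv (sfill i x) v) = blk D (pv x v).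
  by apply/idP/idP => /same_cosetP h; apply/same_cosetP => v; have := h v; rewrite e.
rewrite pv_sfill //.
case: (sigP i v) => [[i0 [v1 ->]]|[[_ [_ ->]]|[[_ [-> ->]]|[[_ [-> ->]]|[[_ [-> ->]]| ]]]]].
- move: t; rewrite i0 pv0 blk0 => t; have [->|->] : v = 1%N \/ v = - 1%N%:Z by lia.
    by rewrite pvN blkN -t oppr0.
  by rewrite opprK pvN blkN -t oppr0.
- by [].
- by rewrite t.
- by rewrite t.
- by rewrite !pvN !blkN t.
by case=> [[_ [-> ->]]|[_ [_ [_ ->]]]] //; rewrite !pvN !blkN t.
Qed.

(** When the positions of [i] and [i + 1] lie in different blocks, the blocks alone decide their
    order, and blocks are constant on the coset. *)
Lemma wdes_coset i x w : same_coset x w -> ~~ tied i w -> wdes i x = wdes i w.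
Proof.
move=> c nt; have nt' := nt; rewrite -(tied_coset i c) in nt'.
suff e y : ~~ tied i y -> wdes i y = (blk D (pv y i.+1) < blk D (pv y i)).
  by rewrite !e // !(same_cosetP _ _ c).
rewrite /tied wdes_pv => ne; apply/idP/idP => [/ltW/(blk_le D)|]; first by lia.
by apply: contraTT; rewrite -!leNgt; exact: blk_le.
Qed.

(** The first two alternatives are the pairs of [sig_lt] pulled back through [w]; excluding
    [z' = - z] rules out the pair -1, 1. *)
Lemma sfill_lt i w (z z' : int) : signed_perm w -> ev w z < ev w z' -> z' <> - z ->
  [\/ pv w i = z /\ pv w i.+1 = z', pv w i = - z' /\ pv w i.+1 = - z
    | ev (sfill i w) z < ev (sfill i w) z'].
Proof.
move=> sp lt ne; rewrite !ev_sfill.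
case: (eqVneq (ev w z) i) => [e1|n1]; case: (eqVneq (ev w z') i.+1) => [e2|n2];
  first by constructor 1; rewrite -e1 -e2 !evK.
all: case: (eqVneq (ev w z) (- i.+1%:Z)) => [e3|n3];
  case: (eqVneq (ev w z') (- i%:Z)) => [e4|n4];
  try by constructor 2; rewrite -(evK sp z) -(evK sp z') e3 e4 !pvN !opprK.
all: constructor 3; apply: sig_lt => //; try by lia.
all: case=> e5 e6; apply: ne; rewrite -(evK sp z) -(evK sp z') e5 e6.
all: by rewrite -[-1]/(- 1%N%:Z) pvN opprK.
Qed.

(** Within a block [w] increases, so [i] stands before [i + 1]. Were [s_i w] increasing on blocks
    too, [i] would be a descent of neither, against [wdes_sfill]. *)
Lemma asc_tied i w : signed_perm w -> asc D w -> tied i w ->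
  ~~ wdes i w /\ ~ asc D (sfill i w).
Proof.
have nd x : signed_perm x -> asc D x -> tied i x -> ~~ wdes i x.
  move=> sp h /eqP t; rewrite wdes_pv; apply/negP => lt.
  by have := asc_blk h lt (esym t); rewrite !pvK // ltz_nat; lia.
move=> sp h t; split; first exact: nd.
move=> h'; have sp' := signed_perm_sfill i sp.
have t' : tied i (sfill i w).
  have c : same_coset (sfill i w) w by rewrite same_coset_tied // same_coset_refl.
  by rewrite (tied_coset i c).
by have := nd _ sp' h' t'; rewrite wdes_sfill // negbK; apply/negP/nd.
Qed.

(** The fillings satisfying [asc D] are the minimal length coset representatives, which form a lower
    set of the left weak order. *)
Lemma asc_down i w : signed_perm w -> asc D w -> wdes i w -> asc D (sfill i w).
Proof.
move=> sp h; rewrite wdes_pv => d k kD.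
by case: (@sfill_lt i w k k.+1 sp (h k kD)) => //; lia.
Qed.

Lemma asc_up i w : signed_perm w -> asc D w -> ~~ tied i w ->
  asc D (sfill i w).
Proof.
move=> sp h nt k kD; have e : blk D k = blk D k.+1.
  by rewrite blkS (count_memPn kD) addr0.
case: (@sfill_lt i w k k.+1 sp (h k kD)) => //; first by lia.
  by case=> e1 e2; move: nt; rewrite /tied e1 e2 e eqxx.
by case=> e1 e2; move: nt; rewrite /tied e1 e2 !blkN e eqxx.
Qed.

Lemma dsc_up i w : signed_perm w -> dsc D w -> ~~ wdes i w -> dsc D (sfill i w).
Proof.
move=> sp h; rewrite wdes_pv => d k kD.
by case: (@sfill_lt i w k.+1 k sp (h k kD)) => //; lia.
Qed.

End Cosets.

(** * Lexicographic order read from the right *)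

Section ReverseLex.
Variable n : nat.
Implicit Types (w x y : filling n).

Definition ltf x w : bool := [exists j, (lval (x j) < lval (w j))
  && [forall k : 'I_n, (j < k)%N ==> (x k == w k)]].

Lemma ltf_irr x : ltf x x = false.
Proof. by apply/existsP => -[j]; rewrite ltxx. Qed.

Lemma ltf_trans : transitive ltf.
Proof.
move=> y x z /existsP[j /andP[lj /forallP hj]] /existsP[k /andP[lk /forallP hk]].
have ej (l : 'I_n) : (j < l)%N -> x l = y l by move=> h; apply/eqP/(implyP (hj l)).
have ek (l : 'I_n) : (k < l)%N -> y l = z l by move=> h; apply/eqP/(implyP (hk l)).
case: (ltngtP j k) => [jk|kj|/val_inj e].
- apply/existsP; exists k; rewrite ej // lk; apply/forallP => l; apply/implyP => kl.
  by rewrite ej ?ek // (ltn_trans jk).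
- apply/existsP; exists j; rewrite -ek // lj; apply/forallP => l; apply/implyP => kl.
  by rewrite ej ?ek // (ltn_trans kj).
apply/existsP; exists k; rewrite -e in ek lk *; rewrite (lt_trans lj lk) /=.
by apply/forallP => l; apply/implyP => kl; rewrite ej ?ek.
Qed.

Definition lexrank x : nat := #|[set y | ltf y x]|.

Lemma ltf_rank x w : ltf x w -> (lexrank x < lexrank w)%N.
Proof.
move=> xw; apply: proper_card; apply/properP; split.
  by apply/subsetP => y; rewrite !inE => /ltf_trans; apply.
by exists x; rewrite !inE ?ltf_irr.
Qed.

(** At the last position where [x] and [w] differ, let [v] be the letter of [x]. In [w] it sits in
    the same block but neither there nor further right, hence earlier, and [w] increases on the
    block. *)
Lemma coset_ltf D x w : signed_perm x -> signed_perm w -> asc D w ->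
  same_coset D x w -> x != w -> ltf x w.
Proof.
move=> sx sw h /same_cosetP c ne.
have [j0 nj0] : exists j : 'I_n, x j != w j.
  by apply/existsP; apply: contraR ne; rewrite negb_exists => /forallP e;
    apply/eqP/ffunP => j; apply/eqP; have := e j; rewrite negbK.
case: (@arg_maxnP _ j0 (fun j => x j != w j) (fun j => j : nat) nj0) => j nj max.
have up (k : 'I_n) : (j < k)%N -> x k = w k.
  by move=> jk; apply/eqP; apply: contraLR jk => /max; rewrite -leqNgt.
apply/existsP; exists j; apply/andP; split; last first.
  by apply/forallP => k; apply/implyP => /up ->.
rewrite -!ev_ord; set v := ev x j.+1.
have e1 : pv x v = j.+1 by rewrite /v evK.
have e2 : ev w (pv w v) = v by rewrite pvK.
have be := c v; rewrite e1 in be.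
case: (ltgtP (pv w v) j.+1) => [lt|gt|e].
- by rewrite -e2; apply: asc_blk h lt _; rewrite be.
- have : ev x (pv w v) = ev w (pv w v); last first.
    rewrite e2 => /(congr1 (pv x)); rewrite evK // e1 => e.
    by rewrite e ltxx in gt.
  case: (pv w v) gt => [[|k]|k] // gt.
  case: (ltnP k n) => kn; last by rewrite !ev_out.
  by rewrite -[k]/(val (Ordinal kn)) !ev_ord up //; move: gt; rewrite ltz_nat ltnS.
exfalso; move: nj; apply/negP; rewrite negbK; apply/eqP.
have : lval (x j) = lval (w j) by rewrite -!ev_ord -/v -e e2.
rewrite /lval; case: (x j) (w j) => [s p] [s' p'] /= ep.
by congr pair; last apply: val_inj; move: ep; case: s; case: s' => /=; lia.
Qed.

End ReverseLex.

(** * Modules over the 0-Hecke algebra *)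

Section HeckeModules.
Variables (F : fieldType) (I : choiceType) (cox : I -> I -> nat).
Local Notation H := (hecke F cox).

Lemma hecke_ind (P : H -> Prop) :
  (forall (c : F) x y, P x -> P y -> P (c *: x + y)) -> P 1 ->
  (forall x y, P x -> P y -> P (x * y)) -> (forall i, P (hgen i)) ->
  forall h, P h.
Proof.
move=> PP P1 PM Pg h; have [x ->] := hproj_surj h.
have P0 : P 0 by rewrite -(addNr 1) -scaleN1r; apply: PP.
have Pw (k : {fmonom I}) : P (hproj cox << k >>).
  case: k => s; elim: s => [|i s IH]; first by rewrite -fmoneE.
  have -> : << FMonom (i :: s) >> = fgen F i * << FMonom s >> :> {malg F[{fmonom I}]}.
    rewrite /fgen malgM_def fgmulUU mulr1; congr << _ >>.
    by apply: val_inj; rewrite /= fmM fmU.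
  by rewrite hprojM'; apply: PM (Pg i) IH.
rewrite [x]monalgE raddf_sum; elim: (enum_fset _) => [|k r IH]; first by rewrite big_nil.
rewrite big_cons; have -> : << x@_k *g k >> = x@_k *: << k >> :> {malg F[{fmonom I}]}.
  by apply/malgP => l; rewrite mcoeffZ !mcoeffU mulr_natr.
by rewrite [X in X + _]hprojZ; apply: PP.
Qed.

Lemma hecke_linear (U V : lmodType H) (f : U -> V) :
  (forall u v, f (u + v) = f u + f v) ->
  (forall (c : F) u, f (c%:A *: u) = c%:A *: f u) ->
  (forall i u, f (hgen i *: u) = hgen i *: f u) -> linear f.
Proof.
move=> fD fZ fg h u v; rewrite fD; congr (_ + _).
elim/hecke_ind: h u => [c x y ex ey|u|x y ex ey u|i u] //; last first.
- by rewrite -!scalerA ex ey.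
- by rewrite !scale1r.
move=> u; have Z (W : lmodType H) (w : W) : (c *: x) *: w = c%:A *: (x *: w).
  by rewrite scalerA mulr_algl.
by rewrite [X in f X]scalerDl fD [RHS]scalerDl ey Z fZ ex Z.
Qed.

End HeckeModules.

Section ModuleIso.
Variable R : pzRingType.
Implicit Types U V W : lmodType R.

Lemma mod_iso_bij U V (f : U -> V) : linear f -> bijective f -> mod_iso U V.
Proof.
move=> lf bf; pose m := GRing.isLinear.Build R U V *:%R f lf.
pose g : {linear U -> V} := HB.pack f m.
by exists g.
Qed.

Lemma mod_iso_sym U V : mod_iso U V -> mod_iso V U.
Proof.
case=> f [g fK gK]; apply: (@mod_iso_bij _ _ g); last by exists f.
by move=> a u v; apply: (can_inj fK); rewrite linearP !gK.
Qed.

Lemma mod_iso_trans U V W : mod_iso U V -> mod_iso V W -> mod_iso U W.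
Proof.
case=> f bf [g bg]; apply: (@mod_iso_bij _ _ (g \o f)); last exact: bij_comp.
by move=> a u v /=; rewrite !linearP.
Qed.

Lemma inj_surj_bij (S T : Type) (f : S -> T) :
  injective f -> (forall y, exists x, f x = y) -> bijective f.
Proof.
move=> fi fs; have [g gP] := choice fs; exists g => // x.
by apply: fi; rewrite gP.
Qed.

End ModuleIso.

(** * The tableau action in coordinates *)

Section TableauCoordinates.
Variables (F : fieldType) (n : nat) (g : gpribbon n).
Implicit Types (v : tabspace F g) (i : 'I_n).

(** Coefficients extended by zero, so that the coefficient at [s_i x] makes sense whether or not
    [s_i x] is standard. *)
Definition tabext v (w : filling n) : F := if insub w is Some t then v t else 0.

Lemma tabext_tab v (t : tab g) : tabext v t = v t.
Proof. by rewrite /tabext valK. Qed.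

Lemma tab_signed (t : tab g) : signed_perm t.
Proof. by have /and3P[] := tabP t. Qed.

Lemma tabext_sum v w : tabext v w = \sum_(t : tab g) v t * (tab_fill t == w)%:R.
Proof.
rewrite /tabext; case: insubP => [t _ <-|nst].
  rewrite (bigD1 t) //= eqxx mulr1 big1 ?addr0 // => u ne.
  by rewrite -[tab_fill u == _]/(u == t) (negbTE ne) mulr0.
rewrite big1 // => t _; case: eqP => [e|]; last by rewrite mulr0.
by rewrite -e tabP in nst.
Qed.

(** Transpose of the action: only [x] and [s_i x] can contribute to [x], and only if [i] is a
    descent of [x], because [s_i] creates the descent. *)
Lemma tabact_coord i (t x : tab g) : tabact F i t x =
  if wdes i x then (tab_fill t == sfill i x)%:R - (t == x)%:R else 0.
Proof.
have sx := tab_signed x; have st := tab_signed t.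
rewrite /tabact descentE ?tabP //; case: ifP => dt.
  rewrite ffunE ffunE; case: (eqVneq t x) => [<-|ne].
    rewrite dt (_ : tab_fill t == sfill i t = false) ?sub0r //.
    by apply/eqP => e; have := wdes_sfill i st; rewrite -e dt.
  rewrite !mulr0n oppr0; case: ifP => // dx.
  rewrite (_ : tab_fill t == _ = false); first by rewrite [RHS]addr0.
  apply/eqP => e.
  by have := wdes_sfill i sx; rewrite -e dt dx.
have -> : (tab_fill t == sfill i x) = (sfill i t == tab_fill x).
  by apply/eqP/eqP => [->|<-]; rewrite sfillK.
have dxt : sfill i t = tab_fill x -> wdes i x by move=> <-; rewrite wdes_sfill // dt.
transitivity ((sfill i t == tab_fill x)%:R : F).
  case: insubP => [u _ eu|nst].
    by rewrite ffunE -eu eq_sym -[RHS]/((u == x)%:R).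
  rewrite ffunE; case: eqP => // e; by rewrite e tabP in nst.
case: ifP => dx; last by case: eqP => // /dxt; rewrite dx.
rewrite (_ : t == x = false) ?subr0 //; apply/eqP => e.
by rewrite e dx in dt.
Qed.

Lemma pibarE i v x : pibar i v x =
  if wdes i x then tabext v (sfill i x) - v x else 0.
Proof.
rewrite /pibar sum_ffunE; under eq_bigr do rewrite ffunE tabact_coord.
case: ifP => _; last by rewrite big1 // => t _; rewrite [LHS]mulr0.
rewrite tabext_sum -[v x]tabext_tab tabext_sum -sumrB.
by apply: eq_bigr => t _; rewrite [LHS]mulrBr.
Qed.

Lemma PB_genE i (v : PB F g) : pi_B F i *: v = pibar i v + v :> tabspace F g.
Proof. by rewrite -PB_pibar scalerBl scale1r [RHS]subrK. Qed.

Lemma PB_scalarE (c : F) (v : PB F g) :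
  c%:A *: v = c *: (v : tabspace F g) :> tabspace F g.
Proof. exact: (@hmod_scalarE F _ _ (PB_rep F g) c v). Qed.

End TableauCoordinates.

(** * Decomposition into pseudo-ribbon modules *)

Section RibbonDecomposition.
Variables (F : fieldType) (n : nat) (a : pscomp n).

Local Notation M := (tabspace F (gpr_rows a)).
Local Notation P b := (tabspace F (gpr_ribbon b)).
Local Notation coset b := (same_coset (descset b)).

Definition coset_sum (b : pscomp n) (v : P b) : M :=
  [ffun x : tab (gpr_rows a) =>
    \sum_(w : tab (gpr_ribbon b) | coset b x w) v w].

Lemma coset_sum_linear b c (u v : P b) :
  coset_sum (c *: u + v) = c *: coset_sum u + coset_sum v.
Proof.
apply/ffunP => x; rewrite !ffunE scaler_sumr -big_split /=.
by apply: eq_bigr => w _; rewrite !ffunE.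
Qed.

HB.instance Definition _ b := GRing.isLinear.Build F (P b) M *:%R
  (@coset_sum b) (@coset_sum_linear b).

Lemma coset_sum_pibar b i (v : P b) :
  coset_sum (pibar i v) = pibar i (coset_sum v).
Proof.
apply/ffunP => x; rewrite pibarE ffunE.
have [sx ax] := elimT (standard_rows a x) (tabP x).
have stdP (w : tab (gpr_ribbon b)) := elimT (standard_ribbon b w) (tabP w).
under eq_bigr do rewrite pibarE.
(* If tied, both sides vanish: no [w] in the coset has the descent [i], and [x] and [s_i x] have
   equal coefficients because they lie in one coset. *)
case: (boolP (tied (descset b) i x)) => tx.
  rewrite big1 => [|w cw]; last first.
    have [sw aw _] := stdP w; have tw := tx; rewrite (tied_coset i cw) in tw.
    by rewrite (negbTE (asc_tied sw aw tw).1).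
  case: ifP => // dx; rewrite /tabext insubT.
    by apply/standard_rows; split; [exact: signed_perm_sfill|exact: asc_down].
  move=> sd; rewrite !ffunE; apply/esym/eqP; rewrite subr_eq0; apply/eqP.
  by apply: eq_bigl => w; rewrite /= same_coset_tied.
have des w : coset b x w -> wdes i x = wdes i w.
  by move=> cw; apply: (wdes_coset cw); rewrite -(tied_coset i cw).
case: ifP => dx; last first.
  by rewrite big1 // => w /des; rewrite dx => <-.
rewrite (eq_bigr (fun w => tabext v (sfill i (tab_fill w)) - v w)); last first.
  by move=> w /des <-; rewrite dx.
rewrite sumrB; congr (_ - _); last by rewrite ffunE.
rewrite /tabext insubT.
  by apply/standard_rows; split; [exact: signed_perm_sfill|exact: asc_down].
move=> sd; rewrite ffunE /=.
(* The coefficient at [s_i w] is spread over all tableaux [u]; after exchanging the sums, each [u]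
   in the coset of [s_i x] comes from the single tableau [w = s_i u]. *)
transitivity (\sum_(w : tab (gpr_ribbon b) | coset b x w)
    \sum_(u : tab (gpr_ribbon b)) v u * (tab_fill u == sfill i w)%:R).
  by apply: eq_bigr => w _; rewrite -tabext_sum.
rewrite exchange_big /= [RHS]big_mkcond /=; apply: eq_bigr => u _.
have [su au du] := stdP u; have sx' := signed_perm_sfill i sx.
case: ifP => cu; last first.
  rewrite big1 // => w cw; case: eqP => [e|]; last by rewrite mulr0.
  have [sw _ _] := stdP w.
  by rewrite e same_coset_sfill in cu.
have cu' : coset b x (sfill i u).
  by rewrite -[tab_fill x](sfillK i); apply: same_coset_sfill.
have ntu : ~~ tied (descset b) i u.
  apply: contra tx => tu; rewrite (tied_coset i cu').
  have /(tied_coset i) -> // : coset b (sfill i u) u.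
  by rewrite same_coset_tied // same_coset_refl.
have ndu : ~~ wdes i u by rewrite -(wdes_coset cu ntu) wdes_sfill // dx.
have su' : standard (gpr_ribbon b) (sfill i u).
  by apply/standard_ribbon; split; [exact: signed_perm_sfill|exact: asc_up|exact: dsc_up].
rewrite (bigD1 (Tab su')) //= sfillK eqxx mulr1 big1 ?addr0 // => w /andP[_ ne].
case: eqP => [e|]; last by rewrite mulr0.
by case/eqP: ne; apply: val_inj => /=; rewrite e sfillK.
Qed.

End RibbonDecomposition.

(** * Unitriangularity and bijectivity *)

Section RibbonIsomorphism.
Variables (F : fieldType) (n : nat) (a : pscomp n).

Local Notation J := {b : pscomp n | pc_le b a}.
Local Notation S := (dsum (fun b : J => PB_comp F (val b))).
Local Notation M := (tabspace F (gpr_rows a)).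

Definition ribbon_sum (y : S) : MB F a := (\sum_(b : J) coset_sum a (y b) : M).

Lemma ribbon_sum_linear : linear ribbon_sum.
Proof.
apply: hecke_linear => [u v|c u|i u].
- rewrite -[RHS]big_split; apply: eq_bigr => b _.
  by rewrite ffunE; exact: linearD.
- rewrite PB_scalarE /ribbon_sum scaler_sumr; apply: eq_bigr => b _.
  by rewrite ffunE PB_scalarE; exact: linearZ.
rewrite [RHS]PB_genE /ribbon_sum raddf_sum -[RHS]big_split.
apply: eq_bigr => b _ /=; rewrite -coset_sum_pibar ffunE PB_genE.
exact: linearD.
Qed.

HB.instance Definition _ := GRing.isLinear.Build (HeckeB F n) S (MB F a) *:%R
  ribbon_sum ribbon_sum_linear.

Lemma ribbon_sumE (y : S) x : (ribbon_sum y : M) x =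
  \sum_(b : J) \sum_(w : tab (gpr_ribbon (val b)) | same_coset (descset (val b)) x w)
    (y b : tabspace F _) w.
Proof. by rewrite sum_ffunE; apply: eq_bigr => b _; rewrite ffunE. Qed.

Lemma ribbon_descset (b : pscomp n) (w : tab (gpr_ribbon b)) (k : nat) :
  (k \in descset b) = (ev w k.+1 < ev w k).
Proof.
have [_ h1 h2] := elimT (standard_ribbon b w) (tabP w).
apply/idP/idP => [/h2 //|]; apply: contraTT => /h1; by rewrite -leNgt => /ltW.
Qed.

Lemma ribbon_std (b : J) (w : tab (gpr_ribbon (val b))) : standard (gpr_rows a) w.
Proof.
have [sp h1 h2] := elimT (standard_ribbon (val b) w) (tabP w).
apply/standard_rows; split=> // k ka; apply: h1; apply: contra ka.
exact: (allP (valP b)).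
Qed.

Lemma ribbon_unique (b b' : J) (w : tab (gpr_ribbon (val b)))
  (w' : tab (gpr_ribbon (val b'))) : w = w' :> filling n -> b = b'.
Proof.
move=> e; apply/val_inj/descset_inj => k.
by rewrite !(ribbon_descset w, ribbon_descset w') e.
Qed.

Lemma ribbon_ltf (b : J) (x : tab (gpr_rows a)) (w : tab (gpr_ribbon (val b))) :
  same_coset (descset (val b)) x w -> tab_fill x != tab_fill w -> ltf x w.
Proof.
have [sx _] := elimT (standard_rows a x) (tabP x).
have [sw h _] := elimT (standard_ribbon (val b) w) (tabP w).
exact: coset_ltf.
Qed.

(** Induction from the largest filling downwards: the coefficient of the image at [w] is that of [y]
    at [w] plus coefficients at larger tableaux, already known to vanish. *)
Lemma ribbon_sum_eq0 (y : S) : ribbon_sum y = 0 ->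
  forall (b : J) (w : tab (gpr_ribbon (val b))), (y b : tabspace F _) w = 0.
Proof.
move=> y0 b w; have [m] := ubnP (#|{: filling n}| - lexrank w).
elim: m b w => // m IH b w lem.
have := ribbon_sumE y (Tab (ribbon_std w)); rewrite y0 ffunE.
have late (b' : J) (w' : tab (gpr_ribbon (val b'))) :
    ltf w w' -> (y b' : tabspace F _) w' = 0.
  move=> lt; apply: IH; have := ltf_rank lt.
  have : (lexrank w' <= #|{: filling n}|)%N by exact: max_card.
  by move: lem; rewrite /=; lia.
rewrite (bigD1 b) //= (bigD1 w) ?same_coset_refl //=.
rewrite big1 => [|w' /andP[c ne]]; last first.
  by apply: late; apply: (@ribbon_ltf b (Tab (ribbon_std w))); rewrite // eq_sym.
rewrite big1 => [|b' nb]; first by rewrite !addr0.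
rewrite big1 // => w' c; apply: late.
apply: (@ribbon_ltf b' (Tab (ribbon_std w))) => //=.
by apply: contra nb => /eqP /ribbon_unique ->.
Qed.

(** Let [D(b)] be the right descent set of [x]. Then [x] has shape [b], its image is the sum of the
    tableaux in its coset, and the others are smaller, hence reached by induction. *)
Lemma ribbon_sum_tabvec (x : tab (gpr_rows a)) :
  exists y, ribbon_sum y = tabvec F x.
Proof.
have [m] := ubnP (lexrank x); elim: m x => // m IH x lem.
have [sx ax] := elimT (standard_rows a x) (tabP x).
have [b Db] := descset_surj n (fun k => ev x k.+1 < ev x k).
have ba : pc_le b a.
  apply/allP => k; rewrite Db => /andP[_ lt]; apply: contraLR lt => /ax.
  by rewrite -leNgt => /ltW.
have sb : standard (gpr_ribbon b) x.
  apply/standard_ribbon; split=> // k; rewrite Db; last by case/andP.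
  rewrite negb_and -leqNgt => /orP[nk|].
    by apply: ax; apply: contraL nk => /descset_ltn; rewrite -ltnNge.
  rewrite -leNgt le_eqVlt => /orP[/eqP|//] /(can_inj (evK sx)); lia.
pose b0 : J := exist _ b ba; pose w0 : tab (gpr_ribbon (val b0)) := Tab sb.
pose y1 : S := [ffun b' : J =>
  ([ffun u : tab (gpr_ribbon (val b')) => (tab_fill u == tab_fill x)%:R]
     : tabspace F _) : PB_comp F (val b')].
have y1E (x' : tab (gpr_rows a)) :
    (ribbon_sum y1 : M) x' = (same_coset (descset b) x' x)%:R.
  rewrite ribbon_sumE (bigD1 b0) //= [X in _ + X]big1 ?addr0 => [|b' nb].
    rewrite big_mkcond (bigD1 w0) //= big1 ?addr0 => [|w ne].
      by rewrite !ffunE eqxx; case: ifP.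
    rewrite !ffunE; case: ifP => // _; case: eqP => // e.
    by case/eqP: ne; apply: val_inj.
  rewrite big1 // => w _; rewrite !ffunE; case: eqP => // e.
  by case/eqP: nb; apply: (@ribbon_unique _ _ w w0).
(* The conditions on [x'] stand inside the existential so that [choice] gives a family indexed by
   all tableaux. *)
have pre (x' : tab (gpr_rows a)) : exists y, same_coset (descset b) x' x ->
    x' != x -> ribbon_sum y = tabvec F x'.
  case: (boolP (same_coset (descset b) x' x && (x' != x))) => [/andP[c ne]|h].
    have [|y ey] := IH x'; last by exists y.
    by have := ltf_rank (@ribbon_ltf b0 x' w0 c ne); rewrite /=; lia.
  by exists 0 => c ne; rewrite c ne in h.
have [Y YP] := choice pre.
pose Q (x' : tab (gpr_rows a)) := same_coset (descset b) x' x && (x' != x).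
have e : ribbon_sum (\sum_(x' | Q x') Y x') = \sum_(x' | Q x') tabvec F x' :> M.
  by rewrite linear_sum; apply: eq_bigr => x' /andP[]; exact: YP.
exists (y1 - \sum_(x' | Q x') Y x'); rewrite linearB /= e.
apply/ffunP => z; rewrite [LHS]ffunE [X in _ + X]ffunE y1E sum_ffunE big_mkcond /=.
rewrite (bigD1 z) //= big1 ?addr0 => [|x' ne]; last first.
  by case: ifP => // _; rewrite ffunE eq_sym (negbTE ne).
rewrite !ffunE eqxx /Q; case: (eqVneq z x) => [->|ne].
  by rewrite same_coset_refl /= [LHS]subr0.
by rewrite andbT; case: same_coset; [rewrite [LHS]subrr|rewrite [LHS]subr0].
Qed.

Lemma MB_iso_ribbons : mod_iso (MB F a) S.
Proof.
apply/mod_iso_sym/mod_iso_bij; first exact: ribbon_sum_linear.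
apply: inj_surj_bij => [y y' e|v].
  apply/eqP; rewrite -subr_eq0; apply/eqP/ffunP => b; rewrite [RHS]ffunE.
  apply/ffunP => w; rewrite [RHS]ffunE; apply: ribbon_sum_eq0.
  by rewrite raddfB /= e subrr.
have [Y YP] := choice ribbon_sum_tabvec.
exists (\sum_(x : tab (gpr_rows a)) (((v : M) x : F) *: (1 : HeckeB F n)) *: Y x).
rewrite [RHS]tabspaceE.
rewrite linear_sum; apply: eq_bigr => x _.
by rewrite linearZ [LHS]PB_scalarE /= YP.
Qed.

End RibbonIsomorphism.

(** * Products along reduced words *)

Section BarredGenerators.
Variables (F : fieldType) (A : algType F) (p q : A).
Hypotheses (pp : p * p = p) (qq : q * q = q).

Let neg (x : A) : {linear A -> A} := (- x) \*o idfun.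

Let neg_sign k x (y v : A) :
  - x * ((-1) ^+ k * y * v) = (-1) ^+ k.+1 * (x * y) * v.
Proof. by rewrite exprS mulN1r !mulNr !mulrA commr_sign. Qed.

Let altcomp_neg k x y v :
  altcomp k (neg x) (neg y) v = (-1) ^+ k * altprod k x y * v.
Proof.
elim: k x y => [|k IH] x y; first by rewrite expr0 !mul1r.
by rewrite [LHS]/= IH; exact: neg_sign.
Qed.

Let altcomp_shift k x y v :
  altcomp k (shiftop (neg x)) (shiftop (neg y)) v
  = (-1) ^+ k * altprod k (x - 1) (y - 1) * v.
Proof.
elim: k x y => [|k IH] x y; first by rewrite expr0 !mul1r.
have sh u : shiftop (neg x) u = - (x - 1) * u.
  by rewrite /shiftop /= !mulNr mulrBl mul1r opprB addrC.
by rewrite [LHS]/= sh IH; exact: neg_sign.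
Qed.

Lemma bar_sq : (p - 1) * (p - 1) = - (p - 1).
Proof. by rewrite mulrBl mulrBr pp mulr1 subrr sub0r mul1r. Qed.

(** [shift_braid] passes from operators [a] with [a^2 = -a] to [a + 1]. Left multiplication by [-p]
    is such an operator and its shift is left multiplication by [-(p - 1)]; the signs [(-1)^k] then
    cancel. *)
Lemma bar_braid k : (1 < k < 5)%N -> altprod k p q = altprod k q p ->
  altprod k (p - 1) (q - 1) = altprod k (q - 1) (p - 1).
Proof.
move=> hk e; have n2 x : x * x = x -> forall v, neg x (neg x v) = - neg x v.
  by move=> xx v /=; rewrite !mulNr mulrN opprK opprK mulrA xx.
have := @shift_braid F A (neg p) (neg q) k 1 (n2 p pp) (n2 q qq) hk.
rewrite !altcomp_neg e => /(_ erefl); rewrite !altcomp_shift !mulr1.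
exact: (can_inj (signrMK k)).
Qed.

End BarredGenerators.

(** * Right multiplication by generators *)

Section RightAction.
Variable n : nat.
Implicit Types (w : filling n) (i j : 'I_n).

(** The product [w s_j]: it acts on positions, where [sfill] acts on values. *)
Definition rfill j w : filling n := [ffun k => if j == 0%N :> nat then
  (if k == j then ~~ (w k).1 else (w k).1, (w k).2) else w (tperm (pred_ord j) j k)].

Lemma signed_perm_rfill j w : signed_perm w -> signed_perm (rfill j w).
Proof.
move=> /injectiveP inj; apply/injectiveP => k l; rewrite !ffunE.
by case: ifP => _ /=; [move/inj|move/inj/perm_inj].
Qed.

Lemma ev_rfill j w z : ev (rfill j w) z = ev w (sig j z).
Proof.
have s0 : sig j 0 = 0 by have := sigP j 0; lia.
elim/(@int_cases n): z => [z e||k|k h]; rewrite ?s0 ?ev0 //.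
- by rewrite sigN !evN e.
- rewrite ev_ord ffunE; case: eqP => [j0|/eqP j0].
    case: eqP => [->|ne].
      have -> : sig j j.+1 = - j.+1%:Z by have := sigP j j.+1; lia.
      by rewrite evN ev_ord /lval /=; case: (w j).1; rewrite /= ?opprK.
    have -> : sig j k.+1 = k.+1.
      have : k != j :> nat by apply/eqP => /val_inj.
      by have := sigP j k.+1; lia.
    by rewrite ev_ord; case: (w k).
  have pj := pred_ord_val j0; rewrite -ev_ord; congr (ev w _).
  have := sigP j k.+1; case: tpermP => [->|->|/eqP + /eqP +]; rewrite -?val_eqE /=.
  + by lia.
  + by lia.
  + by lia.
- have -> : sig j k = k by have := sigP j k; have := ltn_ord j; lia.
  by rewrite !ev_out.
Qed.

Lemma pv_rfill j w v : signed_perm w -> pv (rfill j w) v = sig j (pv w v).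
Proof.
move=> sp; have sp' := signed_perm_rfill j sp.
by apply: (can_inj (evK sp')); rewrite pvK // ev_rfill sigK pvK.
Qed.

Lemma sfill_rfill i j w : sfill i (rfill j w) = rfill j (sfill i w).
Proof. by apply: ev_inj => z; rewrite ev_sfill !ev_rfill ev_sfill. Qed.

(** The hypothesis says that the inverse of [w] carries the pair [i], [i + 1] to [j], [j + 1] up to
    a common sign, so conjugation by it turns [s_i] into [s_j]. *)
Lemma sfill_eq_rfill i j w : signed_perm w ->
  pv w i = j /\ pv w i.+1 = j.+1 \/ pv w i = - j.+1%:Z /\ pv w i.+1 = - j%:Z ->
  sfill i w = rfill j w.
Proof.
move=> sp h; apply: pv_inj; [exact: signed_perm_sfill|exact: signed_perm_rfill|].
move=> v; rewrite pv_sfill // pv_rfill //.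
have inj u : pv w v = pv w u -> v = u by exact: (can_inj (pvK sp)).
have iN u : pv w v = - pv w u -> v = - u by rewrite -pvN; exact: inj.
have [i1 i2 i3 i4] : [/\ pv w v = pv w i -> v = i, pv w v = pv w i.+1 -> v = i.+1,
    pv w v = - pv w i -> v = - i%:Z & pv w v = - pv w i.+1 -> v = - i.+1%:Z].
  by split; [exact: inj|exact: inj|exact: iN|exact: iN].
(* The inverse of [w] sends 0 and only 0 to 0; this makes [i = 0] and [j = 0] equivalent. *)
have z0 : i = 0%N :> nat -> pv w i = 0 by move->; rewrite pv0.
have z1 : pv w i = 0 -> i = 0%N :> nat.
  by move=> e; have := can_inj (pvK sp) (x1 := i) (x2 := 0); rewrite pv0; lia.
have z2 : pv w i.+1 <> 0.
  by move=> e; have := can_inj (pvK sp) (x1 := i.+1) (x2 := 0); rewrite pv0; lia.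
have := sigP j (pv w v).
case: (sigP i v) => [[i0 [v1 ->]]|[[i0 [v1 ->]]|[[i0 [ev ->]]|[[i0 [ev ->]]|[[i0 [ev ->]]| ]]]]].
- have [e|e] : v = i.+1 \/ v = - i.+1%:Z by lia.
    by rewrite e !pvN; lia.
  by rewrite e !pvN; lia.
- have pi0 := z0 i0; have j0 : j = 0%N :> nat by move: h; rewrite pi0; lia.
  have p1 : pv w i.+1 = 1%N by move: h; rewrite pi0 j0; lia.
  rewrite /sig j0 eqxx; case: eqP => // e _; exfalso.
  by move: i2 i4; rewrite p1; lia.
- by rewrite ev; lia.
- by rewrite ev; lia.
- by rewrite ev !pvN; lia.
case=> [[i0 [ev ->]]|[i0 [v1 [v2 ->]]]]; first by rewrite ev !pvN; lia.
have pi0 : pv w i <> 0 by move/z1; lia.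
have j0 : j <> 0%N :> nat by move=> j0; move: h; rewrite j0; lia.
by clear z0 z1; move: h => [] [h1 h2]; rewrite h1 h2 in i1 i2 i3 i4; lia.
Qed.

End RightAction.

(** * A measure decreasing along left descents *)

Section Length.
Variable n : nat.
Implicit Types (w : filling n) (i : 'I_n).

(** A stand-in for the Coxeter length. Removing a descent moves the larger value, of larger weight,
    to the right, or makes the position of 1 positive, so the sum drops. *)
Definition wlen w : nat :=
  absz (\sum_(b : 'I_n) b.+1%:Z * (n%:Z - lpos b w)).

Lemma lpos_le b w : signed_perm w -> lpos b w <= n%:Z.
Proof.
move=> sp; have [k <-] := signed_perm_surj b sp; rewrite lposE //.
by have := ltn_ord k; case: ifP; lia.
Qed.

Lemma wlenE w : signed_perm w ->
  (wlen w : int) = \sum_(b : 'I_n) b.+1%:Z * (n%:Z - lpos b w).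
Proof.
move=> sp; rewrite gez0_abs // sumr_ge0 // => b _.
by rewrite mulr_ge0 // subr_ge0 lpos_le.
Qed.

Lemma wlen_sfill i w : signed_perm w -> wdes i w ->
  (wlen (sfill i w) < wlen w)%N.
Proof.
move=> sp; rewrite wdesE -ltz_nat !wlenE //; last exact: signed_perm_sfill.
rewrite /lpred => d; rewrite (bigD1 i) //= [X in _ < X](bigD1 i) //=.
move: d; rewrite lpos_self; case: eqP => [i0 d|/eqP i0 d].
  rewrite [X in _ + X < _](eq_bigr (fun b : 'I_n => b.+1%:Z * (n%:Z - lpos b w))).
    by rewrite ltrD2r i0; lia.
  by move=> b bi; rewrite lpos_other // i0.
have ne := pred_ord_neq i0.
rewrite (bigD1 (pred_ord i)) //= [X in _ < _ + X](bigD1 (pred_ord i)) //=.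
rewrite lpos_sfill // tpermL.
rewrite [X in _ + (_ + X) < _](eq_bigr (fun b : 'I_n => b.+1%:Z * (n%:Z - lpos b w))).
  rewrite !addrA ltrD2r; move: d; have := pred_ord_val i0; move: (lpos _ _) (lpos _ _).
  move=> x y; move: i0; case: (i : nat) => // m _ /=; rewrite -[m.+2]addn1 PoszD => _ d.
  by rewrite !mulrDl !mulrBr; lia.
by move=> b /andP[b1 b2]; rewrite lpos_other.
Qed.

End Length.

(** * Independence of the reduced word *)

Section WordProducts.
Variables (n : nat) (A : pzRingType) (p : 'I_n -> A).
Implicit Types (w : filling n) (i j : 'I_n).

Hypothesis p_braid : forall i j, i != j ->
  altprod (coxB i j) (p i) (p j) = altprod (coxB i j) (p j) (p i).

Fixpoint tbar_rec (k : nat) w : A :=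
  if k is k'.+1 then
    if [pick i | wdes i w] is Some i then p i * tbar_rec k' (sfill i w) else 1
  else 1.

(* The product of the p_i along a reduced word of w, found by removing the first
   left descent; tbar_des shows that the choice of descent is irrelevant. *)
Definition tbar w : A := tbar_rec (wlen w).+1 w.

Lemma tbar_rec_fuel k k' w : signed_perm w -> (wlen w < k)%N -> (wlen w < k')%N ->
  tbar_rec k w = tbar_rec k' w.
Proof.
elim: k k' w => [|k IH] [|k'] w sp h h'; try by rewrite ltn0 in h h'.
rewrite [LHS]/= [RHS]/=; case: pickP => [i d|_]; last by [].
congr (_ * _); apply: IH; first exact: signed_perm_sfill.
  by have := wlen_sfill sp d; lia.
by have := wlen_sfill sp d; lia.
Qed.

Lemma tbarE w : signed_perm w -> tbar w =
  if [pick i | wdes i w] is Some i then p i * tbar (sfill i w) else 1.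
Proof.
move=> sp; rewrite {1}/tbar [LHS]/=; case: pickP => [i d|_]; last by [].
congr (_ * _); apply: tbar_rec_fuel; last exact: ltnSn.
  exact: signed_perm_sfill.
exact: wlen_sfill.
Qed.

(** With both [i] and [j] as descents, [w] starts with the longest element of the dihedral group of
    [s_i] and [s_j]. Factors are removed alternately along its two reduced words, of length 2, 3 or
    4; both lead to the same filling, and the braid relation compares the factors. *)
Lemma tbar_dihedral w i j : signed_perm w -> (i < j)%N -> wdes i w -> wdes j w ->
  (forall x k, signed_perm x -> (wlen x < wlen w)%N -> wdes k x ->
    tbar x = p k * tbar (sfill k x)) ->
  p i * tbar (sfill i w) = p j * tbar (sfill j w).
Proof.
move=> sp ij di dj IH; have sps k x : signed_perm x -> signed_perm (sfill k x).
  exact: signed_perm_sfill.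
have li := wlen_sfill sp di; have lj := wlen_sfill sp dj.
have down k x : signed_perm x /\ (wlen x < wlen w)%N -> wdes k x ->
    tbar x = p k * tbar (sfill k x) /\
    (signed_perm (sfill k x) /\ (wlen (sfill k x) < wlen w)%N).
  move=> [sx lx] d; split; first exact: IH.
  by split; [exact: sps|have := wlen_sfill sx d; lia].
have ne : i != j by rewrite -val_eqE /=; lia.
have br := p_braid ne; move: br; rewrite /coxB /adjacent.
have -> /= : (j.+1 == i) = false by lia.
have -> : (j == 0%N :> nat) = false by lia.
rewrite !orbF; move: di dj; rewrite !wdes_pv.
have oki : signed_perm (sfill i w) /\ (wlen (sfill i w) < wlen w)%N by split; [exact: sps|].
have okj : signed_perm (sfill j w) /\ (wlen (sfill j w) < wlen w)%N by split; [exact: sps|].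
case: eqP => [eij|neij]; last first.
  move=> di dj; rewrite /= !mulr1 => br.
  have [||-> _] := down j (sfill i w) => //.
    have e1 : sig i j = j by have := sigP i j; lia.
    have e2 : sig i j.+1 = j.+1 by have := sigP i j.+1; lia.
    by rewrite wdes_pv !pv_sfill // e1 e2.
  have [||-> _] := down i (sfill j w) => //.
    have e1 : sig j i = i by have := sigP j i; lia.
    have e2 : sig j i.+1 = i.+1 by have := sigP j i.+1; lia.
    by rewrite wdes_pv !pv_sfill // e1 e2.
  have C : sfill i (sfill j w) = sfill j (sfill i w).
    by apply: sfillC => //; rewrite /adjacent; lia.
  by rewrite !mulrA br C.
have s1 : sig j j.+1 = j by have := sigP j j.+1; lia.
have s2 : sig j j = j.+1 by have := sigP j j; lia.
have s3 : sig j i = i by have := sigP j i; lia.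
have s4 : sig i j.+1 = j.+1 by have := sigP i j.+1; lia.
rewrite eij.
case: eqP => [i0|/eqP i0] di dj.
  have s5 : sig i j = - j%:Z by have := sigP i j; lia.
  have s6 x : pv x i = 0 by rewrite i0 pv0.
  rewrite /= !mulr1 => br; rewrite s6 in di dj.
  have [||-> o1] := down j (sfill i w) => //.
    by rewrite wdes_pv !pv_sfill // s4 s5 pvN; lia.
  have [||-> o2] := down i (sfill j (sfill i w)) => //.
    by rewrite wdes_pv s6 eij !pv_sfill ?sps // s2 s4; lia.
  have [||-> o3] := down j (sfill i (sfill j (sfill i w))) => //.
    by rewrite wdes_pv !pv_sfill ?sps // s4 s5 sigN s1 s2 sigN s4 s5 !pvN; lia.
  have [||-> p1] := down i (sfill j w) => //.
    by rewrite wdes_pv s6 eij !pv_sfill // s2; lia.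
  have [||-> p2] := down j (sfill i (sfill j w)) => //.
    by rewrite wdes_pv !pv_sfill ?sps // s4 s5 sigN s1 s2 pvN; lia.
  have [||-> p3] := down i (sfill j (sfill i (sfill j w))) => //.
    by rewrite wdes_pv s6 eij !pv_sfill ?sps // s2 s4 s1; lia.
  by rewrite !mulrA in br *; rewrite br -sfill_braid4.
have s5 : sig i j = i by have := sigP i j; lia.
have s6 : sig i i = j by have := sigP i i; lia.
rewrite /= !mulr1 => br.
have [||-> o1] := down j (sfill i w) => //.
  by rewrite wdes_pv !pv_sfill // s4 s5; lia.
have [||-> o2] := down i (sfill j (sfill i w)) => //.
  by rewrite wdes_pv eij !pv_sfill ?sps // s2 s3 s4 s6; lia.
have [||-> p1] := down i (sfill j w) => //.
  by rewrite wdes_pv eij !pv_sfill // s2 s3; lia.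
have [||-> p2] := down j (sfill i (sfill j w)) => //.
  by rewrite wdes_pv !pv_sfill ?sps // s4 s5 s1 s3; lia.
by rewrite !mulrA in br *; rewrite br sfill_braid3.
Qed.

Lemma tbar_des i w : signed_perm w -> wdes i w ->
  tbar w = p i * tbar (sfill i w).
Proof.
have [m] := ubnP (wlen w); elim: m w i => // m IH w i lem sp di.
have IH' x k : signed_perm x -> (wlen x < wlen w)%N -> wdes k x ->
    tbar x = p k * tbar (sfill k x).
  by move=> sx lx; apply: IH => //; lia.
rewrite (tbarE sp); case: pickP => [k dk|/(_ i)]; last by rewrite di.
case: (ltngtP k i) => [lt|gt|/val_inj -> //]; first exact: tbar_dihedral.
by apply/esym/tbar_dihedral.
Qed.

Lemma tbar_id : tbar (idfill n) = 1.
Proof.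
rewrite tbarE; last exact: signed_perm_id.
case: pickP => [i|_]; last by [].
by rewrite wdes_pv !pv_id; lia.
Qed.

Lemma tbar_asc i w : signed_perm w -> ~~ wdes i w ->
  p i * tbar w = tbar (sfill i w).
Proof.
move=> sp d; have sp' := signed_perm_sfill i sp.
by rewrite [RHS](tbar_des sp' (i := i)) ?sfillK // wdes_sfill.
Qed.

(** The ascent at [j] means that [w s_j] is longer than [w]. A left descent of [w] stays one of
    [w s_j] and can be removed from both; at the identity, left and right multiplication agree. *)
Lemma tbar_rfill j w : signed_perm w -> ev w j < ev w j.+1 ->
  tbar (rfill j w) = tbar w * p j.
Proof.
have [m] := ubnP (wlen w); elim: m w => // m IH w lem sp aj.
case: (pickP (fun i => wdes i w)) => [i di|nd]; last first.
  have -> : w = idfill n by apply: wdes_none => // i; rewrite nd.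
  have -> : rfill j (idfill n) = sfill j (idfill n).
    by apply: ev_inj => z; rewrite ev_rfill ev_sfill !ev_id.
  rewrite tbar_id -tbar_asc ?tbar_id ?mul1r ?mulr1 //; first exact: signed_perm_id.
  by rewrite wdes_pv !pv_id; lia.
have sp' := signed_perm_sfill i sp; have ls := wlen_sfill sp di.
rewrite (tbar_des sp di) -mulrA -IH //; [|by lia|]; last first.
  move: di; rewrite wdes_pv => di.
  by case: (@sfill_lt n i w j j.+1 sp aj) => //; lia.
rewrite -sfill_rfill; apply: tbar_des; first exact: signed_perm_rfill.
(* Each exception of [sig_lt] is absurd: the first two contradict the ascent at [j], the third gives
   [i = -(i + 1)]. *)
move: di; rewrite !wdes_pv !pv_rfill // => di; apply: sig_lt => // -[e1 e2].
- by move: aj; rewrite -e1 -e2 !pvK // ltz_nat; lia.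
- have e3 : pv w (- i.+1%:Z) = j.+1 by rewrite pvN e1 opprK.
  have e4 : pv w (- i%:Z) = j by rewrite pvN e2 opprK.
  by move: aj; rewrite -e3 -e4 !pvK //; lia.
- have := can_inj (pvK sp) (x1 := i) (x2 := - i.+1%:Z).
  by rewrite pvN e1 e2 => /(_ erefl); lia.
Qed.

End WordProducts.

(** * The induced module *)

(** A certificate that [V] is the line spanned by [v0], with [phi] reading off the coefficient and
    [F] acting through the scalars of [A]. *)
Record coordinate (F : fieldType) (A : algType F) (V : lmodType A) (v0 : V)
    (phi : V -> F) : Prop := Coordinate {
  coordB : forall u v, phi (u - v) = phi u - phi v;
  coordZ : forall (c : F) v, phi ((c%:A : A) *: v) = c * phi v;
  coord1 : phi v0 = 1;
  coordE : forall v, v = ((phi v)%:A : A) *: v0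
}.

Section CoordinateTheory.
Variables (F : fieldType) (A : algType F) (V : lmodType A) (v0 : V) (phi : V -> F).
Hypothesis hphi : coordinate v0 phi.

Lemma coord0 : phi 0 = 0.
Proof. by rewrite -(subrr v0) (coordB hphi) subrr. Qed.

Lemma coordD u v : phi (u + v) = phi u + phi v.
Proof. by rewrite -{1}[v]opprK (coordB hphi) -[- v]sub0r (coordB hphi) coord0 sub0r opprK. Qed.

End CoordinateTheory.

Section OuterCoordinate.
Variables (F : fieldType) (A1 A2 : algType F).
Variables (V : lmodType A1) (v0 : V) (phi : V -> F).
Variables (W : lmodType A2) (w0 : W) (psi : W -> F).
Hypotheses (hphi : coordinate v0 phi) (hpsi : coordinate w0 psi).

Let f (x : V) (y : W) : F := phi x * psi y.

Let fDl x x' y : f (x + x') y = f x y + f x' y.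
Proof. by rewrite /f (coordD hphi) mulrDl. Qed.

Let fDr x y y' : f x (y + y') = f x y + f x y'.
Proof. by rewrite /f (coordD hpsi) mulrDr. Qed.

Let f_bal x (c : F) y : f ((c%:A : A1) *: x) y = f x ((c%:A : A2) *: y).
Proof. by rewrite /f (coordZ hphi) (coordZ hpsi) mulrCA mulrA. Qed.

Definition ocoord (t : otensor V W) : F := tlift f t.

Lemma ocoord_pure x y : ocoord (opure x y) = phi x * psi y.
Proof. exact: (tlift_pure fDl fDr f_bal). Qed.

Lemma ocoordB s t : ocoord (s - t) = ocoord s - ocoord t.
Proof. exact: (tliftB fDl fDr f_bal). Qed.

Lemma ocoordZ (c : F) t : ocoord (actl c%:A t) = c * ocoord t.
Proof.
elim/tensor_ind: t => [x y|s t es et].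
  by rewrite -[pure _ _ _ _]/(opure x y) actl_pure !ocoord_pure (coordZ hphi) mulrA.
by rewrite actlB !ocoordB es et mulrBr.
Qed.

Lemma ocoord1 : ocoord (opure v0 w0) = 1.
Proof. by rewrite ocoord_pure (coord1 hphi) (coord1 hpsi) mulr1. Qed.

Lemma ocoordE t : t = actl (ocoord t)%:A (opure v0 w0).
Proof.
elim/tensor_ind: t => [x y|s t es et].
  rewrite -[pure _ _ _ _]/(opure x y) ocoord_pure actl_pure.
  rewrite {1}(coordE hphi x) {1}(coordE hpsi y) -opureZ.
  have -> : ((phi x * psi y)%:A : A1) = (psi y)%:A * (phi x)%:A.
    by rewrite mulr_algl scalerA mulrC.
  by rewrite scalerA.
rewrite ocoordB -[RHS]/((ocoord s - ocoord t) *: opure v0 w0) scalerBl.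
exact: (congr2 (fun x y => x - y) es et).
Qed.

End OuterCoordinate.

(** * The inner tensor product as a fixed line *)

Section FixedLines.
Variable F : fieldType.

Definition fixed_line k (D : seq nat) (V : lmodType (HeckeB F k)) : Prop :=
  exists v0 phi, coordinate v0 phi /\
    forall i : 'I_k, val i \notin D -> pi_B F i *: v0 = v0 :> V.

Lemma hmod_coordinate (I : choiceType) (cox : I -> I -> nat) (r : hrep F cox)
    (v0 : hr_space r) (phi : hr_space r -> F) :
  (forall u v, phi (u - v) = phi u - phi v) ->
  (forall c v, phi (c *: v) = c * phi v) -> phi v0 = 1 ->
  (forall v, v = phi v *: v0) -> coordinate (v0 : hmod r) phi.
Proof.
move=> pB pZ p1 pE; split=> [u v|c v||v]; [exact: pB| |exact: p1|].
  by rewrite hmod_scalarE pZ.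
by rewrite hmod_scalarE -pE.
Qed.

Definition PA_one m : PA F m := (1 : F^o).
Definition PA_coord m (v : PA F m) : F := v.

Lemma PA_coordinate m : coordinate (PA_one m) (@PA_coord m).
Proof.
apply: (@hmod_coordinate _ _ (PA_rep F m) (1 : F^o) id) => // v.
by rewrite [RHS]mulr1.
Qed.

(** [pi_k] acts by 0 on [outer], so [k] joins the exceptions; every other generator acts on a single
    factor. *)
Lemma fixed_line_outer k m D (V : lmodType (HeckeB F k)) :
  fixed_line D V -> fixed_line (k :: D) (outer V (PA F m)).
Proof.
case=> v0 [phi [hphi v0D]]; have hpsi := @PA_coordinate m.
exists (opure v0 (PA_one m)), (ocoord phi (@PA_coord m)).
split.
  apply: (@hmod_coordinate _ _ (outer_rep V (PA F m))).
  - exact: ocoordB hphi hpsi.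
  - exact: ocoordZ hphi hpsi.
  - exact: ocoord1 hphi hpsi.
  - exact: ocoordE hphi hpsi.
move=> i; rewrite inE negb_or => /andP[ik iD].
case: (splitP i) => [j ej|j ej].
  have -> : i = lshift m j by apply: val_inj.
  by rewrite [LHS]outer_l v0D //; move: iD; rewrite /= ej.
have j0 : (0 < j)%N by move: ik; rewrite /= ej; case: (j : nat) => //; rewrite addn0 eqxx.
(* Type A generators are indexed from 0, whence the shift by one. *)
have hj : (j.-1 < m.-1)%N by have := ltn_ord j; lia.
have -> : i = rshift k j by apply: val_inj.
rewrite [LHS](@outer_r _ _ _ _ _ j (Ordinal hj)); last by rewrite /= prednK.
by rewrite [X in opure _ X](hmod_genE (r := PA_rep F m)).
Qed.

End FixedLines.

Section GeneratorLine.
Variable F : fieldType.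

Lemma pibar_tied n (g : gpribbon n) D (i : 'I_n) (t : tab g) :
  (forall w, standard g w -> asc D w) -> tied D i t -> pibar i (tabvec F t) = 0.
Proof.
move=> h ti; have [nd na] := asc_tied (tab_signed t) (h _ (tabP t)) ti.
rewrite pibar_tab /tabact descentE ?tabP // (negbTE nd) insubN //.
by apply/negP => /h.
Qed.

(** With no cuts there is one block and one coset, so two distinct tableaux would each precede the
    other in [ltf]; the identity is the only tableau. *)
Lemma fixed_line_row k :
  fixed_line [::] (PB F (gpr_ribbon (pcomp1 k))).
Proof.
set g := gpr_ribbon _; have hg w : standard g w -> asc [::] w.
  by case/(standard_ribbon (pcomp1 k)).
have blk_nil z : blk [::] z = 0 by case: z.
have uni (s t : tab g) : s = t.
  apply: val_inj; apply/eqP; apply: contraT => ne.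
  have c (x y : filling k) : same_coset [::] x y by apply/same_cosetP => v; rewrite !blk_nil.
  have lt := coset_ltf (tab_signed s) (tab_signed t) (hg _ (tabP t)) (c _ _) ne.
  rewrite eq_sym in ne.
  have := coset_ltf (tab_signed t) (tab_signed s) (hg _ (tabP s)) (c _ _) ne.
  by move/(ltf_trans lt); rewrite ltf_irr.
have sid : standard g (idfill k).
  apply/(standard_ribbon (pcomp1 k)); split=> //; first exact: signed_perm_id.
  by move=> j _; rewrite !ev_id ltz_nat.
pose t0 := Tab sid; exists (tabvec F t0 : tabspace F g), (fun v : tabspace F g => v t0).
split; last first.
  move=> i _; rewrite [LHS]PB_genE (pibar_tied hg) ?add0r //.
  by rewrite /tied !blk_nil.
apply: (@hmod_coordinate _ _ _ (PB_rep F g)) => [u v|c v||v]; rewrite ?ffunE ?eqxx //.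
by rewrite [LHS]tabspaceE (bigD1 t0) //= big1 ?addr0 // => t /eqP []; exact: uni.
Qed.

(** Follows the recursion of [outer_prod]; [mem_cuts] identifies the result with the descent set. *)
Fixpoint cuts (D : seq nat) k s :=
  if s is m :: s' then cuts (k :: D) (k + m)%N s' else D.

Lemma mem_cuts D k s x : (x \in cuts D k s) = (x \in D) || (x \in descset (k :: s)).
Proof.
elim: s D k => [|m s IH] D k /=; first by rewrite orbF.
by rewrite IH inE descset_cons descset_add inE -orbA orbCA.
Qed.

Lemma fixed_line_prod k D (V : lmodType (HeckeB F k)) s :
  fixed_line D V -> fixed_line (cuts D k s) (outer_prod V s).
Proof. by elim: s k D V => //= m s IH k D V h; apply/IH/fixed_line_outer. Qed.

Lemma fixed_line_ecast k n (e : k = n) D (V : lmodType (HeckeB F k)) :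
  fixed_line D V -> fixed_line D (ecast k (lmodType (HeckeB F k)) e V).
Proof. by case: n / e. Qed.

Lemma fixed_line_outer_full n (a : pscomp n) :
  fixed_line (descset a) (outer_full F a).
Proof.
apply: fixed_line_ecast; rewrite {1}(pscomp_cons a).
have [v0 [phi [hphi hv]]] := fixed_line_prod (pc_tail a) (fixed_line_row (pc_head a)).
exists v0, phi; split=> // i iD; apply: hv; rewrite mem_cuts.
exact: iD.
Qed.

End GeneratorLine.

Lemma pureNl (R : Type) (M N : zmodType) (ra : M -> R -> M) (la : R -> N -> N) x y :
  pure ra la (- x) y = - pure ra la x y.
Proof. by apply: (addrI (pure ra la x y)); rewrite -pureDl !subrr pure0l. Qed.

Lemma scalar_comm (F : fieldType) (A : algType F) (W : lmodType A) (c : F) (x : A) (w : W) :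
  (c%:A : A) *: (x *: w) = x *: ((c%:A : A) *: w).
Proof. by rewrite !scalerA mulr_algl mulr_algr. Qed.

Lemma scalar_scale (F : fieldType) (A : algType F) (W : lmodType A) (c : F) (x : A) (w : W) :
  (c *: x) *: w = (c%:A : A) *: (x *: w).
Proof. by rewrite scalerA mulr_algl. Qed.

Section InducedMap.
Variables (F : fieldType) (A : algType F) (S : A -> Prop).
Variables (V : lmodType A) (v0 : V) (phi : V -> F) (W : lmodType A) (e : W).
Hypothesis hphi : coordinate v0 phi.
Hypothesis v0_fixed : forall x, S x -> x *: v0 = v0.
Hypothesis e_fixed : forall x, S x -> x *: e = e.

Local Notation B := (gensub S).
Local Notation incl := (gensub_incl S).
Local Notation ind := (induced incl (restricted incl V)).

(** Generators fix both [v0] and [e], so an element of the subalgebra acts by the same scalar on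
    both lines. This makes [ind_map] balanced. *)
Lemma parabolic_fixed (b : B) (v : V) :
  incl b *: (((phi v)%:A : A) *: e) = ((phi (incl b *: v))%:A : A) *: e.
Proof.
case: b => x hx; have /gensub_predP gx := hx.
change (x *: (((phi v)%:A : A) *: e) = ((phi (x *: v))%:A : A) *: e).
elim: gx v => {x hx} [x Sx v|v|c x y _ IHx _ IHy v|x y _ IHx _ IHy v].
- have pv : x *: v = v.
    by rewrite {1}(coordE hphi v) -(scalar_comm _ _ v0) v0_fixed // -(coordE hphi).
  by rewrite -(scalar_comm _ _ e) e_fixed // pv.
- by rewrite !scale1r.
- rewrite [LHS]scalerDl (scalar_scale c x) IHx IHy.
  rewrite (scalerDl v (c *: x)) (coordD hphi) (scalar_scale c x v) (coordZ hphi).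
  by rewrite !scalerDl scalerA mulr_algl scalerA.
- by rewrite -!scalerA IHy IHx.
Qed.

Definition ind_map (t : ind) : W :=
  tlift (fun (h : A) (v : restricted incl V) => h *: (((phi v)%:A : A) *: e)) t.

Lemma ind_map_Dl (x x' : A) (v : V) :
  (x + x') *: (((phi v)%:A : A) *: e)
  = x *: (((phi v)%:A : A) *: e) + x' *: (((phi v)%:A : A) *: e).
Proof. exact: scalerDl. Qed.

Lemma ind_map_Dr (x : A) (v v' : V) :
  x *: (((phi (v + v'))%:A : A) *: e)
  = x *: (((phi v)%:A : A) *: e) + x *: (((phi v')%:A : A) *: e).
Proof. by rewrite (coordD hphi) !scalerDl scalerDr. Qed.

Lemma ind_map_bal (x : A) (b : B) (v : V) :
  (x * incl b) *: (((phi v)%:A : A) *: e)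
  = x *: (((phi (incl b *: v))%:A : A) *: e).
Proof. by rewrite -scalerA parabolic_fixed. Qed.

Lemma ind_map_pure x v :
  ind_map (ipure incl x (v : restricted incl V)) = x *: (((phi v)%:A : A) *: e).
Proof. exact: (tlift_pure ind_map_Dl ind_map_Dr ind_map_bal). Qed.

Lemma ind_mapB s t : ind_map (s - t) = ind_map s - ind_map t.
Proof. exact: (tliftB ind_map_Dl ind_map_Dr ind_map_bal). Qed.

(* g is inverse to ind_map. *)
Lemma induced_iso (g : W -> ind) : linear g -> g e = ipure incl 1 (v0 : restricted incl V) ->
  (forall u, exists h, u = h *: e) -> mod_iso W ind.
Proof.
move=> lg ge cyc; apply: (mod_iso_bij lg).
have gB u u' : g (u - u') = g u - g u'.
  by rewrite (addrC u) -scaleN1r lg scaleN1r; exact: addrC.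
have gZ h u : g (h *: u) = h *: g u.
  have g0 : g 0 = 0 by rewrite -(subrr 0) gB subrr.
  by rewrite -[h *: u]addr0 lg g0 [LHS]addr0.
have iZ h x (v : restricted incl V) : h *: ipure incl x v = ipure incl (h * x) v.
  exact: iscale_pure.
exists ind_map => [u|t].
  have [h ->] := cyc u; rewrite gZ ge iZ mulr1 ind_map_pure.
  by rewrite (coord1 hphi) !scale1r.
elim/tensor_ind: t => [x v|s t es et]; last by rewrite ind_mapB gB es et.
rewrite -[pure _ _ _ _]/(ipure incl x (v : restricted incl V)) ind_map_pure.
rewrite !gZ ge !iZ mulr1.
(* Seen in the subalgebra, the scalar crosses the tensor sign and turns [v0] back into [v]. *)
have -> : (phi v)%:A = incl ((phi v)%:A : B) by [].
rewrite [LHS](@pure_bal B A (restricted incl V)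
  (fun x b => x * incl b) (fun b v => b *: v)).
congr ipure; exact: esym (coordE hphi v).
Qed.

End InducedMap.

Section LinearExtension.
Variables (F : fieldType) (n : nat) (g : gpribbon n).
Variables (A : algType F) (W : lmodType A) (b : tab g -> W).
Implicit Types u v : tabspace F g.

Definition tab_extend u : W := \sum_(x : tab g) ((u x : F)%:A : A) *: b x.

Lemma tab_extendD u v : tab_extend (u + v) = tab_extend u + tab_extend v.
Proof. by rewrite -big_split; apply: eq_bigr => x _; rewrite ffunE !scalerDl. Qed.

Lemma tab_extendZ (c : F) u : tab_extend (c *: u) = (c%:A : A) *: tab_extend u.
Proof.
rewrite scaler_sumr; apply: eq_bigr => x _; rewrite ffunE.
by rewrite scalerA mulr_algl scalerA.
Qed.

Lemma tab_extend0 : tab_extend 0 = 0.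
Proof. by rewrite /tab_extend big1 // => x _; rewrite ffunE !scale0r. Qed.

Lemma tab_extendN u : tab_extend (- u) = - tab_extend u.
Proof. by apply: (addrI (tab_extend u)); rewrite -tab_extendD !subrr tab_extend0. Qed.

Lemma tab_extend_sum (T : finType) (c : T -> F) (E : T -> tabspace F g) :
  tab_extend (\sum_t c t *: E t) = \sum_t ((c t)%:A : A) *: tab_extend (E t).
Proof.
elim: (index_enum T) => [|t r IH]; first by rewrite !big_nil tab_extend0.
by rewrite !big_cons tab_extendD tab_extendZ IH.
Qed.

Lemma tab_extend_vec t : tab_extend (tabvec F t) = b t.
Proof.
rewrite /tab_extend (bigD1 t) //= big1 ?addr0 => [|x ne].
  by rewrite ffunE eqxx !scale1r.
by rewrite ffunE (negbTE ne) !scale0r.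
Qed.

Lemma tab_extend_tabact i t : tab_extend (tabact F i t) =
  if wdes i t then - b t else if insub (sfill i t) is Some t' then b t' else 0.
Proof.
rewrite /tabact descentE ?tabP //; case: ifP => _.
  by rewrite tab_extendN tab_extend_vec.
by case: (insub _) => [t'|]; rewrite ?tab_extend_vec ?tab_extend0.
Qed.

Lemma tab_extend_pibar (p : 'I_n -> A) i u :
  (forall t, p i *: b t = tab_extend (tabact F i t)) ->
  tab_extend (pibar i u) = p i *: tab_extend u.
Proof.
move=> h; rewrite tab_extend_sum scaler_sumr; apply: eq_bigr => t _.
by rewrite -h scalar_comm.
Qed.

End LinearExtension.

(** * The isomorphism with the induced module *)

Section Induced.
Variables (F : fieldType) (n : nat) (a : pscomp n).
Variables (V : lmodType (HeckeB F n)) (v0 : V) (phi : V -> F).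
Hypothesis hphi : coordinate v0 phi.
Hypothesis v0_fixed : forall i : 'I_n, val i \notin descset a -> pi_B F i *: v0 = v0.

Let D := descset a.
Local Notation H := (HeckeB F n).
Local Notation M := (tabspace F (gpr_rows a)).
Local Notation incl := (parabolic_incl F a).
Local Notation ind := (induced incl (restricted incl V)).

Definition pibar_B (i : 'I_n) : H := pi_B F i - 1.

Lemma pibar_B_sq i : pibar_B i * pibar_B i = - pibar_B i.
Proof. by apply: bar_sq; exact: hgen_idem. Qed.

Lemma pibar_B_braid i j : i != j -> altprod (coxB i j) (pibar_B i) (pibar_B j)
  = altprod (coxB i j) (pibar_B j) (pibar_B i).
Proof.
move=> ne; apply: bar_braid; [exact: hgen_idem|exact: hgen_idem| |exact: hgen_braid].
by rewrite /coxB; do 2?case: ifP.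
Qed.

Local Notation tb := (tbar pibar_B).

Lemma standard_id : standard (gpr_rows a) (idfill n).
Proof.
apply/standard_rows; split=> [|k _]; first exact: signed_perm_id.
by rewrite !ev_id ltz_nat.
Qed.

Definition idtab : tab (gpr_rows a) := Tab standard_id.
Definition idvec : MB F a := tabvec F idtab.

Lemma rows_down i w : standard (gpr_rows a) w -> wdes i w ->
  standard (gpr_rows a) (sfill i w).
Proof.
move=> /standard_rows[sp h] d; apply/standard_rows.
by split; [exact: signed_perm_sfill|exact: asc_down].
Qed.

(** By [rows_down], everything met while removing left descents from [x] is standard, so rebuilding
    [x] from the identity never meets a zero. *)
Lemma tbar_idvec (x : tab (gpr_rows a)) : tb x *: idvec = tabvec F x :> M.
Proof.
have [m] := ubnP (wlen x); elim: m x => // m IH x lem.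
have sx := tab_signed x.
case: (pickP (fun i => wdes i x)) => [i d|nd]; last first.
  have -> : x = idtab by apply/val_inj/wdes_none => // i; rewrite nd.
  by rewrite tbar_id scale1r.
have st := rows_down (tabP x) d.
rewrite (tbar_des pibar_B_braid sx d) -scalerA.
have /= -> := IH (Tab st); last by have := wlen_sfill sx d; rewrite /=; lia.
rewrite [LHS]PB_pibar pibar_tab /tabact descentE ?tabP //=.
rewrite wdes_sfill // d /= sfillK insubT; first exact: tabP.
by move=> h; congr tabvec; apply: val_inj.
Qed.

Lemma idvec_fixed (i : 'I_n) : val i \notin D -> pi_B F i *: idvec = idvec.
Proof.
move=> iD; rewrite [LHS]PB_genE (@pibar_tied _ _ _ D) ?add0r //.
  by move=> w /standard_rows[].
by rewrite /tied !pv_id /= blkS (count_memPn iD) addr0.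
Qed.

Lemma ipureZ (h x : H) (v : restricted incl V) :
  h *: ipure incl x v = ipure incl (h * x) v.
Proof. exact: iscale_pure. Qed.

Lemma ipure_bal (x : H) (b : parabolic F a) (v : restricted incl V) :
  ipure incl (x * incl b) v = ipure incl x (b *: v).
Proof. exact: pure_bal. Qed.

Definition std_elt (w : filling n) : ind := ipure incl (tb w) (v0 : restricted incl V).

Lemma pibar_std_elt i w : standard (gpr_rows a) w ->
  pibar_B i *: std_elt w = if wdes i w then - std_elt w
    else if standard (gpr_rows a) (sfill i w) then std_elt (sfill i w) else 0.
Proof.
move=> sw; have /standard_rows[sp h] := sw; rewrite [LHS]ipureZ.
case: ifP => [d|/negbT d].
  rewrite /std_elt (tbar_des pibar_B_braid sp d) mulrA pibar_B_sq mulNr.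
  exact: pureNl.
rewrite (tbar_asc pibar_B_braid sp d); case: ifP => [//|/negP ns].
have sp' := signed_perm_sfill i sp.
(* Standardness fails at some [k] outside [D], where [w] ascends. An ascent reversed by [s_i] is one
   whose values [s_i] exchanges, whence [s_i w = w s_k]. *)
have [k kD nk] : exists2 k : 'I_n, val k \notin D & ~~ (ev (sfill i w) k < ev (sfill i w) k.+1).
  case: (boolP [exists k : 'I_n, (val k \notin D) && ~~ (ev (sfill i w) k < ev (sfill i w) k.+1)]).
    by case/existsP => k /andP[]; exists k.
  rewrite negb_exists => /forallP hk; case: ns; apply/standard_rows; split=> //.
  apply: asc_ord => k kD; apply/negPn/negP => nk.
  by have := hk k; rewrite kD nk.
have -> : sfill i w = rfill k w.
  apply: sfill_eq_rfill => //.
  have := @sfill_lt n i w k k.+1 sp (h k kD); case=> [|[]||lt]; [lia|by left|by right|].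
  by rewrite lt in nk.
rewrite (tbar_rfill pibar_B_braid sp (h k kD)).
have gk : pi_B F k \in gensub_pred (fun x : H =>
    exists2 i : 'I_n, val i \notin descset a & x = pi_B F i).
  by apply/gensub_predP/in_gensub_gen; exists k.
(* [pi_k - 1] lies in the parabolic subalgebra, so it crosses the tensor sign, and it kills [v0]. *)
pose pk : parabolic F a := GenSub gk - 1.
have -> : pibar_B k = incl pk by rewrite rmorphB rmorph1.
rewrite ipure_bal.
have -> : pk *: (v0 : restricted incl V) = 0; last exact: pure0r.
rewrite -[LHS]/(incl pk *: (v0 : V)) rmorphB rmorph1 scalerBl scale1r.
by rewrite v0_fixed // subrr.
Qed.

Definition MB_to_ind : MB F a -> ind :=
  tab_extend (fun x : tab (gpr_rows a) => std_elt x).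

Lemma MB_to_ind_linear : linear MB_to_ind.
Proof.
apply: hecke_linear => [u v|c u|i u].
- exact: tab_extendD.
- by rewrite PB_scalarE; exact: tab_extendZ.
rewrite PB_genE [LHS]tab_extendD (@tab_extend_pibar _ _ _ _ _ _ pibar_B i) => [|t].
  by rewrite scalerBl scale1r; exact: subrK.
rewrite tab_extend_tabact pibar_std_elt; last exact: tabP.
case: ifP => [_|_]; first exact: erefl.
case: insubP => [t' -> ->|/negbTE ->]; exact: erefl.
Qed.

Local Notation S := (fun x : H => exists2 i : 'I_n, val i \notin descset a & x = pi_B F i).

Lemma MB_iso_induced : mod_iso (MB F a) ind.
Proof.
have vS x : S x -> x *: v0 = v0 by case=> i iD ->; exact: v0_fixed.
have eS x : S x -> x *: idvec = idvec by case=> i iD ->; exact: idvec_fixed.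
apply: (induced_iso hphi vS eS MB_to_ind_linear) => [|u].
  by rewrite /idvec [LHS]tab_extend_vec /std_elt tbar_id.
(* [tbar_idvec] yields every tableau from the identity, so the coefficients of [u] give the
   witness. *)
exists (\sum_(x : tab (gpr_rows a)) ((u : M) x : F) *: tb x).
rewrite scaler_suml [LHS]tabspaceE; apply: eq_bigr => x _.
rewrite [RHS]scalar_scale tbar_idvec; exact: esym (PB_scalarE _ _).
Qed.

End Induced.

Theorem corollary3p7 (F : fieldType) (n : nat) (alpha : pscomp n) :
  mod_iso (MB F alpha) (ind_comp F alpha) /\
  mod_iso (ind_comp F alpha)
    (dsum (fun beta : {b : pscomp n | pc_le b alpha} => PB_comp F (val beta))).
Proof.
have [v0 [phi [hphi v0_fixed]]] := fixed_line_outer_full F alpha.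
have MI : mod_iso (MB F alpha) (ind_comp F alpha) := MB_iso_induced hphi v0_fixed.
split=> //; apply: (mod_iso_trans (mod_iso_sym MI)); exact: MB_iso_ribbons.
Qed.
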